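(* Assume that $p_n\to0$ and: (1) $(X_{n,i})_{1\le i\le n}$ is stationary for all $n$, and $s_n,r_n\in\mathbb N$ satisfy $s_n=o(r_n)$, $r_n=o(n)$. (2) For all $n\in\mathbb N$ and $1\le i\le m_n$, $V_{n,i}$ and $\tilde V_{n,i}$ are real-valued processes indexed by $\mathcal G$ that are measurable w.r.t. $(X_{n,(i-1)r_n+1},\dots,X_{n,ir_n+s_n-1})$, and $(V_{n,i},\tilde V_{n,i})_{1\le i\le m_n}$ is stationary. (3) $m_n\beta^{\tilde V}_{n,0}\to0$. (4) $m_n\beta^X_{n,(k-1)r_n-s_n}\to0$ for some $k\in\mathbb N$, $k\ge2$. (5) $\Delta_n:=V_n-\tilde V_n$ satisfies, for all $g\in\mathcal G$, $$E\Big[(\Delta_n(g)-E\Delta_n(g))^2\mathbf 1_{\{|\Delta_n(g)-E\Delta_n(g)|\le\sqrt{p_n}\}}\Big]=o(p_n/m_n),\qquad P\big\{|\Delta_n(g)-E\Delta_n(g)|>\sqrt{p_n}\big\}=o(1/m_n).$$ (6) For all $g\in\mathcal G$ and $\epsilon>0$, $E\big[(V_n(g)-EV_n(g))^2\mathbf 1_{\{|V_n(g)-EV_n(g)|>\epsilon\sqrt{p_n}\}}\big]=o(p_n/m_n)$. (7) The processes $(V_n(g))_{g\in\mathcal G}$, $n\in\mathbb N$, are separable. (8) There exists $c:\mathcal G^2\to\mathbb R$ such that $\frac{m_n}{p_n}\mathrm{Cov}(V_n(g),V_n(h))\to c(g,h)$ for all $g,h\in\mathcal G$. Then the finite dimensional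 marginal distributions of the empirical process $(Z_n(g))_{g\in\mathcal G}$, $$Z_n(g):=\frac1{\sqrt{p_n}}\sum_{i=1}^{m_n}\big(V_{n,i}(g)-E[V_{n,i}(g)]\big),$$ converge weakly to those of a (centered) Gaussian process with covariance function $c$.
   Context: All limits and $o$ are for $n\to\infty$. $(E,\|\cdot\|)$ is a complete normed vector space, $(X_{n,i})_{1\le i\le n,\,n\in\mathbb N}$ is a triangular array of row-wise stationary $E$-valued random variables, $s_n,r_n\in\mathbb N$, $m_n:=\lfloor(n-s_n+1)/r_n\rfloor$, and $\mathcal G$ is an index set. $(V_n,\tilde V_n)$ denotes a generic pair with the same distribution as $(V_{n,1},\tilde V_{n,1})$, and $p_n:=P\{\exists g\in\mathcal G:V_n(g)\ne0\}$. Mixing coefficients: $\beta^X_{n,k}:=\sup_{1\le l\le n-k-1}E\big[\sup_{B\in\mathcal B_{n,l+k+1}^n}|P(B\mid\mathcal B_{n,1}^l)-P(B)|\big]$, where $\mathcal B_{n,i}^j$ is the $\sigma$-field generated by $(X_{n,l})_{i\le l\le j}$. $\beta^{\tilde V}_{n,0}$ is the analogous coefficient (with gap $k=0$) of the sequence $(\tilde V_{n,i})_{1\le i\le m_n}$, i.e. $\beta^{\tilde V}_{n,0}=\sup_{1\le l\le m_n-1}E\big[\sup_{B\in\sigma(\tilde V_{n,i},\,l+1\le i\le m_n)}|P(B\mid\sigma(\tilde V_{n,i},\,1\le i\le l))-P(B)|\big]$. Separability is meant in the usual sense of the theory of stochastic processes; it holds in particular if $\mathcal G$ is finite. *)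

(* Defs.v *)
From HB Require Import structures.
From mathcomp Require Import all_boot all_order all_algebra.
From mathcomp Require Import all_classical all_reals all_analysis measurable_realfun.
Set Implicit Arguments.
Unset Strict Implicit.
Unset Printing Implicit Defensive.
Import Order.TTheory GRing.Theory Num.Theory.
Import numFieldNormedType.Exports.
Local Open Scope classical_set_scope.
Local Open Scope ring_scope.
Local Open Scope ereal_scope.

Definition borel (E : ptopologicalType) := g_sigma_algebraType (@open E).

(* The sigma-field on Omega generated by the maps Y i, i in D. *)
Definition sigma_gen (I Omega : Type) d (S : measurableType d)
    (D : set I) (Y : I -> Omega -> S) : set (set Omega) :=
  <<s \bigcup_(i in D) preimage_set_system setT (Y i) measurable >>.

(* The product sigma-field on I -> S, for an arbitrary index set I. *)
Definition cylinder_sigma (I : Type) d (S : measurableType d) :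
    set (set (I -> S)) :=
  sigma_gen setT (fun (i : I) (f : I -> S) => f i).

Section probability_space.
Context d (T : measurableType d) (R : realType) (P : probability T R).

Definition same_law (I : Type) d' (S : measurableType d')
    (Y Y' : I -> T -> S) : Prop :=
  forall B : set (I -> S), cylinder_sigma B ->
    P [set w | B (fun i => Y i w)] = P [set w | B (fun i => Y' i w)].

(* Stationarity of Y 1, ..., Y N, where each Y i is a random element of
   J -> S with the product sigma-field. *)
Definition stationary_row (J : Type) d' (S : measurableType d')
    (N : nat) (Y : nat -> J -> T -> S) : Prop :=
  forall h k : nat, (h + k <= N)%N ->
    same_law (fun (x : 'I_k * J) => Y x.1.+1 x.2)
             (fun (x : 'I_k * J) => Y (h + x.1).+1 x.2).

(* f is a version of the conditional probability P(B | F). *)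
Definition is_cond_prob (F : set (set T)) (B : set T) (f : T -> R) : Prop :=
  [/\ forall U : set R, measurable U -> F (f @^-1` U),
      P.-integrable setT (EFin \o f) &
      forall A, F A -> \int[P]_(w in A) (f w)%:E = P (A `&` B)].

(* E[sup_(B in H) |P(B | F) - P(B)|].  Each P(B | F) being defined only up to a
   null set, the supremum over the possibly uncountable family H is the
   essential supremum.  The latter is the a.e. least measurable majorant of the
   family, so that its expectation is the least expectation of a majorant. *)
Definition abs_regularity (F H : set (set T)) : \bar R :=
  ereal_inf [set \int[P]_w h w | h in
    [set h : T -> \bar R | [/\ measurable_fun setT h, forall w, 0 <= h w &
      forall B f, H B -> is_cond_prob F B f ->
        {ae P, forall w, `|f w - fine (P B)|%:E <= h w}]]].

(* The beta-mixing coefficient with gap k of a row of length N, where F i j is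
   the sigma-field generated by the entries i, ..., j.  The supremum ranges
   over 1 <= l <= N - k - 1, and is 0 if there is no such l. *)
Definition beta_mixing (N : nat) (F : nat -> nat -> set (set T)) (k : nat) :
    \bar R :=
  \big[maxe/0]_(1 <= l < N - k) abs_regularity (F 1%N l) (F (l + k).+1 N).

(* Separability in the sense of Doob: almost all paths are determined by their
   restriction to one countable dense set of indices. *)
Definition separable_process (G : topologicalType) (Y : G -> T -> R) : Prop :=
  exists S : set G, [/\ countable S, dense S &
    {ae P, forall w, forall (g : G) (U : set G), open U -> U g ->
       closure [set Y s w | s in S `&` U] (Y g w)}].

(* Probability of an event that need only be measurable for the completion
   of P: on such events the outer measure of P is the completed probability. *)
Definition prob_completed (A : set T) : R := fine (mu_ext P A).

(* The Dirac case is separate because normal_prob m 0 is not degenerate. *)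
Definition centered_gaussian_process (I : Type) (Y : I -> {RV P >-> R})
    (c : I -> I -> R) : Prop :=
  [/\ forall (q : nat) (i : 'I_q -> I) (a : 'I_q -> R),
        exists m s : R, forall A : set R, measurable A ->
          P [set w | A (\sum_(j < q) a j * Y (i j) w)%R] =
          if s == 0%R then \d_m A else normal_prob m s A,
      forall i, 'E_P[Y i] = 0 &
      forall i j, covariance P (Y i) (Y j) = (c i j)%:E].

End probability_space.

(* Weak convergence of the laws of random vectors in R^q. *)
Definition cvg_law (R : realType) d (T : measurableType d)
    (P : probability T R) d' (T' : measurableType d') (Q : probability T' R)
    (q : nat) (Z : nat -> 'I_q -> T -> R) (Y : 'I_q -> T' -> R) : Prop :=
  forall f : 'rV[R]_q -> R, continuous f ->
    (exists M : R, forall x, (`|f x| <= M)%R) ->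
    (fun n => 'E_P[fun w => f (\row_j Z n j w)%R]) @ \oo -->
    'E_Q[fun w => f (\row_j Y j w)%R].

(* Main.v *)
Require Import Defs.
From HB Require Import structures.
From mathcomp Require Import all_boot all_order all_algebra.
From mathcomp Require Import all_classical all_reals all_analysis measurable_realfun.
From mathcomp Require Import ring lra.
Set Implicit Arguments.
Unset Strict Implicit.
Unset Printing Implicit Defensive.
Import Order.TTheory GRing.Theory Num.Theory.
Import numFieldNormedType.Exports.
Local Open Scope classical_set_scope.
Local Open Scope ring_scope.

(** All limits are obtained from characteristic functions, with a real phase
    [th] and only cosines: [E cos (th + t.Z_n)].

    Truncate the scaled difference [p_n^(-1/2) (Delta_n - E Delta_n)] at 1.  By
    the second half of (5) the truncation changes nothing in any of the [m_n]
    blocks, off an event of vanishing probability.  By the first half the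
    centred truncation has second moment [o(1/m_n)].  Blocks whose indices
    agree modulo [k] are separated by [(k-1) r_n - s_n] observations, so that (4)
    factorizes the characteristic function of the sum of the truncations over
    each of the [k] residue classes, and these sums vanish in probability.

    There remain the blocks [tilde V_{n,i}], recentred.  By (3) the
    characteristic function of their sum factorizes into [m_n] equal factors,
    each of which is [1 - t'ct / (2 m_n) + o(1/m_n)] by (6) and (8).

    Factorization uses that the beta coefficient bounds the covariance of
    indicators, hence up to a factor 4 that of functions bounded by 1.
    Levy's continuity theorem is proved through approximation by trigonometric
    polynomials on cubes, and the limiting Gaussian vector is built by
    successive Schur complements. *)

(** * Inequalities for sine and cosine *)

(** The obstacle is that no single family of blocks carries both kinds of information. Condition (3)
    controls the dependence of the tilde V_{n,i} alone, which are only assumed integrable; (6) and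
    (8) control second moments of the V_{n,i}, and neighbouring V_{n,i} may share s_n - 1
    observations. The link is the scaled V_n minus the centred truncated difference: it has the
    second moment of V_n up to o(1/m_n), and it equals the recentred tilde V_n off an event of
    probability o(1/m_n). An error o(1/m_n) per block is what a product of m_n factors tolerates,
    and it is the standard of smallness throughout.

    The differences involve V_{n,i}, so (3) does not factorize their sum; the gap in (4) does, but
    only along every k-th block. For each class sum S it suffices that E (1 - cos S) tends to 0,
    whatever the dependence between the classes.

    The phase makes real cosines sufficient: th = - pi / 2 yields the sine, and the addition formula
    closes the induction on the number of blocks. *)

Section trig_inequalities.
Context {R : realType}.
Implicit Types x y e : R.

Lemma mvt_bound (f df : R -> R) (M x : R) : 0 <= x ->
  (forall y, is_derive y 1 f (df y)) ->
  (forall y, 0 <= y <= x -> `|df y| <= M) -> `|f x - f 0| <= M * x.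
Proof.
move=> x0 fdf dfM.
have [c cx ->] : exists2 c, c \in `[0, x] & f x - f 0 = df c * (x - 0).
  apply: (MVT_segment x0).
  apply: continuous_subspaceT => y; apply: differentiable_continuous.
  by apply/derivable1_diffP; have /@ex_derive := fdf y.
by rewrite subr0 normrM (ger0_norm x0) ler_wpM2r// dfM.
Qed.

Lemma ler_sin_norm x : `|sin x| <= `|x|.
Proof.
wlog x0 : x / 0 <= x => [H|].
  have [|/ltW] := leP 0 x; first exact: H.
  by rewrite -oppr_ge0 => /H; rewrite sinN !normrN.
have := @mvt_bound sin cos 1 x x0 (@is_derive_sin R) (fun y _ => cos_max y).
by rewrite sin0 subr0 mul1r (ger0_norm x0).
Qed.

Lemma oneB_cosE x : 1 - cos x = 2 * sin (x / 2) ^+ 2.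
Proof.
rewrite -[X in cos X](_ : (x / 2) *+ 2 = x); last by rewrite -mulr_natr divfK.
by rewrite cos_mulr2n cos2sin2; ring.
Qed.

Lemma oneB_cos_ge0 x : 0 <= 1 - cos x.
Proof. by rewrite subr_ge0 cos_le1. Qed.

Lemma oneB_cos_le x : 1 - cos x <= x ^+ 2 / 2.
Proof.
rewrite oneB_cosE.
have : sin (x / 2) ^+ 2 <= (x / 2) ^+ 2.
  by rewrite -ler_sqrt ?sqr_ge0// !sqrtr_sqr ler_sin_norm.
have -> : x ^+ 2 / 2 = 2 * (x / 2) ^+ 2 by field.
lra.
Qed.

Lemma sin_sub_id_le x : `|sin x - x| <= `|x| ^+ 3 / 2.
Proof.
wlog x0 : x / 0 <= x => [H|].
  have [|/ltW] := leP 0 x; first exact: H.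
  by rewrite -oppr_ge0 => /H; rewrite sinN -opprD !normrN.
have h y : is_derive y 1 (fun y => sin y - y) (cos y - 1).
  by apply: is_deriveB; exact: is_derive_sin.
have := @mvt_bound _ _ (x ^+ 2 / 2) x x0 h.
rewrite sin0 !subr0 (ger0_norm x0) => /(_ _)/le_trans; apply.
  move=> y /andP[y0 yx]; rewrite distrC ger0_norm ?oneB_cos_ge0//.
  apply: (le_trans (oneB_cos_le y)); rewrite ler_pM2r ?invr_gt0//.
  by rewrite lerXn2r// nnegrE (le_trans y0).
by rewrite le_eqVlt; apply/orP; left; apply/eqP; field.
Qed.

Lemma cos_taylor2_le x : `|cos x - (1 - x ^+ 2 / 2)| <= x ^+ 4 / 2.
Proof.
wlog x0 : x / 0 <= x => [H|].
  have [|/ltW] := leP 0 x; first exact: H.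
  rewrite -oppr_ge0 => /H; rewrite cosN sqrrN.
  by rewrite (_ : (- x) ^+ 4 = x ^+ 4)//; ring.
have h y : is_derive y 1 (fun y : R => cos y - (1 - y ^+ 2 / 2)) (- sin y + y).
  rewrite [X in is_derive _ _ _ X](_ : _ = - sin y - (0 - y)); last by ring.
  apply: is_deriveB; apply: is_deriveB.
  have -> : (fun t : R => t ^+ 2 / 2) = (2^-1 \*: (fun t : R => t ^+ 2)).
    by apply/funext => t; rewrite /= mulrC.
  rewrite [X in is_derive _ _ _ X](_ : y = 2^-1 *: (2 * y)); last first.
    by rewrite /GRing.scale/= mulKf.
  apply: is_deriveZ; apply: is_derive_eq.
  by rewrite /GRing.scale/= mulr1 mulr_natl.
have := @mvt_bound _ _ (x ^+ 3 / 2) x x0 h.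
rewrite cos0 expr0n/= mul0r subr0 subrr subr0 => /(_ _)/le_trans; apply.
  move=> y /andP[y0 yx]; rewrite -normrN opprD opprK.
  apply: (le_trans (sin_sub_id_le y)); rewrite ler_pM2r ?invr_gt0//.
  by rewrite (ger0_norm y0) lerXn2r// nnegrE (le_trans y0).
by rewrite le_eqVlt; apply/orP; left; apply/eqP; field.
Qed.

(** For [|x| <= e] the cubic error is at most [e * x ^+ 2]; beyond [e] the trivial bound [2 * |x|]
    is at most [2 / e * x ^+ 2]. The second term is what a Lindeberg condition makes negligible,
    after which [e] may tend to 0. *)
Lemma sin_lindeberg e x : 0 < e <= 1 ->
  `|sin x - x| <= e * x ^+ 2 + (2 / e) * (x ^+ 2 * (e < `|x|)%R%:R).
Proof.
move=> /andP[e0 e1]; have [xe|xe] := leP `|x| e; rewrite ?mulr0 ?addr0 ?mulr1.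
  apply: (le_trans (sin_sub_id_le x)).
  have n0 : 0 <= `|x| ^+ 2 by rewrite exprn_ge0.
  have -> : x ^+ 2 = `|x| ^+ 2 by rewrite -normrX ger0_norm// sqr_ge0.
  rewrite -mulrA mulrC exprSr.
  have := ler_wpM2l n0 xe; nra.
apply: (@le_trans _ _ (2 / e * x ^+ 2)); last first.
  by rewrite lerDr mulr_ge0 ?ltW// exprn_even_gt0//= -normr_gt0 (lt_trans e0).
apply: (le_trans (ler_normB _ _)); apply: (@le_trans _ _ (2 * `|x|)).
  by have := ler_sin_norm x; lra.
rewrite -mulrA ler_pM2l// mulrC ler_pdivlMr//.
have -> : x ^+ 2 = `|x| * `|x| by rewrite -expr2 -normrX ger0_norm// sqr_ge0.
by rewrite ler_wpM2l// ltW.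
Qed.

Lemma cos_lindeberg e x : 0 < e <= 1 ->
  `|cos x - (1 - x ^+ 2 / 2)| <= e * x ^+ 2 + x ^+ 2 * (e < `|x|)%R%:R.
Proof.
move=> /andP[e0 e1]; have x20 := sqr_ge0 x.
have [xe|xe] := leP `|x| e; rewrite ?mulr0 ?addr0 ?mulr1.
  apply: (le_trans (cos_taylor2_le x)).
  have : x ^+ 2 <= e.
    rewrite -(ger0_norm x20) normrX expr2.
    have := normr_ge0 x; nra.
  rewrite (_ : x ^+ 4 = x ^+ 2 * x ^+ 2); last by ring.
  nra.
apply: (@le_trans _ _ (x ^+ 2)); last by rewrite lerDr mulr_ge0// ltW.
have := oneB_cos_le x; have := oneB_cos_ge0 x; rewrite ler_norml; lra.
Qed.

(** Since sin^2 y <= 2 (1 - cos y), the inequality of means gives |sin y| <= e + (1 - cos y) / e. A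
    perturbation [y] is thus controlled by the expectation of [1 - cos y] alone, without moments of
    [y]. *)
Lemma cos_perturb e x y : 0 < e ->
  `|cos (x + y) - cos x| <= e + (1 + e^-1) * (1 - cos y).
Proof.
move=> e0; rewrite cosD.
have -> : cos x * cos y - sin x * sin y - cos x =
   - (cos x * (1 - cos y) + sin x * sin y) by ring.
rewrite normrN; apply: (le_trans (ler_normD _ _)); rewrite !normrM.
have c0 := oneB_cos_ge0 y; rewrite (ger0_norm c0).
have := cos_max x; have := sin_max x; have := normr_ge0 (sin y).
have s2 : `|sin y| ^+ 2 <= 2 * (1 - cos y).
  rewrite -normrX ger0_norm ?sqr_ge0// sin2cos2.
  by have := cos_geN1 y; have := cos_le1 y; nra.
have sy : `|sin y| <= e + e^-1 * (1 - cos y).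
  have : 2 * `|sin y| <= 2 * e + 2 * (e^-1 * (1 - cos y)).
    have h : 0 <= (`|sin y| - e) ^+ 2 by rewrite sqr_ge0.
    have -> : 2 * `|sin y| = e^-1 * (2 * `|sin y| * e).
      by field; rewrite gt_eqF.
    have -> : 2 * e + 2 * (e^-1 * (1 - cos y)) =
        e^-1 * (2 * e ^+ 2 + 2 * (1 - cos y)).
      by field; rewrite gt_eqF.
    by rewrite ler_pM2l ?invr_gt0//; have := sqr_ge0 e; nra.
  lra.
move: (normr_ge0 (cos x)) (normr_ge0 (sin x)) c0 sy.
set u := `|cos x|; set v := `|sin x|; set c := 1 - cos y; set s := `|sin y|.
move=> *; nra.
Qed.

End trig_inequalities.

(** * Expectations of real functions *)

Definition intg d (T : measurableType d) (R : realType) (P : probability T R)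
  (f : T -> R) := P.-integrable setT (EFin \o f).

(** With [intg] as side condition, the algebra of expectations stays among real numbers, where
    [ring] and [lra] apply. *)
Definition Ex d (T : measurableType d) (R : realType) (P : probability T R)
  (f : T -> R) : R := \int[P]_w f w.

Section expectation_of_reals.
Context d (T : measurableType d) (R : realType) (P : probability T R).
Implicit Types (f g : T -> R) (A : set T).

Lemma intg_measurable f : intg P f -> measurable_fun setT f.
Proof. by move=> /integrableP[/measurable_EFinP]. Qed.

Lemma intg_le f g : measurable_fun setT f -> intg P g ->
  (forall w, `|f w| <= g w) -> intg P f.
Proof.
move=> mf ig fg; apply: (le_integrable measurableT _ _ ig).
  exact/measurable_EFinP.
by move=> w _; rewrite /= lee_fin (le_trans (fg w))// ler_norm.
Qed.

Lemma intg_cst (c : R) : intg P (fun=> c).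
Proof. exact: finite_measure_integrable_cst. Qed.

Lemma intg_bounded f (M : R) : measurable_fun setT f ->
  (forall w, `|f w| <= M) -> intg P f.
Proof. by move=> mf; apply: intg_le => //; exact: intg_cst. Qed.

Lemma intgD f g : intg P f -> intg P g -> intg P (fun w => f w + g w).
Proof. exact: integrableD. Qed.

Lemma intgZ (c : R) f : intg P f -> intg P (fun w => c * f w).
Proof. by rewrite /intg => fi; apply: (integrableZl measurableT c fi). Qed.

Lemma intgN f : intg P f -> intg P (fun w => - f w).
Proof.
by move=> /(intgZ (-1)); under eq_fun do rewrite mulN1r.
Qed.

Lemma intgB f g : intg P f -> intg P g -> intg P (fun w => f w - g w).
Proof. by move=> fi gi; apply: intgD => //; exact: intgN. Qed.

Lemma intg_sum (I : Type) (s : seq I) (p : pred I) (f : I -> T -> R) :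
  (forall i, p i -> intg P (f i)) -> intg P (fun w => \sum_(i <- s | p i) f i w).
Proof.
move=> fi; elim: s => [|i s IH].
  by under eq_fun do rewrite big_nil; exact: intg_cst.
under eq_fun do rewrite big_cons; case: (boolP (p i)) => // pi.
by apply: intgD => //; exact: fi.
Qed.

Lemma intg_norm f : intg P f -> intg P (fun w => `|f w|).
Proof. by move=> /integrable_abse. Qed.

Lemma intgM_bounded f g (M : R) : intg P f -> measurable_fun setT g ->
  (forall w, `|g w| <= M) -> intg P (fun w => f w * g w).
Proof.
move=> fi mg gM; apply: (intg_le _ (intgZ M (intg_norm fi))).
  by apply: measurable_funM => //; exact: intg_measurable.
by move=> w; rewrite normrM mulrC ler_wpM2r.
Qed.

Lemma Ex_cst (c : R) : Ex P (fun=> c) = c.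
Proof. by rewrite /Ex Rintegral_cst//= probability_setT mulr1. Qed.

Lemma ExD f g : intg P f -> intg P g ->
  Ex P (fun w => f w + g w) = Ex P f + Ex P g.
Proof. by move=> fi gi; rewrite /Ex RintegralD. Qed.

Lemma ExB f g : intg P f -> intg P g ->
  Ex P (fun w => f w - g w) = Ex P f - Ex P g.
Proof. by move=> fi gi; rewrite /Ex RintegralB. Qed.

Lemma ExZ (c : R) f : intg P f -> Ex P (fun w => c * f w) = c * Ex P f.
Proof. by move=> fi; rewrite /Ex RintegralZl. Qed.

Lemma Ex_sum (I : Type) (s : seq I) (p : pred I) (f : I -> T -> R) :
  (forall i, p i -> intg P (f i)) ->
  Ex P (fun w => \sum_(i <- s | p i) f i w) = \sum_(i <- s | p i) Ex P (f i).
Proof.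
move=> fi; elim: s => [|i s IH].
  by under eq_fun do rewrite big_nil; rewrite big_nil Ex_cst.
under eq_fun do rewrite big_cons; rewrite big_cons; case: (boolP (p i)) => // pi.
by rewrite ExD ?IH//; [exact: fi | exact: intg_sum].
Qed.

Lemma Ex_le f g : intg P f -> intg P g -> (forall w, f w <= g w) ->
  Ex P f <= Ex P g.
Proof. by move=> fi gi fg; exact: le_Rintegral. Qed.

Lemma Ex_ge0 f : (forall w, 0 <= f w) -> 0 <= Ex P f.
Proof. by move=> f0; exact: Rintegral_ge0. Qed.

Lemma Ex_norm f : intg P f -> `|Ex P f| <= Ex P (fun w => `|f w|).
Proof. by move=> fi; exact: le_normr_Rintegral. Qed.

Lemma Ex_norm_le f g : intg P f -> intg P g -> (forall w, `|f w| <= g w) ->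
  `|Ex P f| <= Ex P g.
Proof.
move=> fi gi fg; apply: (le_trans (Ex_norm fi)); apply: Ex_le => //.
exact: intg_norm.
Qed.

Lemma Ex_bounded f (M : R) : intg P f -> (forall w, `|f w| <= M) ->
  `|Ex P f| <= M.
Proof. by move=> fi fM; rewrite -(Ex_cst M); apply: Ex_norm_le => //; exact: intg_cst. Qed.

Lemma Ex_indic A : measurable A -> Ex P \1_A = fine (P A).
Proof. by move=> mA; rewrite /Ex /Rintegral integral_indic// setIT. Qed.

Lemma expectation_Ex f : fine 'E_P[f]%E = Ex P f.
Proof. by rewrite unlock. Qed.

Lemma expectation_EFin f : intg P f -> ('E_P[f] = (Ex P f)%:E)%E.
Proof.
move=> fi; rewrite -expectation_Ex fineK// unlock.
exact: integrable_fin_num.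
Qed.

Lemma eq_Ex f g : f =1 g -> Ex P f = Ex P g.
Proof. by move=> /funext ->. Qed.

Lemma intg_Lfun1 f : f \in Lfun P 1%:E -> intg P f.
Proof. by move=> /Lfun1_integrable. Qed.

Lemma intg_Lfun2 f : f \in Lfun P 2%:E -> intg P f.
Proof.
by move=> f2; apply: intg_Lfun1; apply: (Lfun_subset12 _ f2); exact: fin_num_measure.
Qed.

Lemma intg_sqr_Lfun2 f : f \in Lfun P 2%:E -> intg P (fun w => f w ^+ 2).
Proof. exact: Lfun2_integrable_sqr. Qed.

Lemma intgM_sqr f g : measurable_fun setT f -> measurable_fun setT g ->
  intg P (fun w => f w ^+ 2) -> intg P (fun w => g w ^+ 2) ->
  intg P (fun w => f w * g w).
Proof.
move=> mf mg f2 g2; apply: (intg_le _ (intgD f2 g2)).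
  exact: measurable_funM.
move=> w; rewrite normrM; have h := sqr_ge0 (`|f w| - `|g w|).
rewrite -(ger0_norm (sqr_ge0 (f w))) -(ger0_norm (sqr_ge0 (g w))) !normrX.
by have := sqr_ge0 (`|f w|); have := sqr_ge0 (`|g w|); nra.
Qed.

Lemma intg_sqrD f g : measurable_fun setT f -> measurable_fun setT g ->
  intg P (fun w => f w ^+ 2) -> intg P (fun w => g w ^+ 2) ->
  intg P (fun w => (f w + g w) ^+ 2).
Proof.
move=> mf mg f2 g2; have fg := intgM_sqr mf mg f2 g2.
apply: (intg_le _ (intgD (intgZ 2 f2) (intgZ 2 g2))).
  by apply: measurable_funX; exact: measurable_funD.
move=> w; rewrite ger0_norm ?sqr_ge0//.
by have := sqr_ge0 (f w - g w); nra.
Qed.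

End expectation_of_reals.

(** * From beta-mixing to covariances of bounded functions *)

Section coarsening.
Context d (T : measurableType d) (R : realType).
Context (mu : {finite_measure set T -> \bar R}) (C : set (set T)).
Local Open Scope ereal_scope.

(* The Radon-Nikodym theorem for measures restricted to a sub-sigma-field gives
   conditional probabilities. *)
Definition coarsen & <<s C>> `<=` measurable :
  set (g_sigma_algebraType C) -> \bar R := fun A => mu A.

Context (CT : <<s C>> `<=` measurable).
Local Notation mu_C := (coarsen CT).

Let id_measurable : measurable_fun setT (id : T -> g_sigma_algebraType C).
Proof. by move=> _ A mA; rewrite setTI preimage_id; exact: CT. Qed.

Let coarsen0 : mu_C set0 = 0. Proof. exact: measure0. Qed.

Let coarsen_ge0 A : 0 <= mu_C A. Proof. exact: measure_ge0. Qed.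

Let coarsen_sigma_additive : semi_sigma_additive mu_C.
Proof.
move=> F mF tF mUF; apply: measure_semi_sigma_additive => //.
- by move=> n; exact: CT (mF n).
- exact: CT mUF.
Qed.

HB.instance Definition _ := isMeasure.Build _ _ _ mu_C
  coarsen0 coarsen_ge0 coarsen_sigma_additive.

Let coarsen_fin : fin_num_fun mu_C.
Proof. by move=> A mA; apply: fin_num_measure; exact: CT. Qed.

HB.instance Definition _ := Measure_isFinite.Build _ _ _ mu_C coarsen_fin.

Lemma ge0_integral_coarsen (A : set T) (f : T -> \bar R) :
  <<s C>> A -> measurable_fun setT (f : g_sigma_algebraType C -> \bar R) ->
  (forall x, 0 <= f x) ->
  \int[mu_C]_(x in A) f x = \int[mu]_(x in A) f x.
Proof.
move=> CA mf f0.
rewrite -[RHS](@ge0_integral_pushforward _ _ T (g_sigma_algebraType C) R id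
  id_measurable mu A f)//.
exact: measurable_funTS.
Qed.

End coarsening.

Section mixing.
Context d (T : measurableType d) (R : realType) (P : probability T R).
Implicit Types (F H : set (set T)) (A B : set T) (b : R).

(** The strong mixing (alpha) coefficient of [F] and [H] is at most [b]. Factorization uses only
    this consequence of beta-mixing. *)
Definition mixing_le F H b := forall A B, F A -> H B ->
  `|fine (P (A `&` B)) - fine (P A) * fine (P B)| <= b.

(** The Radon-Nikodym density of A |-> P(A & B) with respect to P, both restricted to the
    sub-sigma-field. Existence matters because [abs_regularity] constrains its majorants only
    through versions of P(B | F). *)
Lemma exists_cond_prob (C : set (set T)) B : <<s C>> `<=` measurable ->
  measurable B -> exists f : T -> R, is_cond_prob P <<s C>> B f.
Proof.
move=> CT mB.
pose mu : {finite_measure set _ -> \bar R} := coarsen P CT.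
pose nu : {finite_measure set _ -> \bar R} := coarsen (mrestr P mB) CT.
have CP A : <<s C>> A -> measurable (A : set T) by move=> /CT.
have numu : nu `<< mu.
  apply/null_content_dominatesP => A mA muA; apply/eqP.
  have mA' : measurable (A : set T) by exact: CP.
  rewrite eq_le measure_ge0 andbT.
  apply: (@le_trans _ _ (P A)); last by rewrite -muA.
  by apply: le_measure; rewrite ?inE//; exact: measurableI.
have [f [f0 fi fE]] := radon_nikodym_finite numu.
have ffin : (mu.-integrable setT f) := fi.
have mf : measurable_fun setT (f : g_sigma_algebraType C -> \bar R).
  exact: measurable_int ffin.
have fiP : P.-integrable setT f.
  apply/integrableP; split.
    by move=> _ U mU; apply: CP; exact: mf.
  under eq_integral do rewrite gee0_abs//.
  rewrite -(ge0_integral_coarsen P CT)//; last first.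
    exact: (@measurableT _ (g_sigma_algebraType C)).
  have /integrableP[_] := fi.
  by under eq_integral do rewrite gee0_abs//.
(* The density is finite almost everywhere, so [fine] does not change its integrals. *)
exists (fine \o f).
have aeE A : <<s C>> A ->
    (\int[P]_(w in A) ((fine \o f) w)%:E = \int[P]_(w in A) f w)%E.
  move=> CA; apply: ae_eq_integral; first exact: CP.
  - apply: measurable_funTS; apply/measurable_EFinP; apply: measurableT_comp => //.
    by case/integrableP : fiP.
  - by apply: measurable_funTS; case/integrableP : fiP.
  - have := integrable_ae measurableT fiP.
    by apply: filterS => w /(_ I) fw _ /=; rewrite fineK.
split.
- move=> U mU; rewrite -[_ @^-1` _]setTI.
  have : measurable_fun setT (fine \o f : g_sigma_algebraType C -> R).
    exact: measurableT_comp.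
  by move=> /(_ (@measurableT _ _) U mU).
- apply: (le_integrable measurableT _ _ fiP).
    apply/measurable_EFinP; apply: measurableT_comp => //.
    by case/integrableP : fiP.
  move=> w _ /=; case: (f w) (f0 w) => [r|_|] //=.
  by rewrite leey.
- move=> A CA; rewrite aeE//.
  by rewrite -(ge0_integral_coarsen P CT)// -fE//.
Qed.

End mixing.

Section covariance_inequality.
Context d (T : measurableType d) (R : realType) (P : probability T R).
Implicit Types (A B : set T) (b : R).

(** P(A & B) - P(A) P(B) is the integral over A of P(B | C) - P(B), hence at most the integral of
    any majorant [h] that enters the infimum. *)
Lemma abs_regularity_mixing (C H : set (set T)) A B : <<s C>> `<=` measurable ->
  <<s C>> A -> measurable B -> H B ->
  (`|fine (P (A `&` B)) - fine (P A) * fine (P B)|%:E <=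
   abs_regularity P <<s C>> H)%E.
Proof.
move=> CT CA mB HB; apply: le_ereal_inf_tmp => _ [h [mh h0 hB] <-].
have [f [mf fi fA]] := exists_cond_prob P CT mB.
have mA : measurable A := CT _ CA.
have hf := hB _ _ HB (And3 mf fi fA).
have mf' : measurable_fun setT f.
  by case/integrableP : fi => /measurable_EFinP.
set c := fine (P B).
have gi : P.-integrable A (EFin \o (fun w => f w - c)).
  apply: (integrableS measurableT) => //.
  exact: (intgB fi (intg_cst P c)).
have -> : fine (P (A `&` B)) - fine (P A) * c = \int[P]_(w in A) (f w - c).
  rewrite RintegralB//; last 2 first.
  - by apply: (integrableS measurableT) => //; exact: fi.
  - by apply: (integrableS measurableT) => //; exact: (intg_cst P c).
  by rewrite Rintegral_cst// mulrC; congr (_ - _); rewrite /Rintegral fA.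
rewrite EFin_normr_Rintegral//.
apply: (le_trans (le_abse_integral _ mA _)); first exact: measurable_int gi.
apply: (@le_trans _ _ (\int[P]_(w in A) h w)%E); last first.
  by apply: ge0_subset_integral.
apply: ae_ge0_le_integral => //.
- by do 2 apply: measurableT_comp => //; apply: measurable_funTS;
    apply: measurable_funB.
- exact: measurable_funTS.
- by apply: filterS hf => w hw _ /=.
Qed.

(* A function with values in [0, 1] is the average of the indicator of
   [f >= 1/2] and of the remainder 2 f - 1_[f >= 1/2], again with values in
   [0, 1]; iterating, a bound on indicators passes to functions. *)
Lemma indic_bound_extend (C : set (set T)) (phi : (T -> R) -> R) (b K : R) :
  let Q (f : T -> R) :=
    measurable_fun setT (f : g_sigma_algebraType C -> R) /\
    forall w, 0 <= f w <= 1 in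
  (forall A, <<s C>> A -> `|phi \1_A| <= b) ->
  (forall f, Q f -> `|phi f| <= K) ->
  (forall f g, Q f -> Q g ->
     phi (fun w => (f w + g w) / 2) = (phi f + phi g) / 2) ->
  forall f, Q f -> `|phi f| <= b.
Proof.
move=> Q phib phiK phiD.
have b0 : 0 <= b by rewrite (le_trans _ (phib set0 _))//; exact: sigma_algebra0.
have H n : forall f, Q f -> `|phi f| <= b + K * 2^-1 ^+ n.
  elim: n => [f Qf|n IH f [mf f01]].
    by rewrite expr0 mulr1 (le_trans (phiK _ Qf))// lerDr.
  pose A := [set w | 2^-1 <= f w].
  have CA : <<s C>> A.
    have := mf (@measurableT _ _) _ (measurable_itv `[2^-1, +oo[).
    rewrite setTI; congr (<<s C>> _); apply/seteqP; split=> w /=;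
      by rewrite in_itv/= andbT.
  pose g w := 2 * f w - \1_A w.
  have m1A : measurable_fun setT (\1_A : g_sigma_algebraType C -> R).
    exact: measurable_indic.
  have Q1 : Q \1_A.
    by split=> // w; rewrite indicE; case: (w \in A); rewrite ?lexx ?ler01.
  have Qg : Q g.
    split; first by apply: measurable_funB => //; exact: measurable_funM.
    move=> w; rewrite /g indicE; have /andP[f0 f1] := f01 w.
    have [|] := boolP (w \in A); first by rewrite inE /A/= => h; lra.
    by rewrite notin_setE /A/= => /negP; rewrite -ltNge => h; lra.
  have -> : f = (fun w => (\1_A w + g w) / 2).
    by apply/funext => w; rewrite /g addrC subrK mulrC mulKf.
  rewrite (phiD _ _ Q1 Qg) normrM (@ger0_norm _ 2^-1)// ler_pdivrMr//.
  apply: (le_trans (ler_normD _ _)); have := phib _ CA; have := IH _ Qg.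
  rewrite exprS; set z := K * _ => h1 h2.
  have -> : K * (2^-1 * 2^-1 ^+ n) = z / 2 by rewrite mulrCA mulrC.
  lra.
move=> f Qf; apply/ler_addgt0Pr => e e0.
have K0 : 0 <= K by rewrite (le_trans _ (phiK _ Qf)).
apply: (le_trans (H (Num.truncn (K / e)).+1 f Qf)); rewrite lerD2l.
set n := (Num.truncn _).+1; rewrite exprVn ler_pdivrMr ?exprn_gt0// mulrC -ler_pdivrMr//.
have : K / e < n%:R by rewrite /n truncnS_gt.
move/ltW/le_trans; apply; rewrite -natrX ler_nat ltnW// ltn_expl//.
Qed.

Lemma g_sigma_measurable_fun (C : set (set T)) (f : T -> R) :
  <<s C>> `<=` measurable ->
  measurable_fun setT (f : g_sigma_algebraType C -> R) ->
  measurable_fun setT f.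
Proof.
move=> CT mf _ U mU; rewrite setTI; apply: CT.
by have := mf (@measurableT _ _) _ mU; rewrite setTI.
Qed.

(** Covariance is affine in each argument, so [indic_bound_extend] applies first to [f] against an
    indicator and then to [g] against a function. The factor 4 comes from passing to [(f + 1) / 2]
    and [(g + 1) / 2], with values in [0, 1]: each halves the covariance. *)
Lemma mixing_cov_le (C D : set (set T)) b (f g : T -> R) :
  <<s C>> `<=` measurable -> <<s D>> `<=` measurable ->
  mixing_le P <<s C>> <<s D>> b ->
  measurable_fun setT (f : g_sigma_algebraType C -> R) ->
  measurable_fun setT (g : g_sigma_algebraType D -> R) ->
  (forall w, `|f w| <= 1) -> (forall w, `|g w| <= 1) ->
  `|Ex P (fun w => f w * g w) - Ex P f * Ex P g| <= 4 * b.
Proof.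
move=> CT DT mixb mf mg f1 g1.
have meas := g_sigma_measurable_fun.
pose cov u v := Ex P (fun w => u w * v w) - Ex P u * Ex P v.
have covC u v : cov u v = cov v u.
  by rewrite /cov mulrC; congr (_ - _); apply: eq_Ex => w; rewrite mulrC.
pose bd (u : T -> R) := measurable_fun setT u /\ forall w, `|u w| <= 1.
have bdi u : bd u -> intg P u by case=> mu u1; exact: intg_bounded u1.
have bdMi u v : bd u -> bd v -> intg P (fun w => u w * v w).
  move=> bu [mv v1]; apply: intgM_bounded v1 => //; exact: bdi.
have covD u1 u2 v : bd u1 -> bd u2 -> bd v ->
    cov (fun w => (u1 w + u2 w) / 2) v = (cov u1 v + cov u2 v) / 2.
  move=> b1 b2 bv; rewrite /cov.
  have -> : Ex P (fun w => (u1 w + u2 w) / 2 * v w) =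
            2^-1 * (Ex P (fun w => u1 w * v w) + Ex P (fun w => u2 w * v w)).
    rewrite -ExD ?bdMi// -ExZ; last by apply: intgD; exact: bdMi.
    by apply: eq_Ex => w; field.
  have -> : Ex P (fun w => (u1 w + u2 w) / 2) = 2^-1 * (Ex P u1 + Ex P u2).
    rewrite -ExD ?bdi// -ExZ; last by apply: intgD; exact: bdi.
    by apply: eq_Ex => w; field.
  by field.
have cov2 u v : bd u -> bd v -> `|cov u v| <= 2.
  move=> bu bv; apply: (le_trans (ler_normB _ _)).
  have h1 : `|Ex P (fun w => u w * v w)| <= 1.
    apply: Ex_bounded; first exact: bdMi.
    by move=> w; rewrite normrM mulr_ile1//; [case: bu|case: bv].
  have h2 : `|Ex P u * Ex P v| <= 1.
    rewrite normrM mulr_ile1// Ex_bounded//; [exact: bdi|by case: bu|exact: bdi|by case: bv].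
  lra.
have bd01 C' (u : T -> R) : <<s C'>> `<=` measurable ->
   measurable_fun setT (u : g_sigma_algebraType C' -> R) /\
    (forall w, 0 <= u w <= 1) -> bd u.
  move=> C'T [mu u01]; split; first exact: meas mu.
  by move=> w; have /andP[u0 u1] := u01 w; rewrite ger0_norm.
have bdI A : measurable A -> bd \1_A.
  move=> mA; split; first exact: measurable_indic.
  by move=> w; rewrite indicE; case: (w \in A); rewrite ?normr1 ?normr0.
have step1 B : <<s D>> B -> forall u,
    measurable_fun setT (u : g_sigma_algebraType C -> R) /\
    (forall w, 0 <= u w <= 1) -> `|cov u \1_B| <= b.
  move=> DB; have bB := bdI _ (DT _ DB).
  apply: (indic_bound_extend (K := 2)).
  - move=> A CA; rewrite /cov !Ex_indic; [|exact: DT|exact: CT].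
    rewrite (_ : (fun w => _) = \1_(A `&` B)); last first.
      by apply/funext => w; rewrite !indicE in_setI -natrM mulnb.
    rewrite Ex_indic; last by apply: measurableI; [exact: CT|exact: DT].
    exact: mixb.
  - by move=> u Qu; apply: cov2 => //; exact: bd01 Qu.
  - by move=> u v Qu Qv; apply: covD => //; [exact: bd01 Qu|exact: bd01 Qv].
have step2 u v : measurable_fun setT (u : g_sigma_algebraType C -> R) /\
    (forall w, 0 <= u w <= 1) ->
    measurable_fun setT (v : g_sigma_algebraType D -> R) /\
    (forall w, 0 <= v w <= 1) -> `|cov u v| <= b.
  move=> Qu; have bu := bd01 _ _ CT Qu; move: v.
  apply: (indic_bound_extend (K := 2)) => [B DB|v Qv|v1 v2 Q1 Q2].
  - exact: step1.
  - by apply: cov2 => //; exact: bd01 Qv.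
  - by rewrite !(covC u); apply: covD => //; [exact: bd01 Q1|exact: bd01 Q2].
pose f' w := (f w + 1) / 2; pose g' w := (g w + 1) / 2.
have Qf : measurable_fun setT (f' : g_sigma_algebraType C -> R) /\
    (forall w, 0 <= f' w <= 1).
  split; first by apply: measurable_funM => //; exact: measurable_funD.
  by move=> w; have := f1 w; rewrite ler_norml /f' => /andP[? ?]; lra.
have Qg : measurable_fun setT (g' : g_sigma_algebraType D -> R) /\
    (forall w, 0 <= g' w <= 1).
  split; first by apply: measurable_funM => //; exact: measurable_funD.
  by move=> w; have := g1 w; rewrite ler_norml /g' => /andP[? ?]; lra.
have bf : bd f by split => //; exact: meas mf.
have bg : bd g by split => //; exact: meas mg.
have b1 : bd (fun=> 1) by split => //; move=> w; rewrite normr1.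
have cov1 v : cov (fun=> 1) v = 0.
  rewrite /cov Ex_cst mul1r; apply/eqP; rewrite subr_eq0; apply/eqP.
  by apply: eq_Ex => w; rewrite mul1r.
have bg' := bd01 _ _ DT Qg.
have := step2 _ _ Qf Qg.
rewrite {1}/f' covD// cov1 addr0 covC {1}/g' covD// cov1 addr0 (covC g f).
rewrite !normrM (@ger0_norm _ 2^-1)// /cov; set z := `|_|; lra.
Qed.

End covariance_inequality.

(** * Factorization of characteristic functions under mixing *)

Section trigonometric_moments_of_sums.
Context d (T : measurableType d) (R : realType) (P : probability T R).

Lemma measurable_cos (f : T -> R) : measurable_fun setT f ->
  measurable_fun setT (fun w => cos (f w)).
Proof.
move=> mf; apply: (measurableT_comp _ mf).
by apply: continuous_measurable_fun; exact: continuous_cos.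
Qed.

Lemma measurable_sin (f : T -> R) : measurable_fun setT f ->
  measurable_fun setT (fun w => sin (f w)).
Proof.
move=> mf; apply: (measurableT_comp _ mf).
by apply: continuous_measurable_fun; exact: continuous_sin.
Qed.

Lemma intg_cos (f : T -> R) : measurable_fun setT f ->
  intg P (fun w => cos (f w)).
Proof.
by move=> mf; apply: (intg_bounded P (M := 1)) => [|w];
  [exact: measurable_cos | exact: cos_max].
Qed.

Lemma intg_sin (f : T -> R) : measurable_fun setT f ->
  intg P (fun w => sin (f w)).
Proof.
by move=> mf; apply: (intg_bounded P (M := 1)) => [|w];
  [exact: measurable_sin | exact: sin_max].
Qed.

End trigonometric_moments_of_sums.

Section trig_recursion.
Context d (T : measurableType d) (R : realType) (P : probability T R).

(** When cos (S + x_n) is expanded, each of the two products is factorized at cost [4 * b], and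
    replacing E cos x_n by [rho] and E sin x_n by 0 costs [e] each. The sine of S needs no induction
    hypothesis, its cofactor E sin x_n being itself at most [e]. *)
Lemma cos_sum_recursion (N : nat) (x : nat -> T -> R) (rho e b : R) :
  0 <= rho <= 1 -> 0 <= b -> 0 <= e ->
  (forall j, (j < N)%N -> exists C D : set (set T),
    [/\ <<s C>> `<=` measurable, <<s D>> `<=` measurable,
        mixing_le P <<s C>> <<s D>> b,
        forall i, (i < j)%N ->
          measurable_fun setT (x i : g_sigma_algebraType C -> R) &
        measurable_fun setT (x j : g_sigma_algebraType D -> R)]) ->
  (forall j, (j < N)%N -> `|Ex P (fun w => cos (x j w)) - rho| <= e) ->
  (forall j, (j < N)%N -> `|Ex P (fun w => sin (x j w))| <= e) ->
  forall n th, (n <= N)%N ->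
  `|Ex P (fun w => cos (th + \sum_(i < n) x i w)) - rho ^+ n * cos th|
    <= n%:R * (8 * b + 2 * e).
Proof.
move=> /andP[rho0 rho1] b0 e0 mix Ec Es; elim => [th _|n IH th nN].
  under [X in Ex P X]eq_fun do rewrite big_ord0 addr0.
  by rewrite Ex_cst expr0 mul1r subrr normr0 mul0r.
have [C [D [CT DT mixb Cx Dx]]] := mix _ nN.
pose S w := th + \sum_(i < n) x i w.
have CS : measurable_fun setT (S : g_sigma_algebraType C -> R).
  apply: measurable_funD => //; apply: measurable_sum => i; exact: Cx.
have mS := g_sigma_measurable_fun CT CS.
have mx := g_sigma_measurable_fun DT Dx.
have c1 := mixing_cov_le CT DT mixb (measurable_cos CS) (measurable_cos Dx)
  (fun w => cos_max _) (fun w => cos_max _).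
have c2 := mixing_cov_le CT DT mixb (measurable_sin CS) (measurable_sin Dx)
  (fun w => sin_max _) (fun w => sin_max _).
have -> : Ex P (fun w => cos (th + \sum_(i < n.+1) x i w)) =
   Ex P (fun w => cos (S w) * cos (x n w)) -
   Ex P (fun w => sin (S w) * sin (x n w)).
  rewrite -ExB; last 2 first.
  - by apply: (intgM_bounded (M := 1)); [exact: intg_cos|exact: measurable_cos|
      move=> w; exact: cos_max].
  - by apply: (intgM_bounded (M := 1)); [exact: intg_sin|exact: measurable_sin|
      move=> w; exact: sin_max].
  by apply: eq_Ex => w; rewrite big_ord_recr/= addrA cosD.
have a1 : `|Ex P (fun w => cos (S w))| <= 1.
  by apply: Ex_bounded; [exact: intg_cos|move=> w; exact: cos_max].
have a2 : `|Ex P (fun w => sin (S w))| <= 1.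
  by apply: Ex_bounded; [exact: intg_sin|move=> w; exact: sin_max].
move: (IH th (ltnW nN)) (Ec _ nN) (Es _ nN) c1 c2 a1 a2.
have -> : n.+1%:R * (8 * b + 2 * e) =
  n%:R * (8 * b + 2 * e) + (8 * b + 2 * e) by rewrite -[n.+1%:R]natr1; ring.
rewrite exprS -/S.
set A := Ex P (fun w => cos (S w)); set B := Ex P (fun w => sin (S w)).
set u := Ex P (fun w => cos (x n w)); set v := Ex P (fun w => sin (x n w)).
set CC := Ex P (fun w => cos (S w) * cos (x n w)).
set SS := Ex P (fun w => sin (S w) * sin (x n w)).
set r := rho ^+ n * cos th => hr hc hs c1 c2 a1 a2.
have -> : CC - SS - rho * rho ^+ n * cos th =
  (CC - A * u) - (SS - B * v) + A * (u - rho) - B * v + rho * (A - r).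
  by rewrite /r; ring.
have h1 : `|A * (u - rho)| <= e.
  by have := ler_pM (normr_ge0 _) (normr_ge0 _) a1 hc; rewrite mul1r normrM.
have h2 : `|B * v| <= e.
  by have := ler_pM (normr_ge0 _) (normr_ge0 _) a2 hs; rewrite mul1r normrM.
have h3 : `|rho * (A - r)| <= n%:R * (8 * b + 2 * e).
  have := ler_pM rho0 (normr_ge0 _) rho1 hr.
  by rewrite mul1r normrM (ger0_norm rho0).
move: c1 c2 h1 h2 h3; rewrite !ler_norml.
set X1 := CC - _; set X2 := SS - _; set X3 := A * _; set X4 := B * v.
set X5 := rho * _; set M := n%:R * _; lra.
Qed.

End trig_recursion.

(** * Transfer of expectations between processes with the same law *)

Section equality_in_law.
Context d (T : measurableType d) (R : realType) (P : probability T R).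
Context (I : Type) d' (S : measurableType d').

(** Generator of [cylinder_sigma], named so that path space becomes a measurable type. *)
Definition cylinders : set (set (I -> S)) :=
  \bigcup_(i in setT) preimage_set_system setT (fun f : I -> S => f i) measurable.

Lemma measurable_coordinate (i : I) :
  measurable_fun setT ((fun f => f i) : g_sigma_algebraType cylinders -> S).
Proof.
move=> _ U mU; rewrite setTI; apply: sub_sigma_algebra; exists i => //.
by exists U => //; rewrite setTI.
Qed.

Lemma measurable_path (Y : I -> T -> S) : (forall i, measurable_fun setT (Y i)) ->
  measurable_fun setT
    ((fun w i => Y i w) : T -> g_sigma_algebraType cylinders).
Proof.
move=> mY; apply: (@measurability _ _ T (g_sigma_algebraType cylinders) setT _ cylinders) => //= _ [B [i _ [U mU <-]] <-].
by rewrite !setTI; have := mY i measurableT _ mU; rewrite setTI.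
Qed.

(** Both sides are integrals against image measures on path space, which coincide on the cylinder
    sigma-field. *)
Lemma same_law_integral (Y Y' : I -> T -> S) (phi : (I -> S) -> \bar R) :
  (forall i, measurable_fun setT (Y i)) ->
  (forall i, measurable_fun setT (Y' i)) ->
  same_law P Y Y' ->
  measurable_fun setT (phi : g_sigma_algebraType cylinders -> \bar R) ->
  (\int[P]_w phi (fun i => Y i w) = \int[P]_w phi (fun i => Y' i w))%E.
Proof.
move=> mY mY' YY'.
have ge0 (psi : (I -> S) -> \bar R) :
    measurable_fun setT (psi : g_sigma_algebraType cylinders -> \bar R) ->
    (forall x, 0 <= psi x)%E ->
    (\int[P]_w psi (fun i => Y i w) = \int[P]_w psi (fun i => Y' i w))%E.
  move=> mpsi psi0.
  rewrite -[LHS](@ge0_integral_pushforward _ _ _ _ _ _ (measurable_path mY) P setT psi)//.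
  rewrite -[RHS](@ge0_integral_pushforward _ _ _ _ _ _ (measurable_path mY') P setT psi)//.
  apply: eq_measure_integral => [||? ? A mA _]; [exact: measurable_path..|].
  exact: YY'.
move=> mphi; rewrite integralE [RHS]integralE; congr (_ - _)%E.
  rewrite (eq_integral (fun w => (phi ^\+)%E (fun i => Y i w))); last first.
    by move=> w _; rewrite !funeposE.
  rewrite (ge0 _ (measurable_funepos mphi) (funepos_ge0 phi)).
  by apply: eq_integral => w _; rewrite !funeposE.
rewrite (eq_integral (fun w => (phi ^\-)%E (fun i => Y i w))); last first.
  by move=> w _; rewrite !funenegE.
rewrite (ge0 _ (measurable_funeneg mphi) (funeneg_ge0 phi)).
by apply: eq_integral => w _; rewrite !funenegE.
Qed.

Lemma same_law_Ex (Y Y' : I -> T -> S) (phi : (I -> S) -> R) :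
  (forall i, measurable_fun setT (Y i)) ->
  (forall i, measurable_fun setT (Y' i)) ->
  same_law P Y Y' ->
  measurable_fun setT (phi : g_sigma_algebraType cylinders -> R) ->
  Ex P (fun w => phi (fun i => Y i w)) = Ex P (fun w => phi (fun i => Y' i w)).
Proof.
move=> mY mY' YY' mphi; rewrite /Ex /Rintegral; congr fine.
by apply: (same_law_integral (phi := EFin \o phi)) => //; exact/measurable_EFinP.
Qed.

End equality_in_law.

(** * Characteristic functions *)

Section derivative_criterion.
Context {R : realType}.

(** Serves to differentiate under an integral sign: integrating a pointwise Taylor bound produces
    the hypothesis. *)
Lemma is_derive_quadratic (f : R -> R) (t l B : R) :
  (forall k, `|f (t + k) - f t - k * l| <= B * k ^+ 2) -> is_derive t 1 f l.
Proof.
move=> fB.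
have H : h^-1 *: (f (h *: 1 + t) - f t) @[h --> 0^'] --> l.
  apply/cvgrPdist_le => e e0; near=> h.
  have h0 : h != 0 by near: h; exact: nbhs_dnbhs_neq.
  have -> : l - h^-1 *: (f (h *: 1 + t) - f t) = - (h^-1 * (f (t + h) - f t - h * l)).
    by rewrite /GRing.scale/= mulr1 (addrC t); field.
  rewrite normrN normrM normfV ler_pdivrMl ?normr_gt0//.
  apply: (le_trans (fB h)); rewrite -[h ^+ 2]ger0_norm ?sqr_ge0// normrX expr2.
  rewrite mulrCA ler_wpM2l//.
  apply: (@le_trans _ _ (`|B| * `|h|)); first by rewrite ler_wpM2r// ler_norm.
  rewrite (@le_trans _ _ ((`|B| + 1) * `|h|))// ?ler_wpM2r// ?lerDl//.
  rewrite mulrC -ler_pdivlMr ?ltr_wpDl//.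
  near: h; apply: dnbhs0_le; rewrite divr_gt0// ltr_wpDl//.
by apply: DeriveDef; [apply/cvg_ex; exists l | exact/cvg_lim].
Unshelve. all: by end_near. Qed.

End derivative_criterion.

(** * The characteristic function of the normal law *)

Section normal_characteristic_function.
Context {R : realType} (s : R) (s0 : s != 0).
Local Notation mu := (@lebesgue_measure R).
Local Notation pdf := (normal_pdf 0 s).

Lemma Ex_normal (f : R -> R) (M : R) : measurable_fun setT f ->
  (forall x, `|f x| <= M) ->
  Ex (normal_prob 0 s) f = \int[mu]_x (f x * pdf x).
Proof.
move=> mf fM; rewrite /Ex /Rintegral; congr fine.
have dom := normal_prob_dominates (0 : R) s.
rewrite -(Radon_Nikodym_change_of_variables dom)//=; last first.
  exact: (intg_bounded (normal_prob 0 s) mf fM).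
apply: ae_eq_integral => //.
- apply: emeasurable_funM => //; first exact/measurable_EFinP.
- apply/measurable_EFinP; apply: measurable_funM => //.
  exact: measurable_normal_pdf.
- under [X in ae_eq _ _ _ X]eq_fun do rewrite EFinM.
  apply: ae_eqe_mul2l => /=.
  rewrite Radon_NikodymE//=; case: cid => /= h [h1 h2 h3].
  apply: integral_ae_eq => //=.
- by apply/measurable_EFinP; exact: measurable_normal_pdf.
- by move=> E _ mE; rewrite -h3.
Qed.

Lemma normal_pdf0E x :
  pdf x = normal_peak s * expR (- (x ^+ 2 / (s ^+ 2 *+ 2))).
Proof. by rewrite normal_pdfE// /normal_fun subr0 mulNr. Qed.

(** With y = x^2 / (4 s^2), the factor x^2 is absorbed by half of the exponent, as y exp(-y) <= 1.
    What remains is, up to the constant [C], the density with standard deviation [s']. *)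
Lemma integrable_sqr_normal_pdf :
  mu.-integrable setT (EFin \o (fun x => x ^+ 2 * pdf x)).
Proof.
pose s' := Num.sqrt 2 * s.
have s'0 : s' != 0 by rewrite mulf_neq0// sqrtr_eq0 -ltNge.
pose C := normal_peak s * (s ^+ 2 *+ 4) / normal_peak s'.
have s2 : 0 < s ^+ 2 by rewrite exprn_even_gt0.
apply: (le_integrable measurableT _ _
    (integrableZl measurableT C (integrable_normal_pdf 0 s'))).
  apply/measurable_EFinP; apply: measurable_funM; last exact: measurable_normal_pdf.
  exact: measurable_funX.
move=> x _; rewrite /= lee_fin normrM ger0_norm ?sqr_ge0//.
rewrite ger0_norm ?normal_pdf_ge0//; apply: le_trans (ler_norm _).
rewrite normal_pdf0E normal_pdfE// /normal_fun subr0 /C.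
have p0 := normal_peak_gt0 s'0; have p1 := normal_peak_gt0 s0.
rewrite [leRHS]mulrA divfK ?gt_eqF// /s' exprMn sqr_sqrtr// [leLHS]mulrCA -[leRHS]mulrA ler_wpM2l ?(ltW p1)//.
set y := x ^+ 2 / (s ^+ 2 *+ 4).
have -> : x ^+ 2 / (s ^+ 2 *+ 2) = y + y.
  by rewrite /y -[s ^+ 2 *+ 4]mulr_natr -[s ^+ 2 *+ 2]mulr_natr; field.
have -> : - x ^+ 2 / ((2 * s ^+ 2) *+ 2) = - y.
  by rewrite /y -[s ^+ 2 *+ 4]mulr_natr -[_ *+ 2]mulr_natr; field.
have -> : x ^+ 2 = s ^+ 2 *+ 4 * y.
  by rewrite /y -[s ^+ 2 *+ 4]mulr_natr; field.
rewrite -mulrA ler_wpM2l ?mulrn_wge0 ?(ltW s2)//.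
rewrite opprD expRD mulrA ger_pMl ?expR_gt0// expRN -ler_pdivlMr ?invr_gt0 ?expR_gt0//.
by rewrite invrK mul1r (le_trans _ (expR_ge1Dx y))// lerDr.
Qed.

Lemma integrable_pdf_bounded (g : R -> R) (M : R) : measurable_fun setT g ->
  (forall x, `|g x| <= M * (1 + x ^+ 2)) ->
  mu.-integrable setT (EFin \o (fun x => g x * pdf x)).
Proof.
move=> mg gM.
have i2 := integrableD measurableT (integrable_normal_pdf 0 s) integrable_sqr_normal_pdf.
apply: (le_integrable measurableT _ _ (integrableZl measurableT M i2)).
  by apply/measurable_EFinP; apply: measurable_funM => //; exact: measurable_normal_pdf.
move=> x _; rewrite /= lee_fin normrM (ger0_norm (normal_pdf_ge0 _ _ _)).
apply: le_trans (ler_norm _).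
rewrite -[X in X + _]mul1r -mulrDl mulrA ler_wpM2r ?normal_pdf_ge0//.
Qed.

End normal_characteristic_function.

Section stein.
Context {R : realType} (s : R) (s0 : s != 0).
Local Notation mu := (@lebesgue_measure R).
Local Notation pdf := (normal_pdf 0 s).

Lemma is_derive_normal_pdf (x : R) : is_derive x 1 pdf (- (x / s ^+ 2) * pdf x).
Proof.
have -> : pdf = (fun x => normal_peak s * expR (- (x ^+ 2 / (s ^+ 2 *+ 2)))).
  by apply/funext => y; exact: normal_pdf0E.
have h : is_derive x 1 (fun x : R => - (x ^+ 2 / (s ^+ 2 *+ 2))) (- (x / s ^+ 2)).
  have -> : (fun x : R => - (x ^+ 2 / (s ^+ 2 *+ 2))) =
      (- (s ^+ 2 *+ 2)^-1) \*: (fun x : R => x ^+ 2).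
    by apply/funext => y; rewrite /= /GRing.scale/= mulNr mulrC.
  apply: is_derive_eq; rewrite /GRing.scale/= mulr1 -[_ *+ 2 in LHS]mulr_natr.
  by rewrite -[in LHS]mulr_natr; field.
have -> : (fun x : R => normal_peak s * expR (- (x ^+ 2 / (s ^+ 2 *+ 2)))) =
  normal_peak s \*: (expR \o (fun x : R => - (x ^+ 2 / (s ^+ 2 *+ 2)))).
  by apply/funext.
apply: is_derive_eq; rewrite /GRing.scale/=; ring.
Qed.

(** Stein's identity E[X f(X)] = s^2 E[f'(X)] for f(x) = sin (th + t x). It holds because the
    derivative [h'] of the density times f integrates to 0 over the line. *)
Lemma stein_sin (th t : R) :
  \int[mu]_x (x * sin (th + t * x) * pdf x) =
  s ^+ 2 * t * \int[mu]_x (cos (th + t * x) * pdf x).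
Proof.
have ms : measurable_fun setT (fun x : R => sin (th + t * x)).
  by apply: measurable_sin; apply: measurable_funD => //; exact: measurable_funM.
have mc : measurable_fun setT (fun x : R => cos (th + t * x)).
  by apply: measurable_cos; apply: measurable_funD => //; exact: measurable_funM.
have ixs : mu.-integrable setT (EFin \o (fun x => x * sin (th + t * x) * pdf x)).
  apply: (integrable_pdf_bounded s0 (M := 1)); first exact: measurable_funM.
  move=> x; rewrite normrM mul1r.
  have : `|x| * `|sin (th + t * x)| <= `|x| by rewrite ler_piMr// sin_max.
  move/le_trans; apply; rewrite -[x ^+ 2]ger0_norm ?sqr_ge0// normrX.
  by have := sqr_ge0 (`|x| - 1); have := normr_ge0 x; nra.
have ic : mu.-integrable setT (EFin \o (fun x => cos (th + t * x) * pdf x)).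
  apply: (integrable_pdf_bounded s0 (M := 1)) => // x; rewrite mul1r.
  by rewrite (le_trans (cos_max _))// lerDl sqr_ge0.
pose h (x : R) : R := pdf x * sin (th + t * x).
pose h' (x : R) : R := - (s ^+ 2)^-1 * (x * sin (th + t * x) * pdf x) +
             t * (cos (th + t * x) * pdf x).
have ih1 : mu.-integrable setT
    (EFin \o (fun x => - (s ^+ 2)^-1 * (x * sin (th + t * x) * pdf x))).
  exact: (integrableZl measurableT _ ixs).
have ih2 : mu.-integrable setT (EFin \o (fun x => t * (cos (th + t * x) * pdf x))).
  exact: (integrableZl measurableT _ ic).
have ih' : mu.-integrable setT (EFin \o h') by exact: (integrableD measurableT ih1 ih2).
have dh (x : R) : is_derive x 1 h (h' x).
  have d1 : is_derive x 1 (fun x => sin (th + t * x)) (t * cos (th + t * x)).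
    have -> : (fun x => sin (th + t * x)) = sin \o (cst th + t \*: id).
      by apply/funext.
    apply: is_derive_eq; rewrite /GRing.scale/=; ring.
  have d2 := is_derive_normal_pdf x.
  have -> : h = pdf * (fun x => sin (th + t * x)) by apply/funext.
  apply: is_derive_eq; rewrite /GRing.scale/= /h'; field; exact: s0.
have ch' : continuous h'.
  have cid : continuous (fun x : R => th + t * x).
    move=> x; apply: cvgD; first exact: cvg_cst.
    by apply: cvgM; [exact: cvg_cst|exact: cvg_id].
  have cpdf : continuous pdf by exact: continuous_normal_pdf.
  move=> x; apply: cvgD; apply: cvgM; try exact: cvg_cst.
    apply: cvgM; last exact: cpdf.
    apply: cvgM; first exact: cvg_id.
    by apply: continuous_comp; [exact: cid|exact: continuous_sin].
  apply: cvgM; last exact: cpdf.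
  by apply: continuous_comp; [exact: cid|exact: continuous_cos].
have ch : continuous h.
  move=> x; apply: differentiable_continuous; apply/derivable1_diffP.
  exact: (@ex_derive _ _ _ _ _ _ _ (dh x)).
(* The fundamental theorem of calculus applies on these bounded intervals; dominated convergence
   then lets them grow. *)
pose I (n : nat) : set R := [set` `[- n.+1%:R : R, n.+1%:R]].
pose fn (n : nat) x := ((h' x)%:E * (\1_(I n) x)%:E)%E.
have Ifn n : (\int[mu]_x fn n x = (h n.+1%:R - h (- n.+1%:R))%:E)%E.
  rewrite /fn.
  have -> : (\int[mu]_x ((h' x)%:E * (\1_(I n) x)%:E) =
     \int[mu]_(x in I n) (h' x)%:E)%E.
    rewrite [RHS]integral_mkcond; apply: eq_integral => x _.
    by rewrite patchE indicE; case: ifPn => _; rewrite ?mule1 ?mule0.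
  have nn : - n.+1%:R < n.+1%:R :> R by rewrite (@lt_trans _ _ 0)// ?oppr_lt0 ltr0n.
  rewrite (continuous_FTC2 nn _ _ (F := h))//.
  - exact: continuous_subspaceT.
  - split; first by move=> x _; exact: (@ex_derive _ _ _ _ _ _ _ (dh x)).
      by apply: cvg_at_right_filter; exact: ch.
    by apply: cvg_at_left_filter; exact: ch.
  - by move=> x _; rewrite derive1E; exact: (@derive_val _ _ _ _ _ _ _ (dh x)).
have mh' := measurable_int mu ih'.
have mfn n : measurable_fun setT (fn n).
  apply: emeasurable_funM => //; apply/measurable_EFinP.
  by apply: measurable_indic; exact: measurable_itv.
have fncv (x : R) : fn ^~ x @ \oo --> (EFin \o h') x.
  apply: cvg_near_cst; near=> n.
  rewrite /fn indicE mem_set ?mule1// /I /= in_itv/=.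
  rewrite -ler_norml; apply: (@le_trans _ _ n%:R); last by rewrite ler_nat.
  by near: n; exact: nbhs_infty_ger.
have fnle (x : R) n : (`|fn n x| <= `|(EFin \o h') x|)%E.
  rewrite /fn abseM indicE; case: (x \in I n); rewrite ?abse1 ?mule1//.
  by rewrite abse0 mule0.
have [|||_ _ C] := @dominated_convergence _ _ _ mu setT measurableT fn
  (EFin \o h') (abse \o (EFin \o h')) mfn mh'.
- by apply: aeW => x _; exact: fncv.
- exact: integrable_abse.
- by apply: aeW => x n _; exact: fnle.
(* Decay of the boundary terms: exp(-y) <= 1 / y at y = x^2 / (2 s^2), together with x^2 >= |x| when
   |x| >= 1, bounds |h x| by K / |x|. *)
pose K := normal_peak s * (s ^+ 2 *+ 2).
have s2 : 0 < s ^+ 2 by rewrite exprn_even_gt0.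
have p0 := normal_peak_gt0 s0.
have pdfK (x : R) : 1 <= `|x| -> `|h x| <= K * `|x|^-1.
  move=> x1; rewrite /h normrM (ger0_norm (normal_pdf_ge0 _ _ _)).
  apply: (@le_trans _ _ (pdf x)).
    by rewrite ler_piMr ?normal_pdf_ge0// sin_max.
  rewrite normal_pdf0E// /K -mulrA ler_pM2l// expRN.
  have x0 : 0 < `|x| by rewrite (lt_le_trans _ x1).
  rewrite -[leRHS]invrK lef_pV2 ?posrE ?expR_gt0 ?invr_gt0 ?mulr_gt0 ?mulrn_wgt0 ?invr_gt0//.
  rewrite invfM invrK mulrC.
  apply: (@le_trans _ _ (x ^+ 2 / (s ^+ 2 *+ 2))).
    rewrite ler_pM2r ?invr_gt0 ?mulrn_wgt0// -[x ^+ 2]ger0_norm ?sqr_ge0//.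
    by rewrite normrX expr2 ler_peMr// ltW.
  by apply: le_trans (expR_ge1Dx _); rewrite lerDr.
have C0 : (fun n => (h n.+1%:R - h (- n.+1%:R))%:E) @ \oo --> 0%E.
  apply: cvg_EFin; first by apply: nearW.
  have CK : (fun n => (K + K) * harmonic n) @ \oo --> (0 : R).
    rewrite -[X in _ --> X](mulr0 (K + K)).
    by apply: cvgM; [exact: cvg_cst|exact: cvg_harmonic].
  apply/norm_cvg0P; apply: squeeze_cvgr CK; last exact: cvg_cst.
  apply: nearW => n; rewrite normr_ge0/= (le_trans (ler_normB _ _))//.
  have h1 : (1 : R) <= `|n.+1%:R| by rewrite ger0_norm// ler1n.
  have h2 : (1 : R) <= `|- n.+1%:R| by rewrite normrN.
  have := pdfK _ h1; have := pdfK _ h2; rewrite normrN (@ger0_norm _ n.+1%:R)// mulrDl.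
  by move=> *; exact: lerD.
have : (\int[mu]_x (h' x)%:E = 0)%E.
  apply: (cvg_unique _ C); first exact: ereal_hausdorff.
  rewrite (_ : [sequence _]_n = (fun n => (h n.+1%:R - h (- n.+1%:R))%:E))//.
  by apply/funext => n; exact: Ifn.
move=> I0; have : \int[mu]_x h' x = 0 by rewrite /Rintegral I0.
rewrite /h' RintegralD// !RintegralZl// => H.
set A := \int[mu]_x _ in H *; set B := \int[mu]_x _ in H *.
have : - s ^+ 2 * (- s ^- 2 * A + t * B) = 0 by rewrite H mulr0.
have -> : - s ^+ 2 * (- s ^- 2 * A + t * B) = A - s ^+ 2 * t * B.
  by field; exact: s0.
by move/eqP; rewrite subr_eq0 => /eqP.
Unshelve. all: by end_near. Qed.

Lemma normal_charfn (th t : R) :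
  Ex (normal_prob 0 s) (fun x => cos (th + t * x)) =
  cos th * expR (- (s ^+ 2 * t ^+ 2 / 2)).
Proof.
have mlin (u : R) : measurable_fun setT (fun x : R => th + u * x).
  by apply: measurable_funD => //; exact: measurable_funM.
have EN u : Ex (normal_prob 0 s) (fun x => cos (th + u * x)) =
    \int[mu]_x (cos (th + u * x) * pdf x).
  have h := Ex_normal s (measurable_cos (mlin u)) (fun x => cos_max _).
  exact: h.
rewrite EN; pose phi (u : R) : R := \int[mu]_x (cos (th + u * x) * pdf x).
rewrite -/(phi t).
have ic u : mu.-integrable setT (EFin \o (fun x => cos (th + u * x) * pdf x)).
  apply: (integrable_pdf_bounded s0 (M := 1)); first exact: measurable_cos.
  by move=> x; rewrite mul1r (le_trans (cos_max _))// lerDl sqr_ge0.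
have is1 u : mu.-integrable setT
    (EFin \o (fun x => x * sin (th + u * x) * pdf x)).
  apply: (integrable_pdf_bounded s0 (M := 1)).
    by apply: measurable_funM => //; exact: measurable_sin.
  move=> x; rewrite normrM mul1r.
  have : `|x| * `|sin (th + u * x)| <= `|x| by rewrite ler_piMr// sin_max.
  move/le_trans; apply; rewrite -[x ^+ 2]ger0_norm ?sqr_ge0// normrX.
  by have := sqr_ge0 (`|x| - 1); have := normr_ge0 x; nra.
have i2 := integrable_sqr_normal_pdf s0.
pose B := \int[mu]_x (x ^+ 2 * pdf x).
have dphi (u : R) : is_derive u 1 phi (- (s ^+ 2 * u * phi u)).
  (* The integrand has remainder at most 4 (k x)^2: one unit from the cosine and three from
     [sin_lindeberg] at [e = 1]. *)
  apply: (@is_derive_quadratic _ _ _ _ (4 * B)) => k.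
  rewrite /phi -stein_sin mulrN opprK.
  rewrite -RintegralB// -RintegralZl// -RintegralD//; last 2 first.
  - exact: (integrableB measurableT (ic _) (ic _)).
  - exact: (integrableZl measurableT _ (is1 _)).
  have -> : 4 * B * k ^+ 2 = \int[mu]_x (4 * k ^+ 2 * (x ^+ 2 * pdf x)).
    by rewrite RintegralZl// /B; ring.
  have i3 : mu.-integrable setT (EFin \o (fun x =>
      cos (th + (u + k) * x) * pdf x - cos (th + u * x) * pdf x +
      k * (x * sin (th + u * x) * pdf x))).
    have iA := integrableB measurableT (ic (u + k)) (ic u).
    have iB := integrableZl measurableT k (is1 u).
    exact: (integrableD measurableT iA iB).
  have i4 := integrable_abse i3.
  have i5 := integrableZl measurableT (4 * k ^+ 2) i2.
  apply: (le_trans (le_normr_Rintegral measurableT i3)).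
  apply: (le_Rintegral measurableT i4 i5).
  move=> x _.
  have -> : cos (th + (u + k) * x) * pdf x - cos (th + u * x) * pdf x +
      k * (x * sin (th + u * x) * pdf x) =
      (cos ((th + u * x) + k * x) - cos (th + u * x) +
        (k * x) * sin (th + u * x)) * pdf x.
    by rewrite (_ : th + (u + k) * x = th + u * x + k * x); ring.
  rewrite normrM (ger0_norm (normal_pdf_ge0 _ _ _)) mulrA ler_wpM2r ?normal_pdf_ge0//.
  have -> : 4 * k ^+ 2 * x ^+ 2 = 4 * (k * x) ^+ 2 by ring.
  rewrite cosD.
  set a := th + u * x; set y := k * x.
  have -> : cos a * cos y - sin a * sin y - cos a + y * sin a =
    - (cos a * (1 - cos y)) - sin a * (sin y - y) by ring.
  have c1 : `|cos a * (1 - cos y)| <= y ^+ 2.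
    rewrite normrM -[leRHS]mul1r ler_pM//; first exact: cos_max.
    rewrite ger0_norm ?oneB_cos_ge0//; apply: (le_trans (oneB_cos_le y)).
    by have := sqr_ge0 y; lra.
  have c2 : `|sin a * (sin y - y)| <= 3 * y ^+ 2.
    rewrite normrM -[leRHS]mul1r ler_pM//; first exact: sin_max.
    have := @sin_lindeberg R 1 y; rewrite ltr01 lexx => /(_ isT)/le_trans; apply.
    by have := sqr_ge0 y; case: (1 < `|y|)%R => /=; lra.
  by move: c1 c2; rewrite !ler_norml; set X := cos a * _; set Y := sin a * _; lra.
(* By Stein's identity [phi' = - s^2 u phi], so that [psi] is constant. *)
pose psi : R -> R := phi * (expR \o (fun u : R => s ^+ 2 / 2 * u ^+ 2)).
have dpsi (u : R) : is_derive u 1 psi 0.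
  have d1 := dphi u.
  have d2 : is_derive u 1 (fun u : R => s ^+ 2 / 2 * u ^+ 2) (s ^+ 2 * u).
    have -> : (fun u : R => s ^+ 2 / 2 * u ^+ 2) = (s ^+ 2 / 2) \*: (fun u : R => u ^+ 2).
      by apply/funext.
    apply: is_derive_eq; rewrite /GRing.scale/=; by field.
  apply: is_derive_eq; rewrite /GRing.scale/=; ring.
have := is_derive_0_is_cst t 0 dpsi.
have psiE u : psi u = phi u * expR (s ^+ 2 / 2 * u ^+ 2) by [].
rewrite !psiE expr0n/= mulr0 expR0 mulr1.
have -> : phi 0 = cos th.
  rewrite /phi -EN -[RHS](Ex_cst (normal_prob 0 s)).
  by apply: eq_Ex => x; rewrite mul0r addr0.
move=> <-; rewrite -mulrA -expRD.
have -> : s ^+ 2 / 2 * t ^+ 2 - s ^+ 2 * t ^+ 2 / 2 = 0 by field.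
by rewrite expR0 mulr1.
Qed.

End stein.

(** * Dominated convergence and Fubini's theorem for [Ex] *)

Section dominated_convergence.
Context d (T : measurableType d) (R : realType) (P : probability T R).

Lemma cvg_Ex_dominated (f_ : nat -> T -> R) (f g : T -> R) :
  (forall n, measurable_fun setT (f_ n)) -> intg P g ->
  (forall n w, `|f_ n w| <= g w) -> (forall w, f_ ^~ w @ \oo --> f w) ->
  (fun n => Ex P (f_ n)) @ \oo --> Ex P f.
Proof.
move=> mf ig fg ff.
have mf' : measurable_fun setT f.
  by apply: (measurable_fun_cvg mf) => w _; exact: ff.
have fg' w : `|f w| <= g w.
  by apply: (cvgr_to_le (cvg_norm (ff w))); apply: nearW => n; exact: fg.
have [|||||_ _ C] := @dominated_convergence _ _ _ P setT measurableT
  (fun n => EFin \o f_ n) (EFin \o f) (EFin \o g) _ _.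
- by move=> n; exact/measurable_EFinP.
- exact/measurable_EFinP.
- by apply: aeW => w _; apply: cvg_EFin; [exact: nearW|exact: ff].
- exact: ig.
- by apply: aeW => w n _ /=; rewrite lee_fin.
apply: fine_cvg; rewrite fineK//.
by apply: integrable_fin_num => //; exact: (intg_le mf' ig fg').
Qed.

Lemma cvg_Ex_bounded (f_ : nat -> T -> R) (f : T -> R) (M : R) :
  (forall n, measurable_fun setT (f_ n)) -> (forall n w, `|f_ n w| <= M) ->
  (forall w, f_ ^~ w @ \oo --> f w) ->
  (fun n => Ex P (f_ n)) @ \oo --> Ex P f.
Proof. by move=> mf; apply: cvg_Ex_dominated => //; exact: intg_cst. Qed.

End dominated_convergence.

Section bounded_fubini.
Context d1 d2 (T1 : measurableType d1) (T2 : measurableType d2) (R : realType).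
Context (P : probability T1 R) (Q : probability T2 R).
Context (f : T1 * T2 -> R) (M : R).
Context (mf : measurable_fun setT f) (fM : forall z, `|f z| <= M).

Let fi : (P \x Q)%E.-integrable setT (EFin \o f).
Proof. exact: (intg_bounded (P \x Q)%E mf fM). Qed.

Lemma measurable_Ex_snd : measurable_fun setT (fun x => Ex Q (fun y => f (x, y))).
Proof. by apply: measurableT_comp => //; exact: (measurable_fubini_F fi). Qed.

Lemma fubini_Ex :
  Ex P (fun x => Ex Q (fun y => f (x, y))) =
  Ex Q (fun y => Ex P (fun x => f (x, y))).
Proof.
have mfx x : measurable_fun setT (fun y => f (x, y)).
  exact: (measurableT_comp mf (pair1_measurable x)).
have mfy y : measurable_fun setT (fun x => f (x, y)).
  exact: (measurableT_comp mf (pair2_measurable y)).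
rewrite {1}/Ex /Rintegral [RHS]/Ex /Rintegral; congr fine.
transitivity (\int[P]_x \int[Q]_y (f (x, y))%:E)%E.
  apply: eq_integral => x _; rewrite fineK//; apply: integrable_fin_num => //.
  exact: (intg_bounded Q (mfx x) (fun y => fM (x, y))).
rewrite (Fubini fi); apply: eq_integral => y _; rewrite fineK//.
apply: integrable_fin_num => //.
exact: (intg_bounded P (mfy y) (fun x => fM (x, y))).
Qed.

Lemma Ex_prod :
  Ex (P \x Q)%E f = Ex P (fun x => Ex Q (fun y => f (x, y))).
Proof.
have mfx x : measurable_fun setT (fun y => f (x, y)).
  exact: (measurableT_comp mf (pair1_measurable x)).
rewrite {1}/Ex /Rintegral -(integral12_prod_meas1 fi) [RHS]/Ex /Rintegral.
congr fine; apply: eq_integral => x _; rewrite fineK//.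
apply: integrable_fin_num => //.
exact: (intg_bounded Q (mfx x) (fun y => fM (x, y))).
Qed.

End bounded_fubini.

Section gaussian_smoothing.
Context {R : realType}.

(** exp(-(u x)^2 / 2) is the characteristic function of the standard normal law at u x; the two
    expectations are then exchanged by Fubini's theorem. *)
Lemma gauss_smoothing d (T : measurableType d) (P : probability T R)
    (X : T -> R) (u : R) : measurable_fun setT X ->
  Ex P (fun w => expR (- ((u * X w) ^+ 2 / 2))) =
  Ex (normal_prob 0 1) (fun y : R => Ex P (fun w => cos (u * y * X w))).
Proof.
move=> mX; rewrite -(@fubini_Ex _ _ _ _ _ P (normal_prob 0 1)
  (fun z => cos (u * z.2 * X z.1)) 1).
- apply: eq_Ex => w.
  have := @normal_charfn R 1 (oner_neq0 _) 0 (u * X w).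
  rewrite cos0 expr1n !mul1r => <-; apply: eq_Ex => x.
  by rewrite add0r mulrAC.
- apply: measurable_cos; apply: measurable_funM.
    by apply: measurable_funM => //; exact: measurable_snd.
  exact: (measurableT_comp mX measurable_fst).
- by move=> z; exact: cos_max.
Qed.

End gaussian_smoothing.

(** * Approximation by trigonometric polynomials on cubes *)

Section trigonometric_polynomials.
Context {R : realType} {q : nat}.
Implicit Types (f g : 'rV[R]_q -> R) (t : 'I_q -> R).

(** Phases take the place of sines. The product formula for cosines makes this class an algebra, and
    convergence of characteristic functions extends to it by linearity. *)
Inductive trigpoly : ('rV[R]_q -> R) -> Prop :=
| trigpoly_cos th t : trigpoly (fun x => cos (th + \sum_j t j * x ord0 j))
| trigpolyD f g : trigpoly f -> trigpoly g -> trigpoly (fun x => f x + g x)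
| trigpolyZ c f : trigpoly f -> trigpoly (fun x => c * f x).

Lemma trigpoly_eq f g : f =1 g -> trigpoly f -> trigpoly g.
Proof. by move=> /funext ->. Qed.

Lemma trigpoly_cst c : trigpoly (fun=> c).
Proof.
apply: (trigpoly_eq _ (trigpolyZ c (trigpoly_cos 0 (fun=> 0)))) => x.
by rewrite big1 ?addr0 ?cos0 ?mulr1// => j _; rewrite mul0r.
Qed.

Lemma trigpolyM f g : trigpoly f -> trigpoly g -> trigpoly (fun x => f x * g x).
Proof.
move=> tf; elim: tf g => [th t g tg|f1 f2 _ IH1 _ IH2 g tg|c f1 _ IH g tg].
- elim: tg => [th' t'|g1 g2 _ IH1 _ IH2|c g1 _ IH].
  + apply: (trigpoly_eq _ (trigpolyZ 2^-1 (trigpolyD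
      (trigpoly_cos (th + th') (fun j => t j + t' j))
      (trigpoly_cos (th - th') (fun j => t j - t' j))))) => x.
    set a := th + \sum_j t j * x ord0 j; set b := th' + \sum_j t' j * x ord0 j.
    have -> : th + th' + \sum_j (t j + t' j) * x ord0 j = a + b.
      rewrite /a /b addrACA -big_split; congr (_ + _).
      by apply: eq_bigr => j _; rewrite mulrDl.
    have -> : th - th' + \sum_j (t j - t' j) * x ord0 j = a - b.
      rewrite /a /b opprD addrACA -sumrB; congr (_ + _).
      by apply: eq_bigr => j _; rewrite mulrBl.
    by rewrite cosD cosB; field.
  + by apply: (trigpoly_eq _ (trigpolyD IH1 IH2)) => x; rewrite mulrDr.
  + by apply: (trigpoly_eq _ (trigpolyZ c IH)) => x; rewrite mulrCA.
- by apply: (trigpoly_eq _ (trigpolyD (IH1 _ tg) (IH2 _ tg))) => x; rewrite mulrDl.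
- by apply: (trigpoly_eq _ (trigpolyZ c (IH _ tg))) => x; rewrite mulrA.
Qed.

(* One step moves the state [k] to [k + e_j] with probability [u j]; after
   [N] steps in each coordinate the state is binomial(N, u j) distributed, so
   that [bernstein] is the multivariate Bernstein operator. *)
Definition incr_state (k : 'I_q -> nat) (j : 'I_q) : 'I_q -> nat :=
  fun i => (k i + (i == j))%N.

Fixpoint bernstein (u : 'I_q -> R) (s : seq 'I_q) (F : ('I_q -> nat) -> R)
    (k : 'I_q -> nat) : R :=
  if s is j :: s' then
    (1 - u j) * bernstein u s' F k + u j * bernstein u s' F (incr_state k j)
  else F k.

Lemma bernstein_cst u s c k : bernstein u s (fun=> c) k = c.
Proof. by elim: s k => //= j s IH k; rewrite !IH; ring. Qed.

Lemma bernsteinD u s F G k :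
  bernstein u s (fun k => F k + G k) k = bernstein u s F k + bernstein u s G k.
Proof. by elim: s k => //= j s IH k; rewrite !IH; ring. Qed.

Lemma bernsteinZ u s c F k :
  bernstein u s (fun k => c * F k) k = c * bernstein u s F k.
Proof. by elim: s k => //= j s IH k; rewrite !IH; ring. Qed.

Lemma bernstein_sum u s (F : 'I_q -> ('I_q -> nat) -> R) k :
  bernstein u s (fun k => \sum_j F j k) k = \sum_j bernstein u s (F j) k.
Proof.
elim: s k => //= j s IH k; rewrite !IH !mulr_sumr -big_split.
by apply: eq_bigr.
Qed.

Lemma bernstein_le u s F G k : (forall j, 0 <= u j <= 1) ->
  (forall k, F k <= G k) -> bernstein u s F k <= bernstein u s G k.
Proof.
move=> u01 FG; elim: s k => //= j s IH k; have /andP[u0 u1] := u01 j.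
by rewrite lerD// ler_wpM2l// subr_ge0.
Qed.

Lemma bernstein_norm_le u s F G k : (forall j, 0 <= u j <= 1) ->
  (forall k, `|F k| <= G k) -> `|bernstein u s F k| <= bernstein u s G k.
Proof.
move=> u01 FG; rewrite ler_norml; apply/andP; split.
  rewrite -mulN1r -bernsteinZ; apply: bernstein_le => // k'.
  by rewrite mulN1r; have := FG k'; rewrite ler_norml => /andP[].
by apply: bernstein_le => // k'; rewrite (le_trans (ler_norm _)).
Qed.

(** Squared bias plus variance of a binomial count started at [k i]: [count_mem i s] trials concern
    coordinate [i], each with success probability [u i]. *)
Lemma bernstein_sqr u s (i : 'I_q) (a : R) k :
  bernstein u s (fun k => ((k i)%:R - a) ^+ 2) k =
  ((k i)%:R + (count_mem i s)%:R * u i - a) ^+ 2 +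
  (count_mem i s)%:R * (u i * (1 - u i)).
Proof.
elim: s k => [k|j s IH k] /=; first by rewrite !mul0r !addr0.
rewrite !IH /incr_state; have [->|ij] := eqVneq i j.
  by rewrite !natrD mulr1n; ring.
by rewrite addn0 add0n; ring.
Qed.

Lemma trigpoly_bernstein (u : 'rV[R]_q -> 'I_q -> R) s F k :
  (forall j, trigpoly (u ^~ j)) -> trigpoly (fun x => bernstein (u x) s F k).
Proof.
move=> tu; elim: s k => [k|j s IH k] /=; first exact: trigpoly_cst.
apply: trigpolyD; apply: trigpolyM => //.
apply: (trigpoly_eq _ (trigpolyD (trigpoly_cst 1) (trigpolyZ (-1) (tu j)))) => x.
by rewrite mulN1r.
Qed.

End trigonometric_polynomials.

Section trigonometric_approximation.
Context {R : realType} {q : nat}.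
Implicit Types (f : 'rV[R]_q -> R).

(** Compactness in its near-covering form, applied to pairs of a point and a radius. Only [x] is
    confined to the cube, so nothing has to be checked for the Bernstein nodes that serve as [y]. *)
Lemma cube_uniform_continuous f (L e : R) : continuous f -> 0 < e ->
  exists2 dl, 0 < dl & forall x y : 'rV[R]_q, (forall j, `|x ord0 j| <= L) ->
    (forall j, `|x ord0 j - y ord0 j| < dl) -> `|f x - f y| < e.
Proof.
move=> cf e0; pose K := [set v : 'rV[R]_q | forall i, `[- L, L]%classic (v ord0 i)].
have cK : compact K.
  apply: (@rV_compact R q (fun=> `[- L, L]%classic)) => i; exact: segment_compact.
pose Pr dl (x : 'rV[R]_q) := forall y : 'rV[R]_q,
   (forall j, `|x ord0 j - y ord0 j| < dl) -> `|f x - f y| < e.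
have : \forall dl \near 0^'+, K `<=` Pr dl.
  apply: ((compact_near_coveringP K).1 cK R (at_right (0 : R)) Pr) => x _.
  have /cvgrPdist_lt/(_ (e / 2)) := cf x; rewrite divr_gt0// => /(_ isT).
  move=> /nbhs_ballP[r /= r0 xr].
  exists (ball x (r / 2), [set dl | dl <= r / 2]) => /=.
    split; first by apply: nbhsx_ballx; rewrite divr_gt0.
    by apply: nbhs_right_le; rewrite divr_gt0.
  move=> [x' dl] [/= xx' dlr] y x'y.
  have h1 : `|f x - f x'| < e / 2.
    by apply: xr; apply: le_ball xx'; rewrite ler_pdivrMr// ler_pMr// ler1n.
  have h2 : `|f x - f y| < e / 2.
    apply: xr; split=> // i j; rewrite (ord1 i); have := xx'.2 ord0 j.
    rewrite /ball/= => h; have := x'y j => h'.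
    rewrite -(subrK (x' ord0 j) (x ord0 j)) -addrA.
    rewrite (le_lt_trans (ler_normD _ _))// [ltRHS]splitr ltrD//.
    by rewrite (lt_le_trans h').
  rewrite -(subrK (f x) (f x')) -addrA (le_lt_trans (ler_normD _ _))//.
  by rewrite [ltRHS]splitr ltrD// distrC.
move=> H; near (0 : R)^'+ => dl; exists dl => // x y xL.
have KP : K `<=` Pr dl by near: dl.
by apply: KP => i; rewrite /= in_itv/= -ler_norml.
Unshelve. all: by end_near. Qed.

(** With g = (a + b) / 2 and h = (a - b) / 2 the two sides are 2 sin^2 h and 2 cos g sin h; as |g|
    <= pi / 2 - h, cos g is at least sin h. *)
Lemma sin_diff_lower (a b : R) : - (pi / 2) <= a <= pi / 2 ->
  - (pi / 2) <= b <= pi / 2 -> 1 - cos (a - b) <= `|sin a - sin b|.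
Proof.
wlog ab : a b / b <= a => [H|].
  have [|/ltW] := leP b a; first exact: H.
  move=> /H h ha hb; rewrite distrC -cosN opprB; exact: h.
move=> /andP[a0 a1] /andP[b0 b1].
set h := (a - b) / 2; set g := (a + b) / 2.
have ea : a = g + h by rewrite /g /h; field.
have eb : b = g - h by rewrite /g /h; field.
have -> : sin a - sin b = 2 * (cos g * sin h).
  by rewrite {1}ea {1}eb sinD sinB; ring.
rewrite oneB_cosE -/h.
have h0 : 0 <= h by rewrite divr_ge0// subr_ge0.
have pi0 := pi_gt0 R.
have hpi : h <= pi / 2 by rewrite /h ler_pM2r//; lra.
have sh : 0 <= sin h by apply: sin_ge0_pi; rewrite h0/= (le_trans hpi)//; lra.
have cg : sin h <= cos g.
  rewrite -cosBpihalf -cosN opprB -(cos_norm g).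
  have hg : `|g| <= pi / 2 - h.
    by rewrite ler_norml /g /h; apply/andP; split; lra.
  rewrite leNgt; apply/negP => lt; have : pi / 2 - h < `|g|.
    rewrite -ltr_cos// in_itv/=; apply/andP; split; rewrite ?normr_ge0//; lra.
  by rewrite ltNge hg.
rewrite ger0_norm ?mulr_ge0//; last exact: le_trans cg.
by rewrite ler_pM2l// expr2 ler_wpM2r.
Qed.

End trigonometric_approximation.

Section bernstein_approximation.
Context {R : realType} {q : nat}.

(* [coord L] maps [[-L, L]^q] homeomorphically onto [[0, 1]^q], and a Bernstein
   polynomial in it is a trigonometric polynomial. *)
Let coord (L : R) (x : 'rV[R]_q) (j : 'I_q) : R :=
  (1 + sin (pi / 2 / L * x ord0 j)) / 2.

Let trigpoly_coord L j : trigpoly ((coord L) ^~ j).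
Proof.
apply: (trigpoly_eq _ (trigpolyZ 2^-1 (trigpolyD (trigpoly_cst 1)
  (trigpoly_cos (- (pi / 2)) (fun i => (pi / 2 / L) *+ (i == j)))))) => x.
rewrite (bigD1 j)//= eqxx big1 => [|i /negbTE ->]; last by rewrite mul0r.
by rewrite addr0 mulr1n [- _ + _]addrC cosBpihalf /coord mulrC.
Qed.

Let coord_itv L x j : 0 <= coord L x j <= 1.
Proof.
have := sin_geN1 (pi / 2 / L * x ord0 j); have := sin_le1 (pi / 2 / L * x ord0 j).
by rewrite /coord; lra.
Qed.

(** At the ends of the interval the derivative of sine vanishes and the inverse is not Lipschitz;
    [sin_diff_lower] supplies the modulus of continuity instead. *)
Lemma asin_close (L dl : R) : 0 < L -> 0 < dl ->
  exists2 eta, 0 < eta & forall x v : R, `|x| <= L -> 0 <= v <= 1 ->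
    `|v - (1 + sin (pi / 2 / L * x)) / 2| < eta ->
    `|x - asin (2 * v - 1) / (pi / 2 / L)| < dl.
Proof.
move=> L0 dl0; have pi0 := pi_gt0 R; set c := pi / 2 / L.
have c0 : 0 < c by rewrite !divr_gt0.
(* Angles closer than [m] give the claim after division by [c]; the cap at pi keeps [m] in the
   interval where cosine decreases. *)
pose m := Num.min (c * dl) pi.
have m0 : 0 < m by rewrite lt_min mulr_gt0.
have mpi : m <= pi by rewrite ge_min lexx orbT.
have cm : cos m < 1.
  by rewrite -cos0 ltr_cos ?in_itv/= ?lexx ?(ltW pi0) ?(ltW m0).
exists ((1 - cos m) / 2); first by rewrite divr_gt0// subr_gt0.
move=> x v xL v01 close.
have v11 : -1 <= 2 * v - 1 <= 1 by move: v01 => /andP[? ?]; apply/andP; split; lra.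
set b := asin (2 * v - 1); set a := c * x.
have sb : sin b = 2 * v - 1 by rewrite /b asinK.
have cL : c * L = pi / 2 by rewrite /c divfK ?gt_eqF.
have ai : - (pi / 2) <= a <= pi / 2.
  by rewrite -ler_norml /a normrM (gtr0_norm c0) -cL ler_pM2l.
have bi : - (pi / 2) <= b <= pi / 2 by rewrite asin_geNpi2// asin_lepi2.
have h := sin_diff_lower ai bi.
have {}h : 1 - cos (a - b) < 1 - cos m.
  apply: (le_lt_trans h); rewrite sb.
  have -> : sin a - (2 * v - 1) = - (2 * (v - (1 + sin a) / 2)) by field.
  rewrite normrN normrM ger0_norm// mulrC -ltr_pdivlMr//; exact: close.
have abm : `|a - b| < m.
  rewrite ltNge; apply/negP => mab.
  have : cos `|a - b| <= cos m.
    rewrite leNgt ltr_cos ?in_itv/= ?(ltW m0)//; first by rewrite -leNgt.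
    by rewrite normr_ge0/= ler_norml; move: ai bi => /andP[? ?] /andP[? ?];
      apply/andP; split; lra.
  by rewrite cos_norm => h'; lra.
rewrite (_ : x - b / c = (a - b) / c); last by rewrite /a; field; rewrite gt_eqF.
rewrite normrM normfV (gtr0_norm c0) ltr_pdivrMr// mulrC.
by rewrite (lt_le_trans abm)// ge_min lexx.
Qed.

(** The Bernstein operator is applied to [f] read in the coordinates [coord L]. These lie in [0, 1]
    on the whole space and not only on the cube, which is why the bound [M] survives everywhere, as
    the tail estimates require. *)
Lemma trig_approximation (f : 'rV[R]_q -> R) (M L e : R) : continuous f ->
  (forall x, `|f x| <= M) -> 0 < L -> 0 < e ->
  exists p, [/\ trigpoly p, forall x, `|p x| <= M &
    forall x : 'rV[R]_q, (forall j, `|x ord0 j| <= L) -> `|p x - f x| <= e].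
Proof.
move=> cf fM L0 e0; have M0 : 0 <= M by rewrite (le_trans _ (fM 0)).
have e20 : 0 < e / 2 by rewrite divr_gt0.
have [dl dl0 fdl] := cube_uniform_continuous L cf e20.
have [eta eta0 Heta] := asin_close L0 dl0.
(* Chebyshev's argument: if some frequency is at least [eta] away from its mean, the error [2 * M]
   is at most [K] times the squared deviation. *)
pose K := 2 * M / eta ^+ 2.
have K0 : 0 <= K by rewrite divr_ge0 ?sqr_ge0 ?mulr_ge0.
(* The counts have total variance at most q N, which leaves an error K q / N beyond e / 2; this
   choice makes it at most e / 2. *)
pose N := (Num.truncn (2 * K * q%:R / e)).+1.
have N0 : 0 < N%:R :> R by rewrite ltr0n.
(* The nodes invert [coord L] at the frequencies. States are arbitrary functions, hence the cap at 1
   for counts above [N]. *)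
pose y (k : 'I_q -> nat) : 'rV[R]_q :=
  \row_j (asin (2 * Num.min ((k j)%:R / N%:R) 1 - 1) / (pi / 2 / L)).
pose F k := f (y k).
pose s := flatten (nseq N (enum 'I_q)).
have cs i : count_mem i s = N.
  rewrite /s count_flatten map_nseq sumn_nseq count_uniq_mem ?enum_uniq//.
  by rewrite mem_enum mul1n.
exists (fun x => bernstein (coord L x) s F (fun=> 0%N)); split.
- by apply: trigpoly_bernstein => j; exact: trigpoly_coord.
- move=> x; rewrite -[leRHS](bernstein_cst (coord L x) s M (fun=> 0%N)).
  by apply: bernstein_norm_le => [j|k]; [exact: coord_itv | exact: fM].
move=> x xL.
have -> : bernstein (coord L x) s F (fun=> 0%N) - f x =
    bernstein (coord L x) s (fun k => F k + (- f x)) (fun=> 0%N).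
  by rewrite bernsteinD bernstein_cst.
pose G (k : 'I_q -> nat) := e / 2 +
  K / N%:R ^+ 2 * \sum_j ((k j)%:R - N%:R * coord L x j) ^+ 2.
have FG k : `|F k + - f x| <= G k.
  have termE j : ((k j)%:R - N%:R * coord L x j) ^+ 2 =
      N%:R ^+ 2 * ((k j)%:R / N%:R - coord L x j) ^+ 2.
    by field; rewrite gt_eqF.
  have sum0 : 0 <= \sum_j ((k j)%:R - N%:R * coord L x j) ^+ 2.
    by apply: sumr_ge0 => j _; exact: sqr_ge0.
  have KN0 : 0 <= K / N%:R ^+ 2 by rewrite divr_ge0 ?sqr_ge0.
  have [near_k|/existsNP[j /negP]] := pselect (forall j, `|(k j)%:R / N%:R - coord L x j| < eta).
    rewrite distrC; apply: (@le_trans _ _ (e / 2)); last by rewrite lerDl mulr_ge0.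
    apply/ltW/fdl => // j; rewrite mxE; apply: Heta => //.
      by rewrite le_min ler01 divr_ge0//= ge_min lexx orbT.
    have /andP[u0 u1] := coord_itv L x j.
    apply: le_lt_trans (near_k j); rewrite -/(coord L x j).
    have [kN|kN] := leP ((k j)%:R / N%:R) (1 : R) => //.
    by rewrite !ger0_norm ?subr_ge0// ?lerD2r ltW// (le_lt_trans u1).
  rewrite -leNgt => far_k.
  apply: (@le_trans _ _ (2 * M)).
    by rewrite (le_trans (ler_normB _ _))// mulr_natl mulr2n lerD// fM.
  rewrite /G; apply: (@le_trans _ _ (K / N%:R ^+ 2 * (N%:R ^+ 2 * eta ^+ 2))).
    rewrite /K le_eqVlt; apply/orP; left; apply/eqP; field.
    by rewrite !gt_eqF.
  apply: ler_wpDl; first exact: ltW.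
  rewrite ler_wpM2l// (bigD1 j)//= termE ler_wpDr//.
    by apply: sumr_ge0 => i _; exact: sqr_ge0.
  rewrite ler_wpM2l ?sqr_ge0// -[leRHS]ger0_norm ?sqr_ge0// normrX.
  by rewrite lerXn2r ?nnegrE// ltW.
apply: le_trans (@bernstein_norm_le R q (coord L x) s (fun k => F k + - f x) G
  (fun=> 0%N) (coord_itv L x) FG) _.
rewrite /G bernsteinD bernstein_cst bernsteinZ bernstein_sum.
rewrite [leRHS]splitr lerD2l.
apply: (@le_trans _ _ (K / N%:R ^+ 2 * \sum_(j < q) N%:R)).
  apply: ler_wpM2l; first by rewrite divr_ge0 ?sqr_ge0.
  apply: ler_sum => j _; rewrite bernstein_sqr cs add0r subrr expr0n/= add0r.
  by have /andP[u0 u1] := coord_itv L x j; rewrite ler_piMr ?ltW//; nra.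
rewrite sumr_const card_ord.
have -> : K / N%:R ^+ 2 * (N%:R *+ q) = K * q%:R / N%:R.
  by rewrite -mulr_natr; field; rewrite gt_eqF.
rewrite ler_pdivrMr// -ler_pdivrMl//.
apply: (@le_trans _ _ (2 * K * q%:R / e)).
  by rewrite le_eqVlt; apply/orP; left; apply/eqP; field; rewrite gt_eqF.
by rewrite ltW// /N truncnS_gt.
Qed.

End bernstein_approximation.

Lemma cvg_sumr (R : realType) (I : Type) (r : seq I) (f : I -> nat -> R)
    (l : I -> R) : (forall i, f i @ \oo --> l i) ->
  (fun n => \sum_(i <- r) f i n) @ \oo --> \sum_(i <- r) l i.
Proof. by move=> fl; apply: cvg_big => //; exact: add_continuous. Qed.

Section random_rows.
Context d (T : measurableType d) (R : realType) (P : probability T R) (q : nat).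
Context (Z : 'I_q -> T -> R) (mZ : forall j, measurable_fun setT (Z j)).

Lemma measurable_linear_comb (th : R) (t : 'I_q -> R) :
  measurable_fun setT (fun w => th + \sum_j t j * Z j w).
Proof.
apply: measurable_funD => //; apply: measurable_sum => j.
exact: measurable_funM.
Qed.

Lemma trigpoly_row (p : 'rV[R]_q -> R) : trigpoly p ->
  measurable_fun setT (fun w => p (\row_j Z j w)) /\
  exists M, forall x, `|p x| <= M.
Proof.
elim=> [th t|f g _ [mf [M fM]] _ [mg [M' gM]]|c f _ [mf [M fM]]]; split.
- apply: measurable_cos.
  rewrite [X in measurable_fun _ X](_ : _ = fun w => th + \sum_j t j * Z j w).
    exact: measurable_linear_comb.
  by apply/funext => w; congr (_ + _); apply: eq_bigr => j _; rewrite mxE.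
- by exists 1 => x; exact: cos_max.
- exact: measurable_funD.
- by exists (M + M') => x; rewrite (le_trans (ler_normD _ _))// lerD.
- exact: measurable_funM.
- by exists (`|c| * M) => x; rewrite normrM ler_wpM2l.
Qed.

Lemma trigpoly_intg (p : 'rV[R]_q -> R) : trigpoly p ->
  intg P (fun w => p (\row_j Z j w)).
Proof.
by move=> /trigpoly_row[mp [M pM]]; exact: (intg_bounded P mp (fun w => pM _)).
Qed.

(** A pointwise limit of trigonometric polynomials chosen on growing cubes with vanishing error; no
    sigma-field on row vectors is involved. *)
Lemma measurable_continuous_row (f : 'rV[R]_q -> R) (M : R) : continuous f ->
  (forall x, `|f x| <= M) -> measurable_fun setT (fun w => f (\row_j Z j w)).
Proof.
move=> cf fM.
have ex n : exists p : 'rV[R]_q -> R, [/\ trigpoly p, forall x, `|p x| <= M &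
    forall x : 'rV[R]_q, (forall j, `|x ord0 j| <= n.+1%:R) ->
    `|p x - f x| <= n.+1%:R^-1].
  by apply: trig_approximation => //; rewrite ?invr_gt0 ltr0n.
pose p n := sval (cid (ex n)).
have pP n := svalP (cid (ex n)).
have mp n : measurable_fun setT (fun w => p n (\row_j Z j w)).
  by have [tp _ _] := pP n; have [] := trigpoly_row tp.
apply: (measurable_fun_cvg mp) => w _.
set x := \row_j Z j w; apply/cvgrPdist_le => e e0; near=> n.
have [_ _ H] := pP n; rewrite distrC (le_trans (H x _))//.
  move=> j; apply: (@le_trans _ _ n%:R); last by rewrite ler_nat.
  apply: (@le_trans _ _ (\sum_i `|x ord0 i|)).
    by rewrite (bigD1 j)//= lerDl sumr_ge0.
  by near: n; exact: nbhs_infty_ger.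
rewrite -[leRHS]invrK lef_pV2 ?posrE ?invr_gt0 ?ltr0n//.
apply: (@le_trans _ _ n%:R); last by rewrite ler_nat.
by near: n; exact: nbhs_infty_ger.
Unshelve. all: by end_near. Qed.

End random_rows.

(** * Levy's continuity theorem and uniqueness *)

Section continuity_theorem.
Context {R : realType} d (T : measurableType d) (P : probability T R).
Context d' (T' : measurableType d') (Q : probability T' R) (q : nat).
Context (Z : nat -> 'I_q -> T -> R) (Y : 'I_q -> T' -> R).
Context (mZ : forall n j, measurable_fun setT (Z n j)).
Context (mY : forall j, measurable_fun setT (Y j)).
Context (charfn_cvg : forall th t,
  (fun n => Ex P (fun w => cos (th + \sum_j t j * Z n j w))) @ \oo -->
  Ex Q (fun w => cos (th + \sum_j t j * Y j w))).

Let trigpoly_cvg (p : 'rV[R]_q -> R) : trigpoly p ->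
  (fun n => Ex P (fun w => p (\row_j Z n j w))) @ \oo -->
  Ex Q (fun w => p (\row_j Y j w)).
Proof.
elim=> [th t|f g tf IHf tg IHg|c f tf IHf].
- have E d0 (T0 : measurableType d0) (P0 : probability T0 R) (X : 'I_q -> T0 -> R) :
      Ex P0 (fun w => cos (th + \sum_j t j * (\row_j X j w) ord0 j)) =
      Ex P0 (fun w => cos (th + \sum_j t j * X j w)).
    apply: eq_Ex => w; congr (cos (_ + _)).
    by apply: eq_bigr => j _; rewrite mxE.
  by rewrite E; under eq_fun do rewrite E; exact: charfn_cvg.
- rewrite ExD; [|exact: trigpoly_intg..].
  under eq_fun do rewrite (ExD (trigpoly_intg _ (mZ _) tf) (trigpoly_intg _ (mZ _) tg)).
  exact: cvgD.
- rewrite ExZ; [|exact: trigpoly_intg].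
  under eq_fun do rewrite (ExZ _ (trigpoly_intg _ (mZ _) tf)).
  by apply: cvgM => //; exact: cvg_cst.
Qed.

(* [tail u] is bounded below off a cube of size [1 / u], and its expectation is
   a Gaussian average of values of the characteristic function. *)
Let tail (u x : R) : R := 1 - expR (- ((u * x) ^+ 2 / 2)).

Let tail_ge0 u x : 0 <= tail u x.
Proof. by rewrite subr_ge0 -expR0 ler_expR oppr_le0 divr_ge0 ?sqr_ge0. Qed.

Let tail_le1 u x : `|tail u x| <= 1.
Proof. by rewrite ger0_norm// gerBl expR_ge0. Qed.

Let measurable_tail d0 (T0 : measurableType d0) (X : T0 -> R) u :
  measurable_fun setT X -> measurable_fun setT (fun w => tail u (X w)).
Proof.
move=> mX; apply: measurable_funB => //; apply: measurableT_comp => //.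
apply: measurableT_comp => //; apply: measurable_funM => //.
by apply: measurable_funX; exact: measurable_funM.
Qed.

Let tail_cvg u j :
  (fun n => Ex P (fun w => tail u (Z n j w))) @ \oo -->
  Ex Q (fun w => tail u (Y j w)).
Proof.
have E d0 (T0 : measurableType d0) (P0 : probability T0 R) (X : T0 -> R) :
    measurable_fun setT X ->
    Ex P0 (fun w => tail u (X w)) =
    1 - Ex (normal_prob 0 1) (fun y : R => Ex P0 (fun w => cos (u * y * X w))).
  move=> mX; rewrite -gauss_smoothing// ExB ?Ex_cst//; first exact: intg_cst.
  have mt := measurable_tail u mX.
  have : intg P0 (fun w => 1 - tail u (X w)).
    by apply: intgB; [exact: intg_cst|exact: (intg_bounded P0 mt (fun w => tail_le1 _ _))].
  by under eq_fun do rewrite /tail subKr.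
rewrite (E _ _ _ _ (mY j)); under eq_fun do rewrite (E _ _ _ _ (mZ _ _)).
apply: cvgB; first exact: cvg_cst.
apply: (cvg_Ex_bounded (M := 1)) => [n|n y|y].
- have mz : measurable_fun setT (fun z : R * T => cos (u * z.1 * Z n j z.2)).
    apply: measurable_cos; apply: measurable_funM.
      by apply: measurable_funM => //; exact: measurable_fst.
    exact: (measurableT_comp (mZ n j) measurable_snd).
  exact: (measurable_Ex_snd (normal_prob 0 1) P mz (fun z => cos_max _)).
- apply: Ex_bounded; last by move=> w; exact: cos_max.
  by apply: intg_cos; exact: measurable_funM.
- have H d0 (T0 : measurableType d0) (P0 : probability T0 R) (X : 'I_q -> T0 -> R) :
      Ex P0 (fun w => cos (u * y * X j w)) =
      Ex P0 (fun w => cos (0 + \sum_i ((u * y) *+ (i == j)) * X i w)).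
    apply: eq_Ex => w; rewrite add0r (bigD1 j)//= eqxx big1 ?addr0 ?mulr1n//.
    by move=> i /negbTE ->; rewrite mul0r.
  by rewrite H; under eq_fun do rewrite H; exact: charfn_cvg.
Qed.

Let tail_Y0 j : (fun N => Ex Q (fun w => tail N.+1%:R^-1 (Y j w))) @ \oo --> (0 : R).
Proof.
rewrite -[X in _ --> X](Ex_cst Q 0); apply: (cvg_Ex_bounded (M := 1)) => [n|n w|w].
- exact: measurable_tail.
- exact: tail_le1.
- rewrite /tail -[X in _ --> X](subrr (1 : R)); apply: cvgB; first exact: cvg_cst.
  rewrite -[X in _ --> X]expR0; apply: continuous_cvg; first exact: continuous_expR.
  rewrite -[X in _ --> X]oppr0; apply: cvgN.
  rewrite -[X in _ --> X](mul0r 2^-1); apply: cvgM; last exact: cvg_cst.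
  rewrite -[X in _ --> X](_ : (0 * Y j w) ^+ 2 = 0); last by rewrite mul0r expr0n.
  apply: cvgM; apply: cvgM; try exact: cvg_cst; exact: cvg_harmonic.
Qed.

(** Tightness is read off the limit: the expectations of [tail] under P converge to those under Q,
    which are small for large cubes. On the cube [p] is close to [f], and off it the possible error
    [2 * M] is paid for by [tail]. *)
Theorem charfn_cvg_law : cvg_law P Q Z Y.
Proof.
move=> f cf [M fM].
have mfZ n := measurable_continuous_row (mZ n) cf fM.
have mfY := measurable_continuous_row mY cf fM.
have ifZ n := intg_bounded P (mfZ n) (fun w => fM _).
have ifY := intg_bounded Q mfY (fun w => fM _).
rewrite (expectation_EFin ifY).
under eq_fun do rewrite (expectation_EFin (ifZ _)).
apply: cvg_EFin; first exact: nearW.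
have M0 : 0 <= M by rewrite (le_trans _ (fM 0)).
(* The value of [tail u] at |u x| = 1, hence a lower bound for it off the cube. *)
pose kap : R := 1 - expR (- (1 / 2)).
have kap0 : 0 < kap by rewrite subr_gt0 expR_lt1; lra.
pose K := 2 * M / kap.
have K0 : 0 <= K by rewrite divr_ge0 ?mulr_ge0// ltW.
(* Six errors: one for the convergence of E p, two for [p] against [f] under Q, and three under P,
   where the tail term may exceed its limit by [e1]. *)
apply/cvgrPdist_le => e e0; pose e1 : R := e / 6.
have e10 : 0 < e1 by rewrite divr_gt0.
have [N tN] : exists N : nat, K * \sum_j Ex Q (fun w => tail N.+1%:R^-1 (Y j w)) <= e1.
  have C : (fun N : nat => K * \sum_j Ex Q (fun w => tail N.+1%:R^-1 (Y j w)))
      @ \oo --> (0 : R).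
    rewrite -[X in _ --> X](mulr0 K); apply: cvgM; first exact: cvg_cst.
    by have := cvg_sumr (r := index_enum 'I_q) tail_Y0; rewrite big1.
  move/cvgrPdist_le : C => /(_ _ e10)[N _ /(_ N (leqnn N))].
  by rewrite sub0r normrN => /(le_trans (ler_norm _)) ?; exists N.
pose u : R := N.+1%:R^-1.
have u0 : 0 < u by rewrite invr_gt0 ltr0n.
have L0 : 0 < N.+1%:R :> R by rewrite ltr0n.
have [p [tp pM pf]] := trig_approximation cf fM L0 e10.
have bound (x : 'rV[R]_q) : `|p x - f x| <= e1 + K * \sum_j tail u (x ord0 j).
  have s0 : 0 <= \sum_j tail u (x ord0 j) by apply: sumr_ge0.
  have [xL|/existsNP[j /negP]] := pselect (forall j, `|x ord0 j| <= N.+1%:R).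
    by rewrite (le_trans (pf x xL))// lerDl mulr_ge0.
  rewrite -ltNge => xj; apply: (@le_trans _ _ (2 * M)).
    by rewrite (le_trans (ler_normB _ _))// mulr_natl mulr2n lerD.
  apply: ler_wpDl; first exact: ltW.
  apply: (@le_trans _ _ (K * kap)).
    by rewrite /K divfK// gt_eqF.
  rewrite ler_wpM2l// (bigD1 j)//= ler_wpDr ?sumr_ge0//.
  rewrite /kap /tail lerD2l lerN2 ler_expR lerN2 ler_pM2r//.
  rewrite -[leRHS]ger0_norm ?sqr_ge0// normrX exprn_ege1//.
  by rewrite normrM (gtr0_norm u0) /u mulrC ler_pdivlMr// mul1r ltW.
have diffE d0 (T0 : measurableType d0) (P0 : probability T0 R)
    (X : 'I_q -> T0 -> R) : (forall j, measurable_fun setT (X j)) ->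
    `|Ex P0 (fun w => p (\row_j X j w)) - Ex P0 (fun w => f (\row_j X j w))| <=
    e1 + K * \sum_j Ex P0 (fun w => tail u (X j w)).
  move=> mX; have ip := trigpoly_intg P0 mX tp.
  have if_ := intg_bounded P0 (measurable_continuous_row mX cf fM) (fun w => fM _).
  have it j : intg P0 (fun w => tail u (X j w)).
    exact: (intg_bounded P0 (measurable_tail u (mX j)) (fun w => tail_le1 _ _)).
  have its : intg P0 (fun w => K * \sum_j tail u (X j w)).
    by apply: intgZ; exact: intg_sum.
  rewrite -ExB// -[e1](Ex_cst P0) -Ex_sum// -ExZ; last exact: intg_sum.
  rewrite -ExD//; last exact: intg_cst.
  apply: Ex_norm_le; [exact: intgB|by apply: intgD => //; exact: intg_cst|].
  move=> w; apply: (le_trans (bound _)); rewrite lerD2l ler_wpM2l// ler_sum// => j _.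
  by rewrite mxE.
have CT : (fun n => K * \sum_j Ex P (fun w => tail u (Z n j w))) @ \oo -->
    K * \sum_j Ex Q (fun w => tail u (Y j w)).
  apply: cvgM; first exact: cvg_cst.
  by apply: cvg_sumr => j; exact: tail_cvg.
have Cp := trigpoly_cvg tp.
move/cvgrPdist_le : CT => /(_ _ e10) CT; move/cvgrPdist_le : Cp => /(_ _ e10) Cp.
near=> n.
have h1 : `|K * \sum_j Ex Q (fun w => tail u (Y j w)) -
  K * \sum_j Ex P (fun w => tail u (Z n j w))| <= e1 by near: n.
have h2 : `|Ex Q (fun w => p (\row_j Y j w)) -
  Ex P (fun w => p (\row_j Z n j w))| <= e1 by near: n.
have fin (a b c f' x y : R) : `|x - y| <= e1 -> `|a - b| <= e1 -> x <= e1 ->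
    `|b - c| <= e1 + y -> `|a - f'| <= e1 + x -> `|f' - c| <= e.
  by rewrite /e1 !ler_norml; lra.
exact: fin h1 h2 tN (diffE _ _ P _ (mZ n)) (diffE _ _ Q _ mY).
Unshelve. all: by end_near. Qed.

End continuity_theorem.

Section uniqueness.
Context {R : realType} d (T : measurableType d) (P : probability T R).
Context d' (T' : measurableType d') (Q : probability T' R).
Context (X : T -> R) (Y : T' -> R).
Context (mX : measurable_fun setT X) (mY : measurable_fun setT Y).
Context (charfn_eq : forall th t,
  Ex P (fun w => cos (th + t * X w)) = Ex Q (fun w => cos (th + t * Y w))).

(** The continuity theorem in dimension 1, applied to the constant sequence X. *)
Let Ex_continuous_eq (g : R -> R) (M : R) : continuous g -> (forall x, `|g x| <= M) ->
  Ex P (fun w => g (X w)) = Ex Q (fun w => g (Y w)).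
Proof.
move=> cg gM; pose f (x : 'rV[R]_1) := g (x ord0 ord0).
have cf : continuous f.
  by move=> x; apply: continuous_comp; [exact: coord_continuous|exact: cg].
have H th t : (fun n : nat => Ex P (fun w => cos (th + \sum_(j < 1) t j * X w))) @ \oo -->
  Ex Q (fun w => cos (th + \sum_(j < 1) t j * Y w)).
  have E d0 (T0 : measurableType d0) (P0 : probability T0 R) (U : T0 -> R) :
      Ex P0 (fun w => cos (th + \sum_(j < 1) t j * U w)) =
      Ex P0 (fun w => cos (th + t ord0 * U w)).
    by apply: eq_Ex => w; rewrite big_ord1.
  by under eq_fun do rewrite E charfn_eq; rewrite E; exact: cvg_cst.
have fM : exists M, forall x, `|f x| <= M by exists M => x; exact: gM.
have C : (fun n : nat => 'E_P[fun w => f (\row_(j < 1) X w)])%E @ \oo -->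
    ('E_Q[fun w => f (\row_(j < 1) Y w)])%E.
  exact: (charfn_cvg_law (Z := fun n j => X) (Y := fun j => Y) (fun _ _ => mX)
    (fun _ => mY) H cf fM).
move: C.
have mg : measurable_fun setT g by exact: continuous_measurable_fun.
have E d0 (T0 : measurableType d0) (P0 : probability T0 R) (U : T0 -> R) :
    measurable_fun setT U -> ('E_P0[fun w => f (\row_(j < 1) U w)] = (Ex P0 (fun w => g (U w)))%:E)%E.
  move=> mU; rewrite (_ : (fun w => f _) = (fun w => g (U w))); last first.
    by apply/funext => w; rewrite /f mxE.
  apply: expectation_EFin.
  by apply: (intg_bounded P0 (measurableT_comp mg mU) (fun w => gM _)).
rewrite !E// => C; have : (Ex P (fun w => g (X w)))%:E = (Ex Q (fun w => g (Y w)))%:E.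
  by apply: (cvg_unique _ _ C); [exact: ereal_hausdorff|exact: cvg_cst].
by case.
Qed.

(** Open left rays form a generating pi-system, and the indicator of each is the limit of the
    continuous ramps [g n]. *)
Lemma charfn_unique A : measurable A -> P (X @^-1` A) = Q (Y @^-1` A).
Proof.
have ray (a : R) : P (X @^-1` `]-oo, a[%classic) = Q (Y @^-1` `]-oo, a[%classic).
  pose g (n : nat) (x : R) : R := Num.min 1 (Num.max 0 (n%:R * (a - x))).
  have g01 n x : 0 <= g n x <= 1.
    by rewrite /g le_min ler01 le_max lexx/= ge_min lexx.
  have cg n : continuous (g n).
    move=> x.
    have := @continuous_min R R (cst 1) (cst 0 \max (fun x => n%:R * (a - x))) x.
    apply; first exact: cvg_cst.
    have := @continuous_max R R (cst 0) (fun x => n%:R * (a - x)) x.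
    apply; first exact: cvg_cst.
    apply: cvgM; first exact: cvg_cst.
    by apply: cvgB; [exact: cvg_cst|exact: cvg_id].
  have gn x : g ^~ x @ \oo --> (\1_(`]-oo, a[%classic : set R) x : R).
    rewrite indicE; have [xa|ax] := ltP x a; last first.
      rewrite memNset; last by rewrite /= in_itv/= => /(lt_le_trans)/(_ ax); rewrite ltxx.
      rewrite (_ : g^~ x = cst 0); first exact: cvg_cst.
      apply/funext => n; rewrite /g max_l ?min_r//.
      by rewrite mulr_ge0_le0// subr_le0.
    rewrite mem_set; last by rewrite /= in_itv.
    have ax0 : 0 < a - x by rewrite subr_gt0.
    apply: cvg_near_cst; near=> n.
    have h : 1 <= n%:R * (a - x).
      rewrite -ler_pdivrMr// mul1r; near: n; exact: nbhs_infty_ger.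
    by rewrite /g max_r ?min_l// (le_trans _ h).
  have law d0 (T0 : measurableType d0) (P0 : probability T0 R) (U : T0 -> R) :
      measurable_fun setT U ->
      (fun n => Ex P0 (fun w => g n (U w))) @ \oo --> fine (P0 (U @^-1` `]-oo, a[%classic)).
    move=> mU; rewrite -Ex_indic; last first.
      by rewrite -[X in measurable X]setTI; apply: mU => //; exact: measurable_itv.
    apply: (cvg_Ex_bounded (M := 1)) => [n|n w|w].
    - by apply: measurableT_comp => //; exact: continuous_measurable_fun.
    - by have /andP[? ?] := g01 n (U w); rewrite ger0_norm.
    - rewrite (_ : \1_(U @^-1` _) w = \1_(`]-oo, a[%classic : set R) (U w)) //.
  have E n : Ex P (fun w => g n (X w)) = Ex Q (fun w => g n (Y w)).
    apply: (Ex_continuous_eq (M := 1)) => // x.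
    by have /andP[? ?] := g01 n x; rewrite ger0_norm.
  have C1 := law _ _ P _ mX; have C2 := law _ _ Q _ mY.
  rewrite -[LHS]fineK ?fin_num_measure//; last first.
    by rewrite -[X in measurable X]setTI; apply: mX => //; exact: measurable_itv.
  rewrite -[RHS]fineK ?fin_num_measure//; last first.
    by rewrite -[X in measurable X]setTI; apply: mY => //; exact: measurable_itv.
  have E' : (fun n => Ex P (fun w => g n (X w))) =
    (fun n => Ex Q (fun w => g n (Y w))) by apply/funext.
  rewrite E' in C1.
  congr EFin; have h := @cvg_unique _ (@Rhausdorff R) _ _ _ _ C1 C2.
  exact: h.
move=> mA; pose X' : {RV P >-> R} := mfun_Sub (mem_set mX).
pose Y' : {RV Q >-> R} := mfun_Sub (mem_set mY).
apply: (@measure_unique _ (measurableTypeR R) R (@RGenInftyO.G R) (fun n => `]-oo, n%:R[%classic)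
  _ _ _ _ (distribution P X') (distribution Q Y')) => //.
- exact: RGenInftyO.measurableE.
- move=> _ _ [x ->] [y ->]; exists (Num.min x y).
  apply/seteqP; split=> z /=; rewrite !in_itv/= lt_min; first by case=> -> ->.
  by move=> /andP[].
- by move=> n; exists n%:R.
- apply/seteqP; split=> // x _; exists (Num.truncn `|x|).+1 => //=.
  by rewrite in_itv/= (le_lt_trans (ler_norm x))// truncnS_gt.
- by move=> _ [x ->]; exact: ray.
- by move=> k; rewrite (le_lt_trans (probability_le1 _ _)) ?ltry//; exact: measurable_itv.
Unshelve. all: by end_near. Qed.

End uniqueness.

(** * Gaussian vectors *)

Section quadratic_forms.
Context {R : realType}.

Definition qform q (c : 'I_q -> 'I_q -> R) (t : 'I_q -> R) : R :=
  \sum_i \sum_j t i * t j * c i j.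

Lemma qform_pair q (c : 'I_q -> 'I_q -> R) (x : R) (a b : 'I_q) :
  (forall i j, c i j = c j i) ->
  qform c (fun i => x * (i == a)%:R + (i == b)%:R) =
  x ^+ 2 * c a a + 2 * x * c a b + c b b.
Proof.
move=> sym.
have pick (w : 'I_q -> R) :
    \sum_i (x * (i == a)%:R + (i == b)%:R) * w i = x * w a + w b.
  under eq_bigr do rewrite mulrDl.
  rewrite big_split (bigD1 a)//= eqxx mulr1 big1 ?addr0; last first.
    by move=> i /negbTE ->; rewrite mulr0 mul0r.
  congr (_ + _); rewrite (bigD1 b)//= eqxx mul1r big1 ?addr0// => i /negbTE ->.
  by rewrite mul0r.
rewrite /qform; under eq_bigr => i _.
  under eq_bigr do rewrite -mulrA.
  rewrite -mulr_sumr pick; over.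
rewrite pick (sym b a); ring.
Qed.

(** With [c a a = 0] the form on combinations of the coordinates [a] and [b] is affine in the weight
    of [a]. Unless its slope [2 * c a b] is 0, a suitable weight gives it the value -1. *)
Lemma psd_zero_row q (c : 'I_q -> 'I_q -> R) (a b : 'I_q) :
  (forall i j, c i j = c j i) -> (forall t, 0 <= qform c t) ->
  c a a = 0 -> c a b = 0.
Proof.
move=> sym psd ca; apply/eqP/negP => /negP cab.
have := psd (fun i => (- (c b b + 1) / (2 * c a b)) * (i == a)%:R + (i == b)%:R).
rewrite qform_pair// ca.
have -> : (- (c b b + 1) / (2 * c a b)) ^+ 2 * 0 +
  2 * (- (c b b + 1) / (2 * c a b)) * c a b + c b b = -1 by field.
by move=> h; lra.
Qed.

End quadratic_forms.

Section gaussian_vector.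
Context {R : realType}.

(* Take [Y_j = b_j N + Y'_j] with [N] standard normal, independent of [Y'], where
   [Y'] has the Schur complement [c - b b^T] of [c 0 0] as covariance matrix.  If
   [c 0 0 = 0] then [b = 0], since division by 0 gives 0. *)
Lemma gaussian_vector q (c : 'I_q -> 'I_q -> R) :
  (forall i j, c i j = c j i) -> (forall t, 0 <= qform c t) ->
  exists d (T : measurableType d) (Q : probability T R) (Y : 'I_q -> T -> R),
    (forall j, measurable_fun setT (Y j)) /\
    forall th t, Ex Q (fun w => cos (th + \sum_j t j * Y j w)) =
      cos th * expR (- (qform c t / 2)).
Proof.
elim: q c => [|q IH] c sym psd.
  exists _, (measurableTypeR R), (normal_prob 0 1), (fun _ _ => 0); split => // th t.
  have -> : qform c t = 0 by rewrite /qform big_ord0.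
  rewrite mul0r oppr0 expR0 mulr1 -[RHS](Ex_cst (normal_prob (0 : R) 1)).
  by apply: eq_Ex => w; rewrite big_ord0 addr0.
pose a := Num.sqrt (c ord0 ord0); pose b j := c ord0 j / a.
have c00 : 0 <= c ord0 ord0.
  have := psd (fun i => 0 * (i == ord0)%:R + (i == ord0)%:R).
  by rewrite qform_pair// expr2 => h; lra.
have cb j : c ord0 j = b ord0 * b j.
  have [c0|c0] := eqVneq (c ord0 ord0) 0.
    by rewrite /b (psd_zero_row j sym psd c0) c0 !mul0r.
  have a0 : a != 0 by rewrite sqrtr_eq0 -ltNge lt_neqAle eq_sym c0.
  have a2 : c ord0 ord0 = a ^+ 2 by rewrite sqr_sqrtr.
  by rewrite /b a2; field.
pose c' i j := c (lift ord0 i) (lift ord0 j) - b (lift ord0 i) * b (lift ord0 j).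
have sym' i j : c' i j = c' j i by rewrite /c' sym mulrC.
(* The rank-one part b b^T contributes the square; by [cb] and symmetry the remainder has zero first
   row and column. *)
have split_form t : qform c t =
    (\sum_j t j * b j) ^+ 2 + qform c' (fun j => t (lift ord0 j)).
  have -> : qform c t = \sum_i \sum_j (t i * b i) * (t j * b j) +
      \sum_i \sum_j t i * t j * (c i j - b i * b j).
    rewrite /qform -big_split; apply: eq_bigr => i _; rewrite -big_split.
    by apply: eq_bigr => j _ /=; ring.
  congr (_ + _).
    by rewrite expr2 mulr_suml; apply: eq_bigr => i _; rewrite mulr_sumr.
  rewrite big_ord_recl big1 ?add0r; last by move=> j _; rewrite cb subrr mulr0.
  apply: eq_bigr => i _; rewrite big_ord_recl.
  by rewrite (sym (lift ord0 i)) cb (mulrC (b ord0)) subrr mulr0 add0r.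
have psd' t : 0 <= qform c' t.
  pose B := \sum_j t j * b (lift ord0 j).
  (* The first coordinate is chosen so that the square in [split_form] vanishes. If [b ord0 = 0],
     then [cb] makes the first row of [c] zero, so every [b j] is 0 and the square vanishes
     anyway. *)
  pose t' j := if unlift ord0 j is Some i then t i else - B / b ord0.
  have := psd t'; rewrite split_form.
  have -> : \sum_j t' j * b j = 0.
    rewrite big_ord_recl /t' unlift_none.
    have -> : \sum_(i < q) match unlift ord0 (lift ord0 i) with
        Some i0 => t i0 | None => - B / b ord0 end * b (lift ord0 i) = B.
      by apply: eq_bigr => i _; rewrite liftK.
    have [b0|b0] := eqVneq (b ord0) 0; last by field.
    rewrite b0 mulr0 add0r /B big1// => j _.
    suff -> : b (lift ord0 j) = 0 by rewrite mulr0.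
    rewrite /b; have : c ord0 (lift ord0 j) = 0 by rewrite cb b0 mul0r.
    by move=> ->; rewrite mul0r.
  rewrite expr0n/= add0r; congr (0 <= _); apply: eq_bigr => i _.
  by apply: eq_bigr => j _; rewrite /t' !liftK.
have [d [T [Q [Y [mY charY]]]]] := IH c' sym' psd'.
pose Y' (j : 'I_q.+1) (z : R * T) : R :=
  b j * z.1 + if unlift ord0 j is Some i then Y i z.2 else 0.
have mY' j : measurable_fun setT (Y' j).
  apply: measurable_funD; first by apply: measurable_funM => //; exact: measurable_fst.
  by case: unliftP => [i _|_] //; exact: (measurableT_comp (mY i) measurable_snd).
exists _, (measurableTypeR R * T)%type, (normal_prob 0 1 \x Q)%E, Y'; split => // th t.
pose B := \sum_j t j * b j.
have sumE (z : R * T) : th + \sum_j t j * Y' j z =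
    (th + B * z.1) + \sum_j t (lift ord0 j) * Y j z.2.
  have -> : \sum_j t j * Y' j z = \sum_j t j * b j * z.1 +
      \sum_j t j * (if unlift ord0 j is Some i then Y i z.2 else 0).
    by rewrite -big_split; apply: eq_bigr => j _; rewrite /Y' mulrDr mulrA.
  rewrite -mulr_suml -/B addrA; congr (_ + _).
  rewrite big_ord_recl unlift_none mulr0 add0r.
  by apply: eq_bigr => j _; rewrite liftK.
rewrite (@Ex_prod _ _ _ _ _ (normal_prob 0 1) Q _ 1); first last.
- by move=> z; exact: cos_max.
- exact: (measurable_cos (measurable_linear_comb mY' th t)).
transitivity (Ex (normal_prob 0 1) (fun x : R => cos (th + B * x) *
    expR (- (qform c' (fun j => t (lift ord0 j)) / 2)))).
  by apply: eq_Ex => x; rewrite -charY; apply: eq_Ex => y; rewrite sumE.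
set k := expR _; transitivity (k * Ex (normal_prob 0 1) (fun x : R => cos (th + B * x))).
  rewrite -ExZ; first by apply: eq_Ex => x; rewrite mulrC.
  by apply: intg_cos; apply: measurable_funD => //; exact: measurable_funM.
have := @normal_charfn R 1 (oner_neq0 _) th B; rewrite expr1n mul1r => ->.
rewrite split_form -/B /k mulrCA -expRD; congr (_ * expR _); by field.
Qed.

End gaussian_vector.

Section gaussian_moments.
Context {R : realType} d (T : measurableType d) (P : probability T R).
Context (X : T -> R) (V : R) (mX : measurable_fun setT X) (V0 : 0 <= V).
Context (charX : forall th t,
  Ex P (fun w => cos (th + t * X w)) = cos th * expR (- (V * t ^+ 2 / 2))).

(* [E (g n)] is a second difference at 0 of the characteristic function, and
   [g n] tends to [X ^+ 2]: Fatou's lemma gives the finiteness of the second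
   moment. *)
Let g (n : nat) (w : T) : R :=
  2 * n.+1%:R ^+ 2 * (1 - cos (n.+1%:R^-1 * X w)).

Let mg n : measurable_fun setT (g n).
Proof.
apply: measurable_funM => //; apply: measurable_funB => //.
by apply: measurable_cos; exact: measurable_funM.
Qed.

Let g_ge0 n w : 0 <= g n w.
Proof. by rewrite /g mulr_ge0 ?mulr_ge0 ?sqr_ge0 ?oneB_cos_ge0. Qed.

Let g_le n w : g n w <= X w ^+ 2.
Proof.
have n0 : n.+1%:R != 0 :> R by rewrite pnatr_eq0.
apply: (@le_trans _ _ (2 * n.+1%:R ^+ 2 * ((n.+1%:R^-1 * X w) ^+ 2 / 2))).
  by rewrite ler_wpM2l ?mulr_ge0 ?sqr_ge0 ?oneB_cos_le.
by rewrite le_eqVlt; apply/orP; left; apply/eqP; field.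
Qed.

Let g_cvg w : g ^~ w @ \oo --> X w ^+ 2.
Proof.
have bound n : `|X w ^+ 2 - g n w| <= X w ^+ 4 * harmonic n.
  have n0 : n.+1%:R != 0 :> R by rewrite pnatr_eq0.
  have n1 : 0 < n.+1%:R :> R by rewrite ltr0n.
  have -> : X w ^+ 2 - g n w = 2 * n.+1%:R ^+ 2 *
     (cos (n.+1%:R^-1 * X w) - (1 - (n.+1%:R^-1 * X w) ^+ 2 / 2)).
    by rewrite /g; field.
  rewrite normrM ger0_norm ?mulr_ge0 ?sqr_ge0//.
  apply: (@le_trans _ _ (2 * n.+1%:R ^+ 2 * ((n.+1%:R^-1 * X w) ^+ 4 / 2))).
    by rewrite ler_wpM2l ?mulr_ge0 ?sqr_ge0 ?cos_taylor2_le.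
  have -> : 2 * n.+1%:R ^+ 2 * ((n.+1%:R^-1 * X w) ^+ 4 / 2) =
    X w ^+ 4 * (n.+1%:R^-1 * n.+1%:R^-1) by field.
  have x4 : 0 <= X w ^+ 4 by rewrite -[4%N]/(2 * 2)%N exprM sqr_ge0.
  by rewrite ler_wpM2l// ler_piMl ?invr_ge0 ?(ltW n1)// invf_le1// ler1n.
have C : (fun n => X w ^+ 4 * harmonic n) @ \oo --> (0 : R).
  by rewrite -[X in _ --> X](mulr0 (X w ^+ 4)); apply: cvgM;
    [exact: cvg_cst|exact: cvg_harmonic].
apply/cvgrPdist_le => e e0; move/cvgrPdist_le : C => /(_ _ e0); apply: filterS => n.
by rewrite sub0r normrN => /(le_trans (ler_norm _)); exact: le_trans.
Qed.

Let ig n : intg P (g n).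
Proof.
apply: (intg_bounded P (mg n) (M := 2 * n.+1%:R ^+ 2 * 2)) => w.
rewrite /g normrM ger0_norm ?mulr_ge0 ?sqr_ge0// ler_wpM2l ?mulr_ge0 ?sqr_ge0//.
by rewrite ger0_norm ?oneB_cos_ge0//; have := cos_geN1 (n.+1%:R^-1 * X w); lra.
Qed.

Let Eg n : Ex P (g n) = 2 * n.+1%:R ^+ 2 * (1 - expR (- (V * n.+1%:R ^- 2 / 2))).
Proof.
have mx : measurable_fun setT (fun w => n.+1%:R^-1 * X w) by exact: measurable_funM.
rewrite /g ExZ; last by apply: intgB; [exact: intg_cst|exact: intg_cos].
rewrite ExB ?Ex_cst; [|exact: intg_cst|exact: intg_cos].
congr (_ * (1 - _)); have := charX 0 n.+1%:R^-1; rewrite cos0 mul1r exprVn => <-.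
by apply: eq_Ex => w; rewrite add0r.
Qed.

(** The bounds y - y^2 <= 1 - exp(-y) <= y at y = V / (2 N^2) squeeze the expectation between V -
    V^2 / N and V. *)
Let Eg_cvg : (fun n => Ex P (g n)) @ \oo --> V.
Proof.
have C : (fun n => V - V ^+ 2 * harmonic n) @ \oo --> V.
  rewrite -[X in _ --> X]subr0; apply: cvgB; first exact: cvg_cst.
  by rewrite -[X in _ --> X](mulr0 (V ^+ 2)); apply: cvgM;
    [exact: cvg_cst|exact: cvg_harmonic].
apply: squeeze_cvgr C _; last exact: cvg_cst.
apply: nearW => n; rewrite Eg; set N : R := n.+1%:R.
have N1 : 1 <= N by rewrite ler1n.
have N0 : 0 < N by rewrite ltr0n.
set y := V * N ^- 2 / 2.
have y0 : 0 <= y by rewrite !mulr_ge0 ?invr_ge0 ?sqr_ge0.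
have VE : V = 2 * N ^+ 2 * y by rewrite /y; field; rewrite gt_eqF.
have e1 : 1 - expR (- y) <= y by have := expR_ge1Dx (- y); lra.
have e2 : y - y ^+ 2 <= 1 - expR (- y).
  have : expR (- y) <= (1 + y)^-1.
    by rewrite expRN lef_pV2 ?posrE ?expR_gt0 ?expR_ge1Dx//; lra.
  have : (1 + y)^-1 <= 1 - y + y ^+ 2.
    rewrite -[leLHS]mul1r ler_pdivrMr; last lra.
    have -> : (1 - y + y ^+ 2) * (1 + y) = 1 + y ^+ 3 by ring.
    by rewrite lerDl exprn_ge0.
  lra.
have N20 : 0 <= 2 * N ^+ 2 by rewrite mulr_ge0 ?sqr_ge0.
apply/andP; split; last by rewrite [leRHS]VE ler_wpM2l.
apply: (@le_trans _ _ (2 * N ^+ 2 * (y - y ^+ 2))); last by rewrite ler_wpM2l.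
rewrite mulrBr -VE lerD2l lerN2 /=.
have -> : 2 * N ^+ 2 * y ^+ 2 = V ^+ 2 * (N^-1 * (N^-1 / 2)).
  by rewrite /y; field; rewrite gt_eqF.
rewrite ler_wpM2l ?sqr_ge0// ler_piMr ?invr_ge0 ?(ltW N0)//.
have hN : N^-1 <= 1 by rewrite invf_le1.
by rewrite ler_pdivrMr// mul1r (le_trans hN)// ler1n.
Qed.

Lemma charfn_intg_sqr : intg P (fun w => X w ^+ 2).
Proof.
have mX2 : measurable_fun setT (fun w => X w ^+ 2) by exact: measurable_funX.
apply/integrableP; split; first exact/measurable_EFinP.
under eq_integral do rewrite /= ger0_norm ?sqr_ge0//.
have := @fatou _ _ _ P setT measurableT (fun n => EFin \o g n)
  (fun n => proj2 (measurable_EFinP _ _) (mg n)) (fun n w _ => g_ge0 n w).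
have -> : (\int[P]_w limn_einf (fun n => (EFin \o g n) w) =
    \int[P]_w (X w ^+ 2)%:E)%E.
  apply: eq_integral => w _.
  have /cvg_limn_einf_sup[->//] : (fun n => (EFin \o g n) w) @ \oo --> (X w ^+ 2)%:E.
  by apply: cvg_EFin; [exact: nearW|exact: g_cvg].
move/le_lt_trans; apply.
have -> : limn_einf (fun n => \int[P]_w (EFin \o g n) w)%E = V%:E.
  suff /cvg_limn_einf_sup[->//] :
    (fun n => \int[P]_w (EFin \o g n) w)%E @ \oo --> V%:E.
  rewrite (_ : (fun n => _) = (fun n => (Ex P (g n))%:E)).
    by apply: cvg_EFin; [exact: nearW|exact: Eg_cvg].
  apply/funext => n; rewrite /Ex /Rintegral fineK//.
  by apply: integrable_fin_num => //; exact: ig.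
exact: ltry.
Qed.

Lemma charfn_Ex_sqr : Ex P (fun w => X w ^+ 2) = V.
Proof.
have C : (fun n => Ex P (g n)) @ \oo --> Ex P (fun w => X w ^+ 2).
  apply: (cvg_Ex_dominated mg charfn_intg_sqr) => [n w|w]; last exact: g_cvg.
  by rewrite ger0_norm.
exact: (@cvg_unique _ (@Rhausdorff R) _ _ _ _ C Eg_cvg).
Qed.

Lemma charfn_intg : intg P X.
Proof.
apply: (intg_le mX (intgD (intg_cst P 1) charfn_intg_sqr)) => w.
rewrite -[X w ^+ 2]ger0_norm ?sqr_ge0// normrX.
by have := sqr_ge0 (`|X w| - 1); have := normr_ge0 (X w); nra.
Qed.

(** The phase - pi / 2 shows that E sin (X / N) = 0; N sin (X / N) tends to X and is dominated by
    |X|. *)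
Lemma charfn_Ex : Ex P X = 0.
Proof.
pose h (n : nat) w : R := n.+1%:R * sin (n.+1%:R^-1 * X w).
have mx n : measurable_fun setT (fun w => n.+1%:R^-1 * X w) by exact: measurable_funM.
have mh n : measurable_fun setT (h n).
  by apply: measurable_funM => //; exact: measurable_sin.
have Eh n : Ex P (h n) = 0.
  rewrite /h ExZ; last exact: intg_sin.
  have := charX (- (pi / 2)) n.+1%:R^-1.
  rewrite cosN cos_pihalf mul0r => H.
  rewrite (_ : Ex P _ = 0) ?mulr0// -[RHS]H; apply: eq_Ex => w.
  by rewrite addrC cosBpihalf.
have C : (fun n => Ex P (h n)) @ \oo --> Ex P X.
  apply: (cvg_Ex_dominated mh (intg_norm charfn_intg)) => [n w|w].
    rewrite /h normrM ger0_norm// -ler_pdivlMl ?ltr0n//.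
    apply: (le_trans (ler_sin_norm _)).
    by rewrite normrM ger0_norm.
  have bound n : `|X w - h n w| <= `|X w| ^+ 3 * harmonic n.
    have n0 : n.+1%:R != 0 :> R by rewrite pnatr_eq0.
    have n1 : 0 < n.+1%:R :> R by rewrite ltr0n.
    have -> : X w - h n w =
       - (n.+1%:R * (sin (n.+1%:R^-1 * X w) - n.+1%:R^-1 * X w)).
      by rewrite /h; field.
    rewrite normrN normrM ger0_norm//.
    apply: (@le_trans _ _ (n.+1%:R * (`|n.+1%:R^-1 * X w| ^+ 3 / 2))).
      by rewrite ler_wpM2l ?sin_sub_id_le.
    rewrite normrM (@ger0_norm _ n.+1%:R^-1)//.
    have -> : n.+1%:R * ((n.+1%:R^-1 * `|X w|) ^+ 3 / 2) =
      `|X w| ^+ 3 * (n.+1%:R^-1 * (n.+1%:R^-1 / 2)) by field.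
    rewrite ler_wpM2l ?exprn_ge0// ler_piMr ?invr_ge0 ?(ltW n1)//.
    have hn : n.+1%:R^-1 <= 1 :> R by rewrite invf_le1// ler1n.
    by rewrite ler_pdivrMr// mul1r (le_trans hn)// ler1n.
  have C : (fun n => `|X w| ^+ 3 * harmonic n) @ \oo --> (0 : R).
    by rewrite -[X in _ --> X](mulr0 (`|X w| ^+ 3)); apply: cvgM;
      [exact: cvg_cst|exact: cvg_harmonic].
  apply/cvgrPdist_le => e e0; move/cvgrPdist_le : C => /(_ _ e0); apply: filterS => n.
  by rewrite sub0r normrN => /(le_trans (ler_norm _)); exact: le_trans.
have C0 : (fun n => Ex P (h n)) @ \oo --> (0 : R).
  by under eq_fun do rewrite Eh; exact: cvg_cst.
exact: (@cvg_unique _ (@Rhausdorff R) _ _ _ _ C C0).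
Qed.

End gaussian_moments.

Section gaussian_process.
Context {R : realType}.

(** Each linear combination has the characteristic function of a normal law, or of the point mass at
    0 if its variance is 0, so [charfn_unique] identifies its law. Covariances follow by
    polarization from the second moments of Y i, Y j and Y i + Y j. *)
Lemma exists_gaussian_process q (c : 'I_q -> 'I_q -> R) :
  (forall i j, c i j = c j i) -> (forall t, 0 <= qform c t) ->
  exists d (T : measurableType d) (Q : probability T R) (Y : 'I_q -> {RV Q >-> R}),
    centered_gaussian_process Y c /\
    forall th t, Ex Q (fun w => cos (th + \sum_j t j * Y j w)) =
      cos th * expR (- (qform c t / 2)).
Proof.
move=> sym psd; have [d [T [Q [Y0 [mY0 charY0]]]]] := gaussian_vector sym psd.
pose Y j : {RV Q >-> R} := mfun_Sub (mem_set (mY0 j)).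
have mY j : measurable_fun setT (Y j) by exact: mY0.
have charY th t : Ex Q (fun w => cos (th + \sum_j t j * Y j w)) =
    cos th * expR (- (qform c t / 2)) := charY0 th t.
have qformZ u t : qform c (fun j => u * t j) = qform c t * u ^+ 2.
  rewrite /qform mulr_suml; apply: eq_bigr => i _; rewrite mulr_suml.
  by apply: eq_bigr => j _; ring.
have char1 (t : 'I_q -> R) th u :
    Ex Q (fun w => cos (th + u * \sum_j t j * Y j w)) =
    cos th * expR (- (qform c t * u ^+ 2 / 2)).
  rewrite -qformZ -charY; apply: eq_Ex => w; rewrite mulr_sumr.
  by congr (cos (_ + _)); apply: eq_bigr => j _; rewrite mulrA.
have mS (t : 'I_q -> R) : measurable_fun setT (fun w => \sum_j t j * Y j w).
  by apply: measurable_sum => j; exact: measurable_funM.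
pose dlt (i j : 'I_q) : R := (j == i)%:R.
have Sdlt i w : \sum_j dlt i j * Y j w = Y i w.
  rewrite (bigD1 i)//= /dlt eqxx mul1r big1 ?addr0// => j /negbTE ->.
  by rewrite mul0r.
have qdlt x i j : qform c (fun k => x * dlt i k + dlt j k) =
  x ^+ 2 * c i i + 2 * x * c i j + c j j by exact: qform_pair.
have qdlt1 i : qform c (dlt i) = c i i.
  have := qdlt 0 i i; rewrite (_ : (fun k => _) = dlt i); last first.
    by apply/funext => k; rewrite mul0r add0r.
  by move=> ->; rewrite expr0n/= mul0r mulr0 mul0r !add0r.
have cii i : 0 <= c i i by rewrite -qdlt1.
have charYi i th u : Ex Q (fun w => cos (th + u * Y i w)) =
    cos th * expR (- (c i i * u ^+ 2 / 2)).
  by rewrite -qdlt1 -char1; apply: eq_Ex => w; rewrite Sdlt.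
have iY i : intg Q (Y i) := charfn_intg (mY i) (cii i) (charYi i).
have iY2 i : intg Q (fun w => Y i w ^+ 2) :=
  charfn_intg_sqr (mY i) (cii i) (charYi i).
have EY i : Ex Q (Y i) = 0 := charfn_Ex (mY i) (cii i) (charYi i).
have EY2 i : Ex Q (fun w => Y i w ^+ 2) = c i i :=
  charfn_Ex_sqr (mY i) (cii i) (charYi i).
have EYD i j : Ex Q (fun w => (Y i w + Y j w) ^+ 2) = c i i + 2 * c i j + c j j.
  pose t k := 1 * dlt i k + dlt j k.
  have := charfn_Ex_sqr (mS t) (psd _) (char1 t).
  rewrite /t qdlt expr1n mul1r mulr1 => <-; apply: eq_Ex => w; congr (_ ^+ 2).
  rewrite -(Sdlt i) -(Sdlt j) -big_split; apply: eq_bigr => k _ /=; ring.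
have iYY i j : intg Q (fun w => Y i w * Y j w) by exact: intgM_sqr.
have EYY i j : Ex Q (fun w => Y i w * Y j w) = c i j.
  have := EYD i j; rewrite (_ : Ex Q _ = Ex Q (fun w => Y i w ^+ 2) +
     2 * Ex Q (fun w => Y i w * Y j w) + Ex Q (fun w => Y j w ^+ 2)).
    by rewrite !EY2 => h; lra.
  rewrite -ExZ// -ExD//; last exact: intgZ.
  rewrite -ExD//; last by apply: intgD => //; exact: intgZ.
  by apply: eq_Ex => w; ring.
exists d, T, Q, Y; split => //; split.
(* Components may repeat along [i]; [t] collects the coefficients of each. *)
- move=> q' i a; pose t k := \sum_(j < q' | i j == k) a j.
  have St w : \sum_(j < q') a j * Y (i j) w = \sum_k t k * Y k w.
    rewrite (partition_big i xpredT)//=; apply: eq_bigr => k _.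
    by rewrite mulr_suml; apply: eq_bigr => j /eqP ->.
  exists 0, (Num.sqrt (qform c t)) => A mA.
  rewrite (_ : [set w | _] = (fun w => \sum_k t k * Y k w) @^-1` A); last first.
    by apply/seteqP; split=> w /=; rewrite St.
  have V0 := psd t; case: ifPn => [/eqP s0|s0].
    have Vz : qform c t = 0.
      by apply/eqP; rewrite eq_le V0 andbT -sqrtr_eq0; apply/eqP.
    have := @charfn_unique R _ T Q _ T Q (fun w => \sum_k t k * Y k w) (fun=> 0)
      (mS t) (measurable_cst _) _ A mA.
    move=> -> => [|th u]; last first.
      rewrite char1 Vz !mul0r oppr0 expR0 mulr1 -[LHS](Ex_cst Q).
      by apply: eq_Ex => w; rewrite mulr0 addr0.
    rewrite diracE; have [A0|A0] := boolP (0 \in A).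
      rewrite (_ : _ @^-1` A = setT) ?probability_setT//.
      by apply/seteqP; split=> // w _ /=; rewrite inE in A0.
    rewrite (_ : _ @^-1` A = set0) ?measure0//.
    by apply/seteqP; split=> // w /=; rewrite notin_setE in A0.
  have := @charfn_unique R _ T Q _ (measurableTypeR R)
    (normal_prob 0 (Num.sqrt (qform c t)))
    (fun w => \sum_k t k * Y k w) id (mS t) (@measurable_id _ _ _) _ A mA.
  by apply=> th u; rewrite char1 normal_charfn// sqr_sqrtr.
- by move=> i; rewrite expectation_EFin ?EY.
- move=> i j; rewrite unlock.
  have -> : ((Y i \- cst (fine 'E_Q[Y i])) * (Y j \- cst (fine 'E_Q[Y j])))%R =
      (fun w => Y i w * Y j w).
    by apply/funext => w; rewrite !expectation_Ex !EY /= !fctE/= !subr0.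
  by rewrite expectation_EFin ?EYY.
Qed.

End gaussian_process.

(** * Triangular arrays *)

Lemma indic_bool (R : realType) (T : Type) (b : T -> bool) (w : T) :
  \1_([set w | b w]) w = (b w)%:R :> R.
Proof.
rewrite indicE; have -> // : (w \in [set w | b w]) = b w.
by apply/idP/idP; rewrite inE.
Qed.

Section negligible_sequences.
Context {R : realType} (m : nat -> nat).

(** That is u = o(1/m), in a form that also makes sense when [m n = 0]: the error that each of [m n]
    blocks may contribute. *)
Definition negl (u : nat -> R) : Prop :=
  (fun n => (m n)%:R * u n) @ \oo --> (0 : R).

Lemma neglD u v : negl u -> negl v -> negl (fun n => u n + v n).
Proof.
move=> nu nv; rewrite /negl -[X in _ --> X](addr0 0).
by under eq_fun do rewrite mulrDr; exact: cvgD.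
Qed.

Lemma neglZ c u : negl u -> negl (fun n => c * u n).
Proof.
move=> nu; rewrite /negl -[X in _ --> X](mulr0 c).
by under eq_fun do rewrite mulrCA; apply: cvgM => //; exact: cvg_cst.
Qed.

Lemma negl0 : negl (fun=> 0).
Proof. by rewrite /negl; under eq_fun do rewrite mulr0; exact: cvg_cst. Qed.

Lemma negl_sum (I : Type) (r : seq I) (u : I -> nat -> R) :
  (forall i, negl (u i)) -> negl (fun n => \sum_(i <- r) u i n).
Proof.
move=> nu; elim: r => [|i r IH].
  by under eq_fun do rewrite big_nil; exact: negl0.
by under eq_fun do rewrite big_cons; exact: neglD.
Qed.

Lemma negl_le u v : negl v -> (forall n, `|u n| <= v n) -> negl u.
Proof.
move=> nv uv; apply/cvgrPdist_le => e e0; move/cvgrPdist_le : nv => /(_ _ e0).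
apply: filterS => n; rewrite !sub0r !normrN; apply: le_trans.
by rewrite !normrM ler_wpM2l// (le_trans (uv n))// ler_norm.
Qed.

(** Lindeberg's argument: [m * v] is eventually bounded, so the first term contributes at most a
    fixed multiple of [e], while [z] is negligible for each fixed [e]. *)
Lemma negl_approx u v (C : R) : (fun n => (m n)%:R * v n) @ \oo --> C ->
  (forall n, 0 <= v n) ->
  (forall e : R, 0 < e <= 1 -> exists2 z, negl z &
     forall n, `|u n| <= e * v n + z n) -> negl u.
Proof.
move=> vC v0 H; apply/cvgrPdist_le => e e0.
pose K := `|C| + 1; have K0 : 0 < K by rewrite ltr_wpDl.
pose e1 := Num.min 1 (e / 2 / K).
have e10 : 0 < e1 by rewrite lt_min ltr01 !divr_gt0.
have [|z nz uz] := H e1; first by rewrite e10/= ge_min lexx.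
move/cvgrPdist_le : nz => /(_ (e / 2)); rewrite divr_gt0// => /(_ isT) nz.
move/cvgrPdist_le : vC => /(_ 1 ltr01) vC.
near=> n; rewrite sub0r normrN normrM ger0_norm//.
apply: (@le_trans _ _ ((m n)%:R * (e1 * v n + z n))); first by rewrite ler_wpM2l.
rewrite mulrDr [leRHS]splitr lerD//; last first.
  rewrite (le_trans (ler_norm _))//.
  have : `|0 - (m n)%:R * z n| <= e / 2 by near: n.
  by rewrite sub0r normrN.
have vK : (m n)%:R * v n <= K.
  have : `|C - (m n)%:R * v n| <= 1 by near: n.
  by rewrite /K ler_norml; have := ler_norm C; lra.
rewrite mulrCA; apply: (@le_trans _ _ (e1 * K)); first by rewrite ler_wpM2l// ltW.
by rewrite -ler_pdivlMr// ge_min lexx orbT.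
Unshelve. all: by end_near. Qed.

Lemma negl_cvg u v (C : R) : (fun n => (m n)%:R * v n) @ \oo --> C ->
  negl (fun n => u n - v n) -> (fun n => (m n)%:R * u n) @ \oo --> C.
Proof.
move=> vC nuv; rewrite -[X in _ --> X]addr0.
rewrite (_ : (fun n => (m n)%:R * u n) =
  (fun n => (m n)%:R * v n + (m n)%:R * (u n - v n))); first exact: cvgD.
by apply/funext => n; rewrite -mulrDr addrC subrK.
Qed.

End negligible_sequences.

Section triangular_arrays.
Context d (T : measurableType d) (R : realType) (P : probability T R).
Context (m : nat -> nat).
Implicit Types (X Y : nat -> T -> R).

(* The entries of a row have the same law, hence a single random variable
   stands for the whole row. *)
Definition null_array X : Prop :=
  [/\ forall n, measurable_fun setT (X n), forall n, intg P (fun w => X n w ^+ 2) &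
      negl m (fun n => Ex P (fun w => X n w ^+ 2))].

Definition lindeberg_array X : Prop :=
  [/\ forall n, measurable_fun setT (X n), forall n, intg P (fun w => X n w ^+ 2) &
      forall e : R, 0 < e ->
        negl m (fun n => Ex P (fun w => X n w ^+ 2 * (e < `|X n w|)%R%:R))].

Lemma measurable_lt_norm (f : T -> R) (e : R) : measurable_fun setT f ->
  measurable_fun setT (fun w => (e < `|f w|)%R%:R : R).
Proof.
move=> mf; rewrite (_ : (fun w => _) = \1_([set w | e < `|f w|])); last first.
  by apply/funext => w; rewrite indic_bool.
apply: measurable_indic; rewrite -[X in measurable X]setTI.
have -> : [set w | e < `|f w|] = (fun w => `|f w|) @^-1` `]e, +oo[%classic.
  by apply/seteqP; split=> w /=; rewrite in_itv/= andbT.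
by apply: measurableT_comp => //; exact: measurable_itv.
Qed.

Lemma intg_tail (f : T -> R) (e : R) : measurable_fun setT f ->
  intg P (fun w => f w ^+ 2) -> intg P (fun w => f w ^+ 2 * (e < `|f w|)%R%:R).
Proof.
move=> mf f2; apply: (intgM_bounded (M := 1)) => //; first exact: measurable_lt_norm.
by move=> w; case: (_ < _)%R; rewrite /= ?normr1 ?normr0.
Qed.

Lemma null_arrayZ c X : null_array X -> null_array (fun n w => c * X n w).
Proof.
move=> [mX iX nX]; split=> [n|n|]; first exact: measurable_funM.
  by under eq_fun do rewrite exprMn; exact: intgZ.
have -> : (fun n => Ex P (fun w => (c * X n w) ^+ 2)) =
    (fun n => c ^+ 2 * Ex P (fun w => X n w ^+ 2)).
  by apply/funext => n; rewrite -ExZ//; apply: eq_Ex => w; rewrite exprMn.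
exact: neglZ.
Qed.

Lemma null_arrayD X Y : null_array X -> null_array Y ->
  null_array (fun n w => X n w + Y n w).
Proof.
move=> [mX iX nX] [mY iY nY]; split=> [n|n|].
- exact: measurable_funD.
- exact: intg_sqrD.
- apply: (negl_le (neglD (neglZ 2 nX) (neglZ 2 nY))) => n.
  have h1 := intgZ 2 (iX n); have h2 := intgZ 2 (iY n).
  rewrite -!ExZ// -ExD//; apply: Ex_norm_le; [exact: intg_sqrD|exact: intgD|].
  move=> w; rewrite ger0_norm ?sqr_ge0//.
  by have := sqr_ge0 (X n w - Y n w); nra.
Qed.

Lemma null_array0 : null_array (fun _ _ => 0).
Proof.
split=> // [n|]; first by rewrite expr0n; exact: intg_cst.
have -> : (fun n : nat => Ex P (fun w => (0 : R) ^+ 2)) = (fun=> 0).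
  by apply/funext => n; rewrite Ex_cst expr0n.
exact: negl0.
Qed.

Lemma null_array_sum (I : Type) (r : seq I) (X : I -> nat -> T -> R) :
  (forall i, null_array (X i)) -> null_array (fun n w => \sum_(i <- r) X i n w).
Proof.
move=> nX; elim: r => [|i r IH].
  rewrite (_ : (fun n w => _) = (fun _ _ => 0)); first exact: null_array0.
  by apply/funext => n; apply/funext => w; rewrite big_nil.
rewrite (_ : (fun n w => _) =
  (fun n w => X i n w + \sum_(j <- r) X j n w)); first exact: null_arrayD.
by apply/funext => n; apply/funext => w; rewrite big_cons.
Qed.

Lemma lindeberg_null X : null_array X -> lindeberg_array X.
Proof.
move=> [mX iX nX]; split=> // e e0; apply: (negl_le nX) => n.
apply: Ex_norm_le => //; first exact: intg_tail.
move=> w; rewrite ger0_norm; first by rewrite ler_piMr ?sqr_ge0//; case: (_ < _)%R.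
by apply: mulr_ge0 => //; exact: sqr_ge0.
Qed.

(** Where |x + y| > e, the summand of larger modulus exceeds e / 2 and its square is at least a
    quarter of that of the sum; hence the halved threshold and the factor 4. *)
Lemma lindebergD X Y : lindeberg_array X -> lindeberg_array Y ->
  lindeberg_array (fun n w => X n w + Y n w).
Proof.
move=> [mX iX nX] [mY iY nY]; split=> [n|n|e e0].
- exact: measurable_funD.
- exact: intg_sqrD.
- have e20 : 0 < e / 2 by rewrite divr_gt0.
  have mXY n : measurable_fun setT (fun w => X n w + Y n w) by exact: measurable_funD.
  have iXY n := intg_sqrD (mX n) (mY n) (iX n) (iY n).
  apply: (negl_le (neglD (neglZ 4 (nX _ e20)) (neglZ 4 (nY _ e20)))) => n.
  have h1 := intgZ 4 (intg_tail (e / 2) (mX n) (iX n)).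
  have h2 := intgZ 4 (intg_tail (e / 2) (mY n) (iY n)).
  rewrite -ExZ; last exact: intg_tail.
  rewrite -[4 * Ex P (fun w => Y n w ^+ 2 * _)]ExZ; last exact: intg_tail.
  rewrite -ExD//; apply: Ex_norm_le; [exact: intg_tail|exact: intgD|].
  move=> w; set x := X n w; set y := Y n w.
  have x2 := sqr_ge0 x; have y2 := sqr_ge0 y.
  have bound (u v : R) : `|v| <= `|u| -> e < `|u + v| ->
      (u + v) ^+ 2 <= 4 * u ^+ 2 /\ e / 2 < `|u|.
    move=> vu euv; have := ler_normD u v => h; split; last by lra.
    have -> : (u + v) ^+ 2 = `|u + v| ^+ 2 by rewrite -normrX ger0_norm ?sqr_ge0.
    have -> : u ^+ 2 = `|u| ^+ 2 by rewrite -normrX ger0_norm ?sqr_ge0.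
    by have := normr_ge0 (u + v); have := normr_ge0 u; nra.
  rewrite ger0_norm; last by apply: mulr_ge0 => //; exact: sqr_ge0.
  have [exy|_] := boolP (e < `|x + y|); last first.
    by rewrite mulr0 addr_ge0// mulr_ge0// mulr_ge0.
  rewrite mulr1; have [yx|xy] := leP `|y| `|x|.
    have [h ->] := bound _ _ yx exy; rewrite mulr1 (le_trans h)// lerDl.
    by rewrite mulr_ge0// mulr_ge0.
  rewrite (addrC x y) in exy *; have [h ->] := bound y x (ltW xy) exy.
  by rewrite mulr1 (le_trans h)// lerDr mulr_ge0// mulr_ge0.
Qed.

Lemma lindebergZ c X : lindeberg_array X -> lindeberg_array (fun n w => c * X n w).
Proof.
move=> [mX iX nX]; split=> [n|n|e e0]; first exact: measurable_funM.
  by under eq_fun do rewrite exprMn; exact: intgZ.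
pose k := `|c| + 1; have k0 : 0 < k by rewrite ltr_wpDl.
have ek : 0 < e / k by rewrite divr_gt0.
have i2 n : intg P (fun w => (c * X n w) ^+ 2).
  by under eq_fun do rewrite exprMn; exact: intgZ.
apply: (negl_le (neglZ (c ^+ 2) (nX _ ek))) => n.
rewrite -ExZ; last exact: intg_tail.
apply: Ex_norm_le.
- by apply: intg_tail; [exact: measurable_funM|exact: i2].
- by apply: intgZ; exact: intg_tail.
move=> w; rewrite ger0_norm; last by apply: mulr_ge0 => //; exact: sqr_ge0.
rewrite exprMn -mulrA.
rewrite ler_wpM2l ?sqr_ge0// ler_wpM2l ?sqr_ge0// ler_nat.
have [ecx|//] := boolP (e < `|c * X n w|); suff -> : e / k < `|X n w| by [].
rewrite ltr_pdivrMr//; apply: (lt_le_trans ecx); rewrite normrM mulrC ler_wpM2l//.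
by rewrite lerDl.
Qed.

Lemma lindeberg_sum (I : Type) (r : seq I) (X : I -> nat -> T -> R) :
  (forall i, lindeberg_array (X i)) ->
  lindeberg_array (fun n w => \sum_(i <- r) X i n w).
Proof.
move=> nX; elim: r => [|i r IH].
  rewrite (_ : (fun n w => _) = (fun _ _ => 0)).
    by apply: lindeberg_null; exact: null_array0.
  by apply/funext => n; apply/funext => w; rewrite big_nil.
rewrite (_ : (fun n w => _) =
  (fun n w => X i n w + \sum_(j <- r) X j n w)); first exact: lindebergD.
by apply/funext => n; apply/funext => w; rewrite big_cons.
Qed.

(* [|(x - y)^2 - x^2| <= e x^2 + (1 + 1/e) y^2] *)
Lemma second_moment_perturb X Y (C : R) :
  (forall n, measurable_fun setT (X n)) ->
  (forall n, intg P (fun w => X n w ^+ 2)) -> null_array Y ->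
  (fun n => (m n)%:R * Ex P (fun w => X n w ^+ 2)) @ \oo --> C ->
  (fun n => (m n)%:R * Ex P (fun w => (X n w - Y n w) ^+ 2)) @ \oo --> C.
Proof.
move=> mX iX [mY iY nY] XC; apply: (negl_cvg XC).
have iXY n : intg P (fun w => (X n w - Y n w) ^+ 2).
  have := @intg_sqrD _ _ _ P (X n) (fun w => - Y n w) (mX n).
  apply=> //; first exact: measurableT_comp.
  by under eq_fun do rewrite sqrrN.
apply: (negl_approx XC) => [n|e /andP[e0 e1]].
  by apply: Ex_ge0 => w; exact: sqr_ge0.
exists (fun n => (1 + e^-1) * Ex P (fun w => Y n w ^+ 2)); first exact: neglZ.
move=> n; rewrite -ExB// -!ExZ// -ExD; [|exact: intgZ..].
apply: Ex_norm_le; [exact: intgB|by apply: intgD; exact: intgZ|].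
move=> w; set x := X n w; set y := Y n w.
have -> : (x - y) ^+ 2 - x ^+ 2 = y ^+ 2 - 2 * (x * y) by ring.
have h : `|2 * (x * y)| <= e * x ^+ 2 + e^-1 * y ^+ 2.
  have k : forall u, u ^+ 2 = y ^+ 2 -> 2 * (x * u) <= e * x ^+ 2 + e^-1 * y ^+ 2.
    move=> u <-; have : 0 <= e^-1 * (e * x - u) ^+ 2.
      by rewrite mulr_ge0 ?sqr_ge0// invr_ge0 ltW.
    have -> : e^-1 * (e * x - u) ^+ 2 = e * x ^+ 2 + e^-1 * u ^+ 2 - 2 * (x * u).
      by field; rewrite gt_eqF.
    lra.
  have k1 := k y erefl; have k2 := k (- y) (sqrrN y).
  by rewrite ler_norml; lra.
apply: (le_trans (ler_normB _ _)); rewrite (ger0_norm (sqr_ge0 y)); lra.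
Qed.

Lemma lindeberg_cos X (C : R) : lindeberg_array X ->
  (fun n => (m n)%:R * Ex P (fun w => X n w ^+ 2)) @ \oo --> C ->
  negl m (fun n => Ex P (fun w => cos (X n w)) - (1 - Ex P (fun w => X n w ^+ 2) / 2)).
Proof.
move=> [mX iX nX] XC; apply: (negl_approx XC) => [n|e e01].
  by apply: Ex_ge0 => w; exact: sqr_ge0.
have /andP[e0 _] := e01.
exists (fun n => Ex P (fun w => X n w ^+ 2 * (e < `|X n w|)%R%:R)); first exact: nX.
move=> n; have i2 : intg P (fun w => 1 - X n w ^+ 2 / 2).
  apply: intgB; first exact: intg_cst.
  by under eq_fun do rewrite mulrC; exact: intgZ.
have -> : 1 - Ex P (fun w => X n w ^+ 2) / 2 = Ex P (fun w => 1 - X n w ^+ 2 / 2).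
  rewrite ExB ?Ex_cst; [|exact: intg_cst|].
    by congr (_ - _); rewrite mulrC -ExZ//; apply: eq_Ex => w; rewrite mulrC.
  by under eq_fun do rewrite mulrC; exact: intgZ.
have ic := intg_cos P (mX n).
rewrite -ExB// -ExZ// -ExD; [|exact: intgZ|exact: intg_tail].
apply: Ex_norm_le; [exact: intgB|by apply: intgD; [exact: intgZ|exact: intg_tail]|].
by move=> w; exact: cos_lindeberg.
Qed.

(** Centring removes the first-order term, so that only [sin x - x] counts. *)
Lemma lindeberg_sin X (C : R) : lindeberg_array X ->
  (forall n, Ex P (X n) = 0) -> (forall n, intg P (X n)) ->
  (fun n => (m n)%:R * Ex P (fun w => X n w ^+ 2)) @ \oo --> C ->
  negl m (fun n => Ex P (fun w => sin (X n w))).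
Proof.
move=> [mX iX nX] EX0 iX1 XC; apply: (negl_approx XC) => [n|e e01].
  by apply: Ex_ge0 => w; exact: sqr_ge0.
have /andP[e0 _] := e01.
exists (fun n => (2 / e) * Ex P (fun w => X n w ^+ 2 * (e < `|X n w|)%R%:R)).
  by apply: neglZ; exact: nX.
move=> n; have is_ := intg_sin P (mX n).
have it := intg_tail e (mX n) (iX n).
rewrite -[Ex P (fun w => sin _)]subr0 -(EX0 n) -ExB// -!ExZ// -ExD; [|exact: intgZ..].
apply: Ex_norm_le; [exact: intgB|by apply: intgD; exact: intgZ|].
by move=> w; exact: sin_lindeberg.
Qed.

End triangular_arrays.

Lemma sum_residue_classes (R : nmodType) (k N : nat) (f : nat -> R) :
  \sum_(i < k * N) f i = \sum_(a < k) \sum_(l < N) f (a + k * l)%N.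
Proof.
elim: N => [|N IH].
  by rewrite muln0 big_ord0 big1// => a _; rewrite big_ord0.
rewrite mulnS addnC big_split_ord /= IH.
under [RHS]eq_bigr do rewrite big_ord_recr/=.
by rewrite [RHS]big_split/=; congr (_ + _); apply: eq_bigr => a _; rewrite addnC.
Qed.

(** Telescoping over partial sums, with one [cos_perturb] for each added term. *)
Lemma cos_perturb_sum (R : realType) (e : R) (k : nat) (y : nat -> R) x : 0 < e ->
  `|cos (x + \sum_(a < k) y a) - cos x| <=
  \sum_(a < k) (e + (1 + e^-1) * (1 - cos (y a))).
Proof.
move=> e0; elim: k => [|k IH]; first by rewrite !big_ord0 addr0 subrr normr0.
rewrite !big_ord_recr/= addrA; set z := x + _.
rewrite -(subrK (cos z) (cos (z + y k))) -addrA addrC.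
by rewrite (le_trans (ler_normD _ _))// lerD// cos_perturb.
Qed.

Lemma negl_norm (R : realType) (m : nat -> nat) (u : nat -> R) :
  negl m u -> negl m (fun n => `|u n|).
Proof.
move=> nu; rewrite /negl -[X in _ --> X](@normr0 R R).
rewrite (_ : (fun n => _) = (fun n => `|(m n)%:R * u n|)); first exact: cvg_norm.
by apply/funext => n; rewrite normrM (@ger0_norm _ (m n)%:R).
Qed.

(** * Characteristic functions of row sums *)

Section row_sums.
Context d (T : measurableType d) (R : realType) (P : probability T R).

(** The dependence condition of [cos_sum_recursion]: [C] carries the past of term [j] and [D] the
    term itself, and both may change with [j]. *)
Definition mixing_sums (N : nat) (x : nat -> T -> R) (b : R) : Prop :=
  forall j, (j < N)%N -> exists C D : set (set T),
    [/\ <<s C>> `<=` measurable, <<s D>> `<=` measurable,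
        mixing_le P <<s C>> <<s D>> b,
        forall i, (i < j)%N ->
          measurable_fun setT (x i : g_sigma_algebraType C -> R) &
        measurable_fun setT (x j : g_sigma_algebraType D -> R)].

Context (m : nat -> nat).

(** The recursion leaves an error m (8 b + 2 u), where [u] is o(1/m) and [b] may be taken as any
    small multiple of 1/m. *)
Lemma row_sum_charfn (x : nat -> nat -> T -> R) (rho u : nat -> R) (L th : R) :
  (forall e, 0 < e -> \forall n \near \oo, mixing_sums (m n) (x n) (e / (m n)%:R)) ->
  (forall n, 0 <= rho n <= 1) -> (fun n => rho n ^+ m n) @ \oo --> L ->
  negl m u ->
  (forall n i, (i < m n)%N ->
    `|Ex P (fun w => cos (x n i w)) - rho n| <= u n /\
    `|Ex P (fun w => sin (x n i w))| <= u n) ->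
  (fun n => Ex P (fun w => cos (th + \sum_(i < m n) x n i w))) @ \oo --> L * cos th.
Proof.
move=> mix rho01 rhoL nu xu.
have C : (fun n => rho n ^+ m n * cos th) @ \oo --> L * cos th.
  by apply: cvgM => //; exact: cvg_cst.
apply/cvgrPdist_le => e e0.
move/cvgrPdist_le : C => /(_ (e / 2)); rewrite divr_gt0// => /(_ isT) C.
(* The factors 2 and 8 turn e / 16 and the mixing bound e / 32 into e / 8 and e / 4, which together
   stay below e / 2. *)
move/cvgrPdist_le : nu => /(_ (e / 16)); rewrite divr_gt0// => /(_ isT) nu.
have mixe := mix (e / 32) (divr_gt0 e0 (ltr0n _ 32)).
near=> n.
have h1 : `|L * cos th - rho n ^+ m n * cos th| <= e / 2 by near: n.
have h2 : `|0 - (m n)%:R * u n| <= e / 16 by near: n.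
have h3 : mixing_sums (m n) (x n) (e / 32 / (m n)%:R) by near: n.
have b0 : 0 <= e / 32 / (m n)%:R by rewrite !mulr_ge0 ?invr_ge0// ltW.
have pc i : (i < m n)%N -> `|Ex P (fun w => cos (x n i w)) - rho n| <= `|u n|.
  by move=> /xu[p1 _]; rewrite (le_trans p1)// ler_norm.
have ps i : (i < m n)%N -> `|Ex P (fun w => sin (x n i w))| <= `|u n|.
  by move=> /xu[_ p2]; rewrite (le_trans p2)// ler_norm.
have h4 := cos_sum_recursion (rho01 n) b0 (normr_ge0 _) h3 pc ps th (leqnn _).
have h5 : (m n)%:R * (8 * (e / 32 / (m n)%:R) + 2 * `|u n|) <= e / 2.
  rewrite mulrDr.
  have k1 : (m n)%:R * (8 * (e / 32 / (m n)%:R)) <= e / 4.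
    have [->|mn0] := eqVneq (m n) 0%N; first by rewrite mul0r divr_ge0// ltW.
    rewrite le_eqVlt; apply/orP; left; apply/eqP; field.
    by rewrite pnatr_eq0.
  have k2 : (m n)%:R * (2 * `|u n|) <= e / 8.
    move: h2; rewrite sub0r normrN normrM ger0_norm// => h2.
    by rewrite mulrCA; lra.
  lra.
have h6 : `|Ex P (fun w => cos (th + \sum_(i < m n) x n i w)) - rho n ^+ m n * cos th|
    <= e / 2 := le_trans h4 h5.
move: h1 h6; rewrite !ler_norml; lra.
Unshelve. all: by end_near. Qed.

(** If some [B] is at least 1, the cosines differ by at most 2, hence by at most twice the sum of
    the [B]. Otherwise X = Z + D in every block, and [cos_perturb_sum] adds one residue class at a
    time. Each class sum has characteristic function tending to that of 0, which gives the required
    smallness of E (1 - cos S). *)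
Lemma row_sum_perturb (k : nat) (X Z D B : nat -> nat -> T -> R) (b u : nat -> R)
    (L th : R) :
  (0 < k)%N ->
  (forall n i, measurable_fun setT (X n i)) ->
  (forall n i, measurable_fun setT (Z n i)) ->
  (forall n i, measurable_fun setT (D n i)) ->
  (forall n i, intg P (B n i)) -> (forall n i w, 0 <= B n i w) ->
  (forall n i w, B n i w < 1 -> X n i w = Z n i w + D n i w) ->
  negl m b -> (forall n i, (i < m n)%N -> Ex P (B n i) <= b n) ->
  (forall e, 0 < e -> \forall n \near \oo, forall a, (a < k)%N ->
     mixing_sums (m n) (fun l w => if (a + k * l < m n)%N then D n (a + k * l)%N w else 0)
       (e / (m n)%:R)) ->
  negl m u ->
  (forall n i, (i < m n)%N ->
    `|Ex P (fun w => cos (D n i w)) - 1| <= u n /\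
    `|Ex P (fun w => sin (D n i w))| <= u n) ->
  (fun n => Ex P (fun w => cos (th + \sum_(i < m n) Z n i w))) @ \oo --> L ->
  (fun n => Ex P (fun w => cos (th + \sum_(i < m n) X n i w))) @ \oo --> L.
Proof.
move=> k0 mX mZ mD iB B0 XZD nb Bb mixD nu Du ZL.
(* Padding by 0 past the end of the row gives each class [m n] terms, so no incomplete class has to
   be treated; the k classes reach up to k m n >= m n. *)
pose Dk n a l w := if (a + k * l < m n)%N then D n (a + k * l)%N w else 0.
have mDk n a l : measurable_fun setT (Dk n a l).
  by rewrite /Dk; case: (a + k * l < m n)%N => //; exact: mD.
pose S n a w := \sum_(l < m n) Dk n a l w.
have mS n a : measurable_fun setT (S n a) by exact: measurable_sum.
have SC a : (a < k)%N -> (fun n => Ex P (fun w => 1 - cos (S n a w))) @ \oo --> (0 : R).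
  move=> ak.
  have : (fun n => Ex P (fun w => cos (0 + S n a w))) @ \oo --> (1 * cos 0 : R).
    apply: (@row_sum_charfn (fun n => Dk n a) (fun=> 1) (fun n => `|u n|)).
    - by move=> e e0; apply: filterS (mixD _ e0) => n; apply.
    - by move=> n; rewrite ler01 lexx.
    - by under eq_fun do rewrite expr1n; exact: cvg_cst.
    - exact: negl_norm.
    - move=> n i im; rewrite /Dk; case: (boolP (a + k * i < m n)%N) => [h|_].
        have [p1 p2] := Du n _ h.
        by split; [apply: (le_trans p1)|apply: (le_trans p2)]; exact: ler_norm.
      by rewrite cos0 sin0 !Ex_cst subrr normr0; split.
  rewrite cos0 mulr1 => C.
  rewrite -[X in _ --> X](subrr (1 : R)).
  rewrite (_ : (fun n => _) = (fun n => 1 - Ex P (fun w => cos (0 + S n a w)))).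
    by apply: cvgB => //; exact: cvg_cst.
  apply/funext => n; rewrite ExB ?Ex_cst; [|exact: intg_cst|exact: intg_cos].
  by congr (_ - _); apply: eq_Ex => w; rewrite add0r.
have splitD n w : \sum_(i < m n) D n i w = \sum_(a < k) S n a w.
  have := sum_residue_classes k (m n) (fun i => if (i < m n)%N then D n i w else 0).
  rewrite /S /Dk => <-.
  have mk : (m n <= k * m n)%N by rewrite leq_pmull.
  rewrite (big_ord_widen (k * m n) (fun i => D n i w) mk).
  by rewrite big_mkcond.
have pointwise n w e : 0 < e ->
    `|cos (th + \sum_(i < m n) X n i w) - cos (th + \sum_(i < m n) Z n i w)| <=
    2 * (\sum_(i < m n) B n i w) +
    \sum_(a < k) (e + (1 + e^-1) * (1 - cos (S n a w))).
  move=> e0; have sB : 0 <= \sum_(i < m n) B n i w by apply: sumr_ge0.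
  have sS : 0 <= \sum_(a < k) (e + (1 + e^-1) * (1 - cos (S n a w))).
    apply: sumr_ge0 => a _; rewrite addr_ge0 ?(ltW e0)// mulr_ge0 ?oneB_cos_ge0//.
    by rewrite addr_ge0 ?invr_ge0 ?(ltW e0).
  have [good|/existsNP[i /negP]] := pselect (forall i : 'I_(m n), B n i w < 1).
    have -> : \sum_(i < m n) X n i w = \sum_(i < m n) Z n i w + \sum_(a < k) S n a w.
      by rewrite -splitD -big_split; apply: eq_bigr => i _; rewrite XZD.
    rewrite addrA; apply: (le_trans (cos_perturb_sum k (fun a => S n a w) _ e0)).
    by rewrite lerDr mulr_ge0.
  rewrite -leNgt => Bi; apply: (@le_trans _ _ (2 * 1)).
    apply: (le_trans (ler_normB _ _)).
    by have := cos_max (th + \sum_(i < m n) X n i w);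
       have := cos_max (th + \sum_(i < m n) Z n i w); lra.
  apply: ler_wpDr => //; rewrite ler_wpM2l// (le_trans Bi)//.
  by rewrite (bigD1 i)//= lerDl sumr_ge0.
have mXS n : measurable_fun setT (fun w => th + \sum_(i < m n) X n i w).
  by apply: measurable_funD => //; apply: measurable_sum => i; exact: mX.
have mZS n : measurable_fun setT (fun w => th + \sum_(i < m n) Z n i w).
  by apply: measurable_funD => //; apply: measurable_sum => i; exact: mZ.
have iS n a : intg P (fun w => 1 - cos (S n a w)).
  by apply: intgB; [exact: intg_cst|exact: intg_cos].
have bound n e : 0 < e ->
    `|Ex P (fun w => cos (th + \sum_(i < m n) X n i w)) -
      Ex P (fun w => cos (th + \sum_(i < m n) Z n i w))| <=
    2 * ((m n)%:R * b n) +
    \sum_(a < k) (e + (1 + e^-1) * Ex P (fun w => 1 - cos (S n a w))).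
  move=> e0; rewrite -ExB; [|exact: intg_cos..].
  have i1 : intg P (fun w => 2 * (\sum_(i < m n) B n i w)) by apply: intgZ; exact: intg_sum.
  have i3 a : intg P (fun w => e + (1 + e^-1) * (1 - cos (S n a w))).
    by apply: intgD; [exact: intg_cst|exact: intgZ].
  have i2 : intg P (fun w => \sum_(a < k) (e + (1 + e^-1) * (1 - cos (S n a w)))).
    by apply: intg_sum => a _.
  apply: (@le_trans _ _ (Ex P (fun w => 2 * (\sum_(i < m n) B n i w) +
    \sum_(a < k) (e + (1 + e^-1) * (1 - cos (S n a w)))))).
    apply: Ex_norm_le; [by apply: intgB; exact: intg_cos|exact: intgD|].
    by move=> w; exact: pointwise.
  rewrite ExD// ExZ; last exact: intg_sum.
  rewrite Ex_sum// Ex_sum//; apply: lerD.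
    rewrite ler_wpM2l//; apply: (@le_trans _ _ (\sum_(i < m n) b n)).
      by apply: ler_sum => i _; exact: Bb.
    by rewrite sumr_const card_ord mulr_natl.
  apply: ler_sum => a _; rewrite ExD ?Ex_cst ?ExZ//; first exact: intg_cst.
  exact: intgZ.
apply/cvgrPdist_le => e e0.
pose e1 := e / 4 / k%:R.
have k0' : 0 < k%:R :> R by rewrite ltr0n.
have e10 : 0 < e1 by rewrite !divr_gt0.
have Csum : (fun n => 2 * ((m n)%:R * b n) +
   \sum_(a < k) (e1 + (1 + e1^-1) * Ex P (fun w => 1 - cos (S n a w)))) @ \oo -->
   (2 * 0 + \sum_(a < k) (e1 + (1 + e1^-1) * 0) : R).
  apply: cvgD; first by apply: cvgM; [exact: cvg_cst|exact: nb].
  apply: (cvg_sumr (f := fun (a : 'I_k) n =>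
     e1 + (1 + e1^-1) * Ex P (fun w => 1 - cos (S n a w)))) => a.
  apply: cvgD; first exact: cvg_cst.
  by apply: cvgM; [exact: cvg_cst|exact: SC].
have limE : 2 * 0 + \sum_(a < k) (e1 + (1 + e1^-1) * 0) = e / 4 :> R.
  rewrite mulr0 add0r; under eq_bigr do rewrite mulr0 addr0.
  by rewrite sumr_const card_ord -[LHS]mulr_natr /e1 divfK// gt_eqF.
rewrite limE in Csum.
move/cvgrPdist_le : Csum => /(_ (e / 4)); rewrite divr_gt0// => /(_ isT) Csum.
move/cvgrPdist_le : ZL => /(_ (e / 2)); rewrite divr_gt0// => /(_ isT) ZL.
near=> n.
have h1 : `|L - Ex P (fun w => cos (th + \sum_(i < m n) Z n i w))| <= e / 2 by near: n.
have h2 : `|e / 4 - (2 * ((m n)%:R * b n) +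
   \sum_(a < k) (e1 + (1 + e1^-1) * Ex P (fun w => 1 - cos (S n a w))))| <= e / 4.
  by near: n.
have h3 := bound n e1 e10.
have fin (l z x q : R) : `|l - z| <= e / 2 -> `|e / 4 - q| <= e / 4 ->
    `|x - z| <= q -> `|l - x| <= e by rewrite !ler_norml; lra.
exact: fin h1 h2 h3.
Unshelve. all: by end_near. Qed.

End row_sums.

(** * Mixing of rows from beta-mixing coefficients *)

Section generated_sigma_fields.
Context d (T : measurableType d) d' (S : measurableType d') (I : Type).
Context (Y : I -> T -> S).
Implicit Types D : set I.

(** Generator of [sigma_gen D Y], in the form that [g_sigma_algebraType] takes. *)
Definition entries D : set (set T) :=
  \bigcup_(i in D) preimage_set_system setT (Y i) measurable.

Lemma entries_measurable D : (forall i, measurable_fun setT (Y i)) ->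
  <<s entries D>> `<=` measurable.
Proof.
move=> mY; apply: smallest_sub; first exact: sigma_algebra_measurable.
by move=> _ [i _ [B mB <-]]; exact: mY.
Qed.

Lemma entries_mono D D' : D `<=` D' -> <<s entries D>> `<=` <<s entries D'>>.
Proof.
move=> DD'; apply: sub_sigma_algebra2 => A [i Di Ai]; exists i => //.
exact: DD'.
Qed.

Lemma entries_set0 : entries set0 = set0.
Proof. by rewrite /entries bigcup_set0. Qed.

Lemma measurable_entry D i : D i ->
  measurable_fun setT (Y i : g_sigma_algebraType (entries D) -> S).
Proof.
move=> Di _ B mB; apply: sub_sigma_algebra; exists i => //.
by exists B.
Qed.

End generated_sigma_fields.

Section mixing_of_rows.
Context d (T : measurableType d) (R : realType) (P : probability T R).

Lemma g_sigma_set0 (A : set T) : <<s set0>> A -> A = set0 \/ A = setT.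
Proof.
have : <<s (set0 : set (set T))>> `<=` [set set0; setT].
  apply: smallest_sub => //; split => /=; first by left.
    move=> B [->|->]; first by right; rewrite setD0.
    by left; rewrite setDv.
  move=> F F01; have [FT|F0] := pselect (exists n, F n = setT).
    right; apply/seteqP; split=> // w _; have [n Fn] := FT.
    by exists n => //; rewrite Fn.
  left; apply/seteqP; split=> // w [n _ Fnw].
  by case: (F01 n) => Fn; [rewrite Fn in Fnw|case: F0; exists n].
by move=> h /h.
Qed.

Lemma mixing_trivial_l (H : set (set T)) (b : R) : 0 <= b -> H `<=` measurable ->
  mixing_le P <<s set0>> H b.
Proof.
move=> b0 mH A B /g_sigma_set0[->|->] HB.
  by rewrite set0I !measure0 mul0r subrr normr0.
by rewrite setTI probability_setT mul1r subrr normr0.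
Qed.

Lemma mixing_trivial_r (F : set (set T)) (b : R) : 0 <= b -> F `<=` measurable ->
  mixing_le P F <<s set0>> b.
Proof.
move=> b0 mF A B FA /g_sigma_set0[->|->].
  by rewrite setI0 !measure0 mulr0 subrr normr0.
by rewrite setIT probability_setT mulr1 subrr normr0.
Qed.

Context d' (S : measurableType d') (I : Type) (Y : I -> T -> S) (pos : I -> nat).
Context (mY : forall i, measurable_fun setT (Y i)).

Definition span (i j : nat) := entries Y [set z | (i <= pos z <= j)%N].

Let spanT i j : <<s span i j>> `<=` measurable.
Proof. exact: entries_measurable. Qed.

Lemma beta_mixing_le (N k l : nat) (b : R) : (1 <= l)%N -> (l + k < N)%N ->
  (beta_mixing P N (fun i j => sigma_gen [set z | (i <= pos z <= j)%N] Y) k <= b%:E)%E ->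
  mixing_le P <<s span 1 l>> <<s span (l + k).+1 N>> b.
Proof.
move=> l1 lkN betab A B FA HB.
rewrite -lee_fin; apply: le_trans betab; apply: le_trans.
  exact: (abs_regularity_mixing P (@spanT _ _) FA (spanT HB) HB).
rewrite /beta_mixing.
apply: (@le_bigmax_seq _ _ _ (index_iota 1 (N - k)) 0%E l xpredT (fun l =>
  abs_regularity P (sigma_gen [set z | (1 <= pos z <= l)%N] Y)
    (sigma_gen [set z | ((l + k).+1 <= pos z <= N)%N] Y))) => //.
by rewrite mem_index_iota l1 ltn_subRL addnC.
Qed.

(** A first term has no past and a constant carries no information, so that one of the two
    sigma-fields can be taken trivial; otherwise [k] entries separate past and present. If
    [l + k >= N], no entries are left for the present, whose sigma-field is again trivial. *)
Lemma mixing_sums_span (J N k : nat) (x : nat -> T -> R) (b : R) : 0 <= b ->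
  (beta_mixing P N (fun i j => sigma_gen [set z | (i <= pos z <= j)%N] Y) k <= b%:E)%E ->
  (forall j, (j < J)%N ->
     [\/ j = 0%N /\ measurable_fun setT (x j : g_sigma_algebraType (span 1 N) -> R),
         (exists c, x j = cst c) /\ (forall i, (i < j)%N ->
            measurable_fun setT (x i : g_sigma_algebraType (span 1 N) -> R)) |
         exists l, [/\ (1 <= l)%N, forall i, (i < j)%N ->
           measurable_fun setT (x i : g_sigma_algebraType (span 1 l) -> R) &
           measurable_fun setT (x j : g_sigma_algebraType (span (l + k).+1 N) -> R)]]) ->
  mixing_sums P J x b.
Proof.
move=> b0 betab H j jJ.
have s0T : <<s (set0 : set (set T))>> `<=` measurable.
  by move=> A /g_sigma_set0[->|->].
have [[-> mx]|[[c xc] mx]|[l [l1 mx mxj]]] := H j jJ.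
- exists set0, (span 1 N); split => //; exact: mixing_trivial_l.
- exists (span 1 N), set0; split => //; first exact: mixing_trivial_r.
  by rewrite xc; exact: measurable_cst.
- exists (span 1 l), (span (l + k).+1 N); split => //.
  have [lkN|Nlk] := ltnP (l + k)%N N; first exact: beta_mixing_le.
  rewrite [X in mixing_le P _ <<s X>>](_ : _ = set0).
    exact: mixing_trivial_r.
  rewrite /span (_ : [set z | _] = set0) ?entries_set0//.
  apply/seteqP; split=> // z /= /andP[h1 h2].
  by have := leq_trans h1 h2; rewrite ltnNge Nlk.
Qed.

End mixing_of_rows.

Section reindexing.
Context d (T : measurableType d) (R : realType) (P : probability T R).
Context (I J : Type) d' (S : measurableType d').

Lemma same_law_trans (Y Y' Y'' : I -> T -> S) :
  same_law P Y Y' -> same_law P Y' Y'' -> same_law P Y Y''.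
Proof. by move=> h h' B cB; rewrite h// h'. Qed.

(** Stationarity for windows of length 1 shifted by [i]. Windows are indexed by pairs, so a set of
    paths over [J] is pulled back along [h']. *)
Lemma stationary_row_law (N : nat) (Y : nat -> J -> T -> S) (i : nat) :
  stationary_row P N Y -> (i < N)%N -> same_law P (Y 1%N) (Y i.+1).
Proof.
move=> stY iN; have := stY i 1%N; rewrite addn1 => /(_ iN) h B cB.
pose h' (j : J) : 'I_1 * J := (ord0, j).
have hB : cylinder_sigma [set f : 'I_1 * J -> S | B (fun j => f (h' j))].
  have := @measurable_path _ (g_sigma_algebraType (@cylinders ('I_1 * J) _ S)) J _ S
    (fun j f => f (h' j)) (fun j => @measurable_coordinate ('I_1 * J) _ S (h' j)).
  by move=> /(_ (@measurableT _ _) B cB); rewrite setTI.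
by have := h _ hB; rewrite /= addn0.
Qed.

End reindexing.

(** * Blocks *)

(** Values beyond 1 are sent to 0 rather than clipped, so that the square is, after scaling, exactly
    the truncated square of (5). *)
Definition trunc1 (R : realType) (x : R) : R := x * (`|x| <= 1)%R%:R.

Lemma trunc1_id (R : realType) (x : R) : `|x| <= 1 -> trunc1 x = x.
Proof. by rewrite /trunc1 => ->; rewrite mulr1. Qed.

Lemma trunc1_le1 (R : realType) (x : R) : `|trunc1 x| <= 1.
Proof.
rewrite /trunc1; have [h|h] := boolP (`|x| <= 1); first by rewrite mulr1.
by rewrite mulr0 normr0.
Qed.

Lemma trunc1_sqr (R : realType) (x : R) :
  trunc1 x ^+ 2 = x ^+ 2 * (`|x| <= 1)%R%:R.
Proof.
by rewrite /trunc1 exprMn; case: (`|x| <= 1); rewrite /= ?expr1n// expr0n.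
Qed.

Lemma measurable_trunc1 (R : realType) d (T : measurableType d) (f : T -> R) :
  measurable_fun setT f -> measurable_fun setT (fun w => trunc1 (f w)).
Proof.
move=> mf; apply: measurable_funM => //.
rewrite (_ : (fun w => _) = (fun w => 1 - (1 < `|f w|)%R%:R)).
  by apply: measurable_funB => //; exact: measurable_lt_norm.
apply/funext => w; have [h|h] := leP `|f w| 1; first by rewrite subr0.
by rewrite subrr.
Qed.

Section rows_of_pairs.
Context {R : realType} d (T : measurableType d) (P : probability T R) (G : Type).
Context (V Vt : nat -> nat -> G -> T -> R) (V0 Vt0 : nat -> G -> T -> R).
Context (m : nat -> nat) (a : nat -> R) (q : nat) (g : 'I_q -> G).
Context (c : 'I_q -> 'I_q -> R).
Context (mV : forall n i h, measurable_fun setT (V n i h)).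
Context (mVt : forall n i h, measurable_fun setT (Vt n i h)).
Context (mV0 : forall n h, measurable_fun setT (V0 n h)).
Context (mVt0 : forall n h, measurable_fun setT (Vt0 n h)).
Context (iV0 : forall n h, intg P (V0 n h)).
Context (iV02 : forall n h, intg P (fun w => V0 n h w ^+ 2)).
Context (iVt0 : forall n h, intg P (Vt0 n h)).

(** A function of a path of pairs rather than of an outcome, as are the functionals below: equality
    in law then transfers expectations from any block to the generic pair. The factor [a n] stands
    for p_n^(-1/2). *)
Definition scaled_V n j (f : G -> R * R) : R :=
  a n * ((f (g j)).1 - Ex P (V0 n (g j))).

Definition scaled_Vt n j (f : G -> R * R) : R :=
  a n * ((f (g j)).2 - Ex P (Vt0 n (g j))).

Definition scaled_diff n j (f : G -> R * R) : R :=
  a n * ((f (g j)).1 - (f (g j)).2 - Ex P (fun w => V0 n (g j) w - Vt0 n (g j) w)).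

Definition path0 n w : G -> R * R := fun h => (V0 n h w, Vt0 n h w).
Definition path_ n i w : G -> R * R := fun h => (V n i h w, Vt n i h w).

Definition mean_trunc n j : R := Ex P (fun w => trunc1 (scaled_diff n j (path0 n w))).

Context (t : 'I_q -> R).

Definition row_V n f : R := \sum_j t j * scaled_V n j f.

(* [row_Vt] is recentred by the mean of the truncated difference, which need
   not be negligible; then [row_V = row_Vt + row_diff] off [bad_row]. *)
Definition row_Vt n f : R := \sum_j t j * (scaled_Vt n j f + mean_trunc n j).
Definition row_diff n f : R :=
  \sum_j t j * (trunc1 (scaled_diff n j f) - mean_trunc n j).
(** Counts the coordinates that the truncation alters. Being an integer, it is 0 wherever it is
    below 1, and its expectation bounds the probability of an alteration. *)
Definition bad_row n (f : G -> R * R) : R :=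
  \sum_j (1 < `|scaled_diff n j f|)%R%:R.

Lemma bad_row_ge0 n f : 0 <= bad_row n f.
Proof. by apply: sumr_ge0. Qed.

Lemma row_split n f : bad_row n f < 1 -> row_V n f = row_Vt n f + row_diff n f.
Proof.
move=> bad; rewrite /row_V /row_Vt /row_diff -big_split; apply: eq_bigr => j _ /=.
rewrite -mulrDr trunc1_id; last first.
  rewrite leNgt; apply/negP => h; move: bad; rewrite /bad_row (bigD1 j)//= h.
  by apply/negP; rewrite -leNgt lerDl sumr_ge0.
rewrite addrACA subrr addr0; congr (_ * _).
by rewrite /scaled_V /scaled_Vt /scaled_diff ExB//; ring.
Qed.

Section measurability.
Context d1 (T1 : measurableType d1) (f : T1 -> G -> R * R).

Lemma measurable_row_Vt n :
  (forall j, measurable_fun setT (fun x => (f x (g j)).2)) ->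
  measurable_fun setT (fun x => row_Vt n (f x)).
Proof.
move=> mf; apply: measurable_sum => j; apply: measurable_funM => //.
apply: measurable_funD => //; apply: measurable_funM => //.
exact: measurable_funB.
Qed.

Context (mf1 : forall j, measurable_fun setT (fun x => (f x (g j)).1)).

Lemma measurable_scaled_V n j : measurable_fun setT (fun x => scaled_V n j (f x)).
Proof. by apply: measurable_funM => //; exact: measurable_funB. Qed.

Lemma measurable_row_V n : measurable_fun setT (fun x => row_V n (f x)).
Proof.
by apply: measurable_sum => j; apply: measurable_funM => //; exact: measurable_scaled_V.
Qed.

Context (mf2 : forall j, measurable_fun setT (fun x => (f x (g j)).2)).

Lemma measurable_scaled_diff n j :
  measurable_fun setT (fun x => scaled_diff n j (f x)).
Proof.
by apply: measurable_funM => //; apply: measurable_funB => //; exact: measurable_funB.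
Qed.

Lemma measurable_row_diff n : measurable_fun setT (fun x => row_diff n (f x)).
Proof.
apply: measurable_sum => j; apply: measurable_funM => //.
apply: measurable_funB => //; apply: measurable_trunc1.
exact: measurable_scaled_diff.
Qed.

Lemma measurable_bad_row n : measurable_fun setT (fun x => bad_row n (f x)).
Proof.
by apply: measurable_sum => j; apply: measurable_lt_norm; exact: measurable_scaled_diff.
Qed.

End measurability.

Let CG := g_sigma_algebraType (@cylinders G _ (R * R)%type).

Let mc1 h : measurable_fun setT ((fun f => (f h).1) : CG -> R).
Proof. exact: (measurableT_comp measurable_fst (measurable_coordinate h)). Qed.

Let mc2 h : measurable_fun setT ((fun f => (f h).2) : CG -> R).
Proof. exact: (measurableT_comp measurable_snd (measurable_coordinate h)). Qed.

Context (law : forall n i, (i < m n)%N ->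
  same_law P (fun h w => (V0 n h w, Vt0 n h w))
             (fun h w => (V n i.+1 h w, Vt n i.+1 h w))).

Lemma transfer_Ex n i (phi : (G -> R * R) -> R) : (i < m n)%N ->
  measurable_fun setT (phi : CG -> R) ->
  Ex P (fun w => phi (path_ n i.+1 w)) = Ex P (fun w => phi (path0 n w)).
Proof.
move=> im mphi; apply/esym; apply: (same_law_Ex _ _ (law im) mphi) => h.
  exact: measurable_fun_pair.
exact: measurable_fun_pair.
Qed.

Context (m_large : forall M : nat, \forall n \near \oo, (M <= m n)%N).
Context (diff_small : forall j, negl m (fun n => Ex P (fun w =>
  scaled_diff n j (path0 n w) ^+ 2 * (`|scaled_diff n j (path0 n w)| <= 1)%R%:R))).
Context (diff_tail : forall j, negl m (fun n => Ex P (fun w =>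
  (1 < `|scaled_diff n j (path0 n w)|)%R%:R))).
Context (lindeberg : forall j (e : R), 0 < e -> negl m (fun n => Ex P (fun w =>
  scaled_V n j (path0 n w) ^+ 2 * (e < `|scaled_V n j (path0 n w)|)%R%:R))).
Context (cov_cvg : forall i j, (fun n => (m n)%:R *
  Ex P (fun w => scaled_V n i (path0 n w) * scaled_V n j (path0 n w))) @ \oo --> c i j).

Let m01 n j : measurable_fun setT (fun w => (path0 n w (g j)).1).
Proof. exact: mV0. Qed.

Let m02 n j : measurable_fun setT (fun w => (path0 n w (g j)).2).
Proof. exact: mVt0. Qed.

Lemma intg_scaled_V n j : intg P (fun w => scaled_V n j (path0 n w)).
Proof. by apply: intgZ; apply: intgB; [exact: iV0|exact: intg_cst]. Qed.

Lemma Ex_scaled_V n j : Ex P (fun w => scaled_V n j (path0 n w)) = 0.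
Proof.
rewrite ExZ; last by apply: intgB; [exact: iV0|exact: intg_cst].
rewrite ExB; [|exact: iV0|exact: intg_cst].
by rewrite Ex_cst subrr mulr0.
Qed.

Lemma intg_scaled_V_sqr n j : intg P (fun w => scaled_V n j (path0 n w) ^+ 2).
Proof.
rewrite (_ : (fun w => _) = (fun w => (a n * V0 n (g j) w + - (a n * Ex P (V0 n (g j)))) ^+ 2)).
  apply: intg_sqrD => //; first exact: measurable_funM.
    by under eq_fun do rewrite exprMn; exact: intgZ.
  exact: intg_cst.
by apply/funext => w; rewrite /scaled_V mulrBr.
Qed.

Lemma intg_scaled_VM n i j :
  intg P (fun w => scaled_V n i (path0 n w) * scaled_V n j (path0 n w)).
Proof.
by apply: intgM_sqr; [exact: measurable_scaled_V..|exact: intg_scaled_V_sqr|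
  exact: intg_scaled_V_sqr].
Qed.

Lemma row_V_second_moment :
  (fun n => (m n)%:R * Ex P (fun w => row_V n (path0 n w) ^+ 2)) @ \oo --> qform c t.
Proof.
have E n : Ex P (fun w => row_V n (path0 n w) ^+ 2) =
    \sum_i \sum_j t i * t j *
      Ex P (fun w => scaled_V n i (path0 n w) * scaled_V n j (path0 n w)).
  have -> : (fun w => row_V n (path0 n w) ^+ 2) = (fun w => \sum_i \sum_j t i * t j *
      (scaled_V n i (path0 n w) * scaled_V n j (path0 n w))).
    apply/funext => w; rewrite expr2 /row_V mulr_suml; apply: eq_bigr => i _.
    by rewrite mulr_sumr; apply: eq_bigr => j _; ring.
  have iM i j := intg_scaled_VM n i j.
  rewrite Ex_sum => [|i _]; last by apply: intg_sum => j _; exact: intgZ.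
  apply: eq_bigr => i _; rewrite Ex_sum => [|j _]; last exact: intgZ.
  by apply: eq_bigr => j _; rewrite ExZ.
rewrite (_ : (fun n => _) = (fun n => \sum_i \sum_j t i * t j * ((m n)%:R *
    Ex P (fun w => scaled_V n i (path0 n w) * scaled_V n j (path0 n w))))).
  apply: (cvg_sumr (f := fun i n => \sum_j t i * t j * ((m n)%:R *
    Ex P (fun w => scaled_V n i (path0 n w) * scaled_V n j (path0 n w))))) => i.
  apply: (cvg_sumr (f := fun j n => t i * t j * ((m n)%:R *
    Ex P (fun w => scaled_V n i (path0 n w) * scaled_V n j (path0 n w))))) => j.
  by apply: cvgM; [exact: cvg_cst|exact: cov_cvg].
apply/funext => n; rewrite E mulr_sumr; apply: eq_bigr => i _.
by rewrite mulr_sumr; apply: eq_bigr => j _; rewrite mulrCA.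
Qed.

(** A limit of rescaled second moments; this is what makes [c] a possible covariance. *)
Lemma limit_qform_ge0 : 0 <= qform c t.
Proof.
apply: (cvgr_to_ge row_V_second_moment); apply: nearW => n.
by rewrite mulr_ge0// Ex_ge0// => w; rewrite sqr_ge0.
Qed.

(** A variance is at most the second moment, which by [trunc1_sqr] is the quantity in
    [diff_small]. *)
Lemma trunc_diff_null j : null_array P m
  (fun n w => trunc1 (scaled_diff n j (path0 n w)) - mean_trunc n j).
Proof.
have mt n : measurable_fun setT (fun w => trunc1 (scaled_diff n j (path0 n w))).
  by apply: measurable_trunc1; exact: measurable_scaled_diff.
have it n : intg P (fun w => trunc1 (scaled_diff n j (path0 n w))).
  by apply: (intg_bounded P (mt n)) => w; exact: trunc1_le1.
have it2 n : intg P (fun w => trunc1 (scaled_diff n j (path0 n w)) ^+ 2).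
  apply: (intg_bounded P (M := 1)); first exact: measurable_funX.
  by move=> w; rewrite normrX exprn_ile1// trunc1_le1.
split=> [n|n|]; first exact: measurable_funB.
  apply: (intg_sqrD (g := fun=> - mean_trunc n j) (mt n) _ (it2 n)) => //.
  exact: intg_cst.
apply: (negl_le (diff_small j)) => n.
rewrite ger0_norm; last by apply: Ex_ge0 => w; exact: sqr_ge0.
have -> : Ex P (fun w => (trunc1 (scaled_diff n j (path0 n w)) - mean_trunc n j) ^+ 2) =
    Ex P (fun w => trunc1 (scaled_diff n j (path0 n w)) ^+ 2) - mean_trunc n j ^+ 2.
  rewrite (_ : (fun w => _ ^+ 2) = (fun w => trunc1 (scaled_diff n j (path0 n w)) ^+ 2 -
    (2 * mean_trunc n j * trunc1 (scaled_diff n j (path0 n w)) - mean_trunc n j ^+ 2))).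
    rewrite ExB//; last by apply: intgB; [exact: intgZ|exact: intg_cst].
    rewrite ExB ?Ex_cst; [|exact: intgZ|exact: intg_cst].
    by rewrite ExZ// -/(mean_trunc n j); ring.
  by apply/funext => w; ring.
rewrite (eq_Ex _ (fun w => trunc1_sqr (scaled_diff n j (path0 n w)))).
by rewrite gerBl sqr_ge0.
Qed.

Lemma row_diff_null : null_array P m (fun n w => row_diff n (path0 n w)).
Proof.
apply: (@null_array_sum _ _ _ P m _ (index_enum 'I_q) (fun j n w =>
  t j * (trunc1 (scaled_diff n j (path0 n w)) - mean_trunc n j))) => j.
by apply: null_arrayZ; exact: trunc_diff_null.
Qed.

Lemma row_V_lindeberg : lindeberg_array P m (fun n w => row_V n (path0 n w)).
Proof.
apply: (@lindeberg_sum _ _ _ P m _ (index_enum 'I_q) (fun j n w => t j * scaled_V n j (path0 n w))) => j.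
apply: lindebergZ; split=> [n|n|]; [exact: measurable_scaled_V|
  exact: intg_scaled_V_sqr|exact: lindeberg].
Qed.

Let Rv n w := row_V n (path0 n w).
Let Rd n w := row_diff n (path0 n w).
(** Stand-in for [row_Vt], with which it agrees off the bad event. It inherits a second moment from
    V, whereas tilde V is only integrable. *)
Let eta n w := Rv n w - Rd n w.
Let v n := Ex P (fun w => eta n w ^+ 2).

Let mRv n : measurable_fun setT (Rv n). Proof. exact: measurable_row_V. Qed.
Let mRd n : measurable_fun setT (Rd n). Proof. exact: measurable_row_diff. Qed.
Let meta n : measurable_fun setT (eta n). Proof. exact: measurable_funB. Qed.

Let iRv n : intg P (Rv n).
Proof. by apply: intg_sum => j _; apply: intgZ; exact: intg_scaled_V. Qed.

Let intg_trunc n j : intg P (fun w => trunc1 (scaled_diff n j (path0 n w))).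
Proof.
apply: (intg_bounded P (M := 1)); last by move=> w; exact: trunc1_le1.
by apply: measurable_trunc1; exact: measurable_scaled_diff.
Qed.

Let intg_trunc_centered n j :
  intg P (fun w => trunc1 (scaled_diff n j (path0 n w)) - mean_trunc n j).
Proof. by apply: intgB => //; exact: intg_cst. Qed.

Let iRd n : intg P (Rd n).
Proof. by apply: intg_sum => j _; exact: intgZ. Qed.

Let Ex_Rd n : Ex P (Rd n) = 0.
Proof.
rewrite Ex_sum => [|j _]; last exact: intgZ.
rewrite big1// => j _; rewrite ExZ// ExB ?Ex_cst//; last exact: intg_cst.
by rewrite subrr mulr0.
Qed.

Let Ex_eta n : Ex P (eta n) = 0.
Proof.
rewrite ExB// Ex_Rd subr0 Ex_sum => [|j _]; last by apply: intgZ; exact: intg_scaled_V.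
rewrite big1// => j _; rewrite ExZ; last exact: intg_scaled_V.
by rewrite Ex_scaled_V mulr0.
Qed.

Let v_cvg : (fun n => (m n)%:R * v n) @ \oo --> qform c t.
Proof.
apply: second_moment_perturb => //; [|exact: row_diff_null|exact: row_V_second_moment].
by have [] := row_V_lindeberg.
Qed.

Let eta_lindeberg : lindeberg_array P m eta.
Proof.
rewrite (_ : eta = (fun n w => Rv n w + -1 * Rd n w)).
  apply: lindebergD; first exact: row_V_lindeberg.
  by apply: lindeberg_null; apply: null_arrayZ; exact: row_diff_null.
by apply/funext => n; apply/funext => w; rewrite mulN1r.
Qed.

Let bad n : R := Ex P (fun w => bad_row n (path0 n w)).

Let intg_bad (f : T -> G -> R * R) n :
  (forall j, measurable_fun setT (fun x => (f x (g j)).1)) ->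
  (forall j, measurable_fun setT (fun x => (f x (g j)).2)) ->
  intg P (fun w => bad_row n (f w)).
Proof.
move=> mf1 mf2; apply: intg_sum => j _; apply: (intg_bounded P (M := 1)).
  by apply: measurable_lt_norm; exact: measurable_scaled_diff.
by move=> w; case: (_ < _)%R; rewrite /= ?normr1 ?normr0.
Qed.

Let bad_negl : negl m bad.
Proof.
rewrite (_ : bad = (fun n => \sum_j Ex P (fun w =>
  (1 < `|scaled_diff n j (path0 n w)|)%R%:R))).
  by apply: (@negl_sum _ m _ (index_enum 'I_q) (fun j n => Ex P (fun w =>
    (1 < `|scaled_diff n j (path0 n w)|)%R%:R))).
apply/funext => n; rewrite /bad Ex_sum// => j _; apply: (intg_bounded P (M := 1)).
  by apply: measurable_lt_norm; exact: measurable_scaled_diff.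
by move=> w; case: (_ < _)%R; rewrite /= ?normr1 ?normr0.
Qed.

(** By [row_split] the arguments of [h] agree where [bad_row] is below 1; elsewhere the values
    differ by at most 2. *)
Let row_Vt_near_eta n (h : R -> R) : (forall x, `|h x| <= 1) ->
  measurable_fun setT h ->
  `|Ex P (fun w => h (row_Vt n (path0 n w))) - Ex P (fun w => h (eta n w))|
    <= 2 * bad n.
Proof.
move=> h1 mh.
have mZ : measurable_fun setT (fun w => h (row_Vt n (path0 n w))).
  by apply: measurableT_comp => //; exact: measurable_row_Vt.
have mH : measurable_fun setT (fun w => h (eta n w)) by exact: measurableT_comp.
have i1 := intg_bounded P mZ (fun w => h1 _).
have i2 := intg_bounded P mH (fun w => h1 _).
have ib : intg P (fun w => bad_row n (path0 n w)) by exact: intg_bad.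
rewrite -ExB// /bad -ExZ//; apply: Ex_norm_le; [exact: intgB|exact: intgZ|].
move=> w; have [good|gebad] := ltP (bad_row n (path0 n w)) 1.
  rewrite /eta /Rv /Rd row_split// addrK subrr normr0.
  by rewrite mulr_ge0// bad_row_ge0.
apply: (le_trans (ler_normB _ _)).
by have := h1 (row_Vt n (path0 n w)); have := h1 (eta n w); lra.
Qed.

Let expRN_bounds (y : R) : 0 <= y -> `|1 - y - expR (- y)| <= y ^+ 2.
Proof.
move=> y0; have e1 : 1 - y <= expR (- y) by have := expR_ge1Dx (- y); lra.
have e2 : expR (- y) <= 1 - y + y ^+ 2.
  apply: (@le_trans _ _ (1 + y)^-1).
    by rewrite expRN lef_pV2 ?posrE ?expR_gt0 ?expR_ge1Dx//; lra.
  rewrite -[leLHS]mul1r ler_pdivrMr; last lra.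
  have -> : (1 - y + y ^+ 2) * (1 + y) = 1 + y ^+ 3 by ring.
  by rewrite lerDl exprn_ge0.
by rewrite ler_norml; have := sqr_ge0 y; lra.
Qed.

Let v_ge0 n : 0 <= v n. Proof. by apply: Ex_ge0 => w; exact: sqr_ge0. Qed.

Let v_cvg0 : v @ \oo --> (0 : R).
Proof.
apply/cvgrPdist_le => e e0; pose C := `|qform c t| + 1.
have C0 : 0 < C by rewrite ltr_wpDl.
move/cvgrPdist_le : v_cvg => /(_ 1 ltr01) H.
have mM := m_large (Num.truncn (C / e)).+1.
near=> n; rewrite sub0r normrN ger0_norm//.
have vC : (m n)%:R * v n <= C.
  have : `|qform c t - (m n)%:R * v n| <= 1 by near: n.
  by rewrite /C ler_norml; have := ler_norm (qform c t); lra.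
have mC : C / e < (m n)%:R.
  apply: (@lt_le_trans _ _ (Num.truncn (C / e)).+1%:R); first exact: truncnS_gt.
  by rewrite ler_nat; near: n.
have m0 : 0 < (m n)%:R :> R by rewrite (lt_trans _ mC)// divr_gt0.
move: vC; rewrite -ler_pdivlMl// => /le_trans; apply.
by rewrite ler_pdivrMl// -ler_pdivrMr// ltW.
Unshelve. all: by end_near. Qed.

(** Unlike 1 - v / 2, this lies in [0, 1] for every n, and its m-th power is exactly exp(- m v /
    2). *)
Let rho n : R := expR (- (v n / 2)).

Let rho_negl : negl m (fun n => 1 - v n / 2 - rho n).
Proof.
have nv2 : negl m (fun n => v n ^+ 2).
  rewrite /negl -[X in _ --> X](mulr0 (qform c t)).
  rewrite (_ : (fun n => _) = (fun n => ((m n)%:R * v n) * v n)).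
    exact: cvgM.
  by apply/funext => n; rewrite expr2 mulrA.
apply: (negl_le nv2) => n; apply: le_trans (expRN_bounds _) _.
  by rewrite divr_ge0.
by have := sqr_ge0 (v n); rewrite exprMn; lra.
Qed.

Let rho_cvg : (fun n => rho n ^+ m n) @ \oo --> expR (- (qform c t / 2)).
Proof.
rewrite (_ : (fun n => _) = (fun n => expR (- ((m n)%:R * v n / 2)))).
  apply: continuous_cvg; first exact: continuous_expR.
  by apply: cvgN; apply: cvgM => //; exact: cvg_cst.
apply/funext => n; rewrite /rho -expRM_natl; congr expR.
by rewrite mulrN mulrA.
Qed.

Context (k : nat) (k0 : (0 < k)%N).
Context (mixVt : forall e, 0 < e -> \forall n \near \oo,
  mixing_sums P (m n) (fun i w => row_Vt n (path_ n i.+1 w)) (e / (m n)%:R)).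
Context (mix_diff : forall e, 0 < e -> \forall n \near \oo, forall l, (l < k)%N ->
  mixing_sums P (m n) (fun i w =>
    if (l + k * i < m n)%N then row_diff n (path_ n (l + k * i).+1 w) else 0)
    (e / (m n)%:R)).

(** [row_sum_perturb] removes [row_diff] by the mixing of every k-th block, and [row_sum_charfn]
    treats the remaining [row_Vt] by the mixing with gap 0. One-block expectations are computed for
    the generic pair. *)
Lemma row_V_charfn_cvg th :
  (fun n => Ex P (fun w => cos (th + \sum_(i < m n) row_V n (path_ n i.+1 w))))
    @ \oo --> expR (- (qform c t / 2)) * cos th.
Proof.
have mp1 n i j : measurable_fun setT (fun w => (path_ n i w (g j)).1) by exact: mV.
have mp2 n i j : measurable_fun setT (fun w => (path_ n i w (g j)).2) by exact: mVt.
have [_ iRd2 nRd2] := row_diff_null.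
have mcRd n : measurable_fun setT (row_diff n : CG -> R).
  exact: (@measurable_row_diff _ CG id (fun j => mc1 (g j)) (fun j => mc2 (g j)) n).
have mcVt n : measurable_fun setT (row_Vt n : CG -> R).
  exact: (@measurable_row_Vt _ CG id n (fun j => mc2 (g j))).
have mcbad n : measurable_fun setT (bad_row n : CG -> R).
  exact: (@measurable_bad_row _ CG id (fun j => mc1 (g j)) (fun j => mc2 (g j)) n).
apply: (@row_sum_perturb _ _ _ P m k (fun n i w => row_V n (path_ n i.+1 w))
  (fun n i w => row_Vt n (path_ n i.+1 w)) (fun n i w => row_diff n (path_ n i.+1 w))
  (fun n i w => bad_row n (path_ n i.+1 w)) bad
  (fun n => 3 * Ex P (fun w => Rd n w ^+ 2))).
- exact: k0.
- by move=> n i; exact: measurable_row_V.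
- by move=> n i; exact: measurable_row_Vt.
- by move=> n i; exact: measurable_row_diff.
- by move=> n i; exact: intg_bad.
- by move=> n i w; exact: bad_row_ge0.
- by move=> n i w; exact: row_split.
- exact: bad_negl.
- by move=> n i im; rewrite (transfer_Ex im (mcbad n)).
- exact: mix_diff.
- exact: (neglZ 3 nRd2).
(* The constant 3 comes from [sin_lindeberg] at [e = 1]; the cosine needs only 1 / 2. *)
- move=> n i im.
  rewrite (transfer_Ex im (measurable_cos (mcRd n))).
  rewrite (transfer_Ex im (measurable_sin (mcRd n))) -/(Rd n).
  have i3 : intg P (fun w => 3 * Rd n w ^+ 2) := intgZ 3 (iRd2 n).
  have icos := intg_cos P (mRd n); have isin := intg_sin P (mRd n).
  rewrite -(ExZ 3 (iRd2 n)); split.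
    have -> : Ex P (fun w => cos (Rd n w)) - 1 = Ex P (fun w => cos (Rd n w) - 1).
      by rewrite (ExB icos (intg_cst P 1)) Ex_cst.
    apply: (Ex_norm_le (intgB icos (intg_cst P 1)) i3) => w.
    rewrite distrC ger0_norm ?oneB_cos_ge0// (le_trans (oneB_cos_le _))//.
    by have := sqr_ge0 (Rd n w); rewrite -/(Rd n w); lra.
  rewrite -[Ex P (fun w => sin _)]subr0 -(Ex_Rd n) -(ExB isin (iRd n)).
  apply: (Ex_norm_le (intgB isin (iRd n)) i3) => w.
  have := @sin_lindeberg R 1 (Rd n w); rewrite ltr01 lexx => /(_ isT).
  move/le_trans; apply; have := sqr_ge0 (Rd n w).
  by case: (1 < `|Rd n w|)%R => /=; lra.
- pose u n := `|Ex P (fun w => cos (eta n w)) - (1 - v n / 2)| +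
    `|1 - v n / 2 - rho n| + (`|Ex P (fun w => sin (eta n w))| + 2 * bad n).
  apply: (@row_sum_charfn _ _ _ P m (fun n i w => row_Vt n (path_ n i.+1 w)) rho u).
  + exact: mixVt.
  + by move=> n; rewrite expR_ge0/= -expR0 ler_expR oppr_le0 divr_ge0.
  + exact: rho_cvg.
  + have n1 := negl_norm (lindeberg_cos eta_lindeberg v_cvg).
    have ieta n : intg P (eta n) by exact: intgB.
    have n2 := negl_norm (lindeberg_sin eta_lindeberg Ex_eta ieta v_cvg).
    exact: (neglD (neglD n1 (negl_norm rho_negl)) (neglD n2 (neglZ 2 bad_negl))).
  + move=> n i im.
    rewrite (transfer_Ex im (measurable_cos (mcVt n))).
    rewrite (transfer_Ex im (measurable_sin (mcVt n))).
    have hc := row_Vt_near_eta n (@cos_max R)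
      (continuous_measurable_fun (@continuous_cos R)).
    have hs := row_Vt_near_eta n (@sin_max R)
      (continuous_measurable_fun (@continuous_sin R)).
    have b0 : 0 <= bad n by apply: Ex_ge0 => w; exact: bad_row_ge0.
    have gen (x y z r p' b' : R) : `|x - y| <= b' ->
        `|x - r| <= `|y - z| + `|z - r| + (`|p'| + b').
      move=> h; have -> : x - r = (x - y) + (y - z) + (z - r) by ring.
      have := normr_ge0 p'.
      have := ler_normD (x - y + (y - z)) (z - r).
      by have := ler_normD (x - y) (y - z); lra.
    split; first exact: gen.
    rewrite /u; have := ler_normD (Ex P (fun w => sin (row_Vt n (path0 n w))) -
      Ex P (fun w => sin (eta n w))) (Ex P (fun w => sin (eta n w))).
    rewrite subrK => /le_trans; apply; rewrite addrC.
    by apply: ler_wpDl; [rewrite addr_ge0|rewrite lerD2l].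
Qed.

End rows_of_pairs.

(** * From the asymptotic hypotheses to negligible errors and mixing blocks *)

Section asymptotics.
Context {R : realType}.

(** Multiplication by m / p turns o(p/m) into o(1). The value at [p n = 0] is prescribed separately:
    there the scaling (sqrt p)^-1 is 0 by convention, and scaled moments vanish with it. *)
Lemma littleo_negl (m : nat -> nat) (u p w : nat -> R) :
  (forall n, 0 <= p n) -> (forall n, p n = 0 -> w n = 0) ->
  (forall n, p n != 0 -> w n = (p n)^-1 * u n) ->
  u =o_\oo (fun n => p n / (m n)%:R) -> negl m w.
Proof.
move=> p0 w0 wE /eqoP up; apply/cvgrPdist_le => e e0; apply: filterS (up e e0) => n.
rewrite sub0r normrN; have [pn _|pn] := eqVneq (p n) 0.
  by rewrite (w0 _ pn) mulr0 normr0 ltW.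
rewrite wE// => h; rewrite !normrM (@ger0_norm _ (m n)%:R)//.
have [->|m0] := eqVneq (m n) 0%N; first by rewrite mul0r ltW.
have m0' : 0 < (m n)%:R :> R by rewrite ltr0n lt0n.
have pn0 : 0 < p n by rewrite lt_neqAle eq_sym pn p0.
rewrite (@gtr0_norm _ (p n)^-1) ?invr_gt0//.
apply: (@le_trans _ _ ((m n)%:R * ((p n)^-1 * (e * (p n / (m n)%:R))))).
  rewrite ler_wpM2l// ler_wpM2l ?invr_ge0//; apply: (le_trans h).
  by rewrite ger0_norm// divr_ge0.
suff -> : (m n)%:R * ((p n)^-1 * (e * (p n / (m n)%:R))) = e by [].
by field; rewrite pn (gt_eqF m0').
Qed.

(** Eventually s <= r and (M + 1) r <= n, so that n + 1 - s >= n - r >= M r. *)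
Lemma block_count_large (s r : nat -> nat) : (forall n, (0 < r n)%N) ->
  (fun n => (s n)%:R : R) =o_\oo (fun n => (r n)%:R : R) ->
  (fun n => (r n)%:R : R) =o_\oo (fun n => n%:R : R) ->
  forall M : nat, \forall n \near \oo, (M <= (n.+1 - s n) %/ r n)%N.
Proof.
move=> r0 /eqoP sr /eqoP rn M.
have sr1 := sr 1 ltr01.
have eM : 0 < (M.+1%:R)^-1 :> R by rewrite invr_gt0.
have rnM := rn _ eM.
near=> n.
have srn : (s n <= r n)%N.
  have : `|(s n)%:R : R| <= 1 * `|(r n)%:R : R| by near: n.
  by rewrite mul1r !ger0_norm// ler_nat.
have Mrn : (M.+1 * r n <= n)%N.
  have : `|(r n)%:R : R| <= M.+1%:R^-1 * `|n%:R : R| by near: n.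
  by rewrite !ger0_norm// ler_pdivlMl// -natrM ler_nat.
rewrite leq_divRL//; apply: (@leq_trans (n - r n)).
  by rewrite -(leq_add2r (r n)) -mulSnr subnK// (leq_trans _ Mrn)// mulSn leq_addr.
by apply: leq_sub.
Unshelve. all: by end_near. Qed.

Lemma eventually_le_div (m : nat -> nat) (b : nat -> \bar R) (e : R) : 0 < e ->
  (\forall n \near \oo, (0 < m n)%N) ->
  (fun n => (m n)%:R%:E * b n)%E @ \oo --> 0%E ->
  \forall n \near \oo, (b n <= (e / (m n)%:R)%:E)%E.
Proof.
move=> e0 m0 mb.
move/fine_cvgP : mb => [fin_mb /cvgrPdist_le/(_ _ e0) mb]; near=> n.
have mn : 0 < (m n)%:R :> R by rewrite ltr0n; near: n.
rewrite mulrC EFinM lee_pdivlMl// -[leLHS]fineK; last by near: n.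
rewrite lee_fin (le_trans (ler_norm _))//.
have : `|0 - fine ((m n)%:R%:E * b n)%E| <= e by near: n.
by rewrite sub0r normrN.
Unshelve. all: by end_near. Qed.

End asymptotics.

Section blocks.
Context {R : realType} d (T : measurableType d) (P : probability T R) (G : Type).
Context (V Vt : nat -> G -> T -> R) (V0 Vt0 : nat -> G -> T -> R).
Context (a : nat -> R) (q : nat) (g : 'I_q -> G) (t : 'I_q -> R).
Context (n : nat).
Context (mVt : forall i h, measurable_fun setT (Vt i h)).

(** [row_Vt] reads only second components: the past of term j lies in the field of Vt 1, ..., Vt j
    and the term itself in that of Vt j.+1 onwards, which is a gap of 0. *)
Lemma mixing_sums_row_Vt (N : nat) (b : R) : 0 <= b ->
  (beta_mixing P N (fun i j => sigma_gen [set x : nat * G | (i <= x.1 <= j)%N]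
    (fun x : nat * G => Vt x.1 x.2)) 0 <= b%:E)%E ->
  mixing_sums P N (fun i w => row_Vt P V0 Vt0 a g t n
    (fun h => (V i.+1 h w, Vt i.+1 h w))) b.
Proof.
move=> b0 betab; apply: (@mixing_sums_span _ _ _ P _ _ (nat * G)%type
  (fun x => Vt x.1 x.2) fst _ N N 0 _ b b0 betab) => [x|j jN]; first exact: mVt.
have mx lo hi i : (lo <= i.+1 <= hi)%N -> measurable_fun setT
    ((fun w => row_Vt P V0 Vt0 a g t n (fun h => (V i.+1 h w, Vt i.+1 h w))) :
      g_sigma_algebraType (span (fun x : nat * G => Vt x.1 x.2) fst lo hi) -> R).
  move=> ihi; apply: (@measurable_row_Vt _ _ _ P _ V0 Vt0 a _ g t _
    (g_sigma_algebraType (span (fun x : nat * G => Vt x.1 x.2) fst lo hi))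
    (fun w h => (V i.+1 h w, Vt i.+1 h w)) n) => l.
  exact: (@measurable_entry _ _ _ _ _ (fun x : nat * G => Vt x.1 x.2) _ (i.+1, g l)).
have [->|j0] := eqVneq j 0%N; first by apply: Or31; split => //; apply: mx; case: (N) jN.
apply: Or33; exists j; split; first by rewrite lt0n.
  by move=> i ij; apply: mx; rewrite ij.
by apply: mx; rewrite addn0 leqnn.
Qed.

Context d' (S : measurableType d') (X : nat -> T -> S).
Context (mX : forall i, measurable_fun setT (X i)).
Context (r s N mN : nat) (r0 : (0 < r)%N) (mNE : (mN * r + s <= N.+1)%N).
Context (blockV : forall i h (B : set R), (1 <= i <= mN)%N -> measurable B ->
  sigma_gen [set l : nat | ((i.-1 * r).+1 <= l <= i * r + s - 1)%N] X (V i h @^-1` B) /\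
  sigma_gen [set l : nat | ((i.-1 * r).+1 <= l <= i * r + s - 1)%N] X (Vt i h @^-1` B)).

Lemma measurable_block_diff i lo hi : (1 <= i <= mN)%N ->
  (lo <= (i.-1 * r).+1)%N -> (i * r + s - 1 <= hi)%N ->
  measurable_fun setT
    ((fun w => row_diff P V0 Vt0 a g t n (fun h => (V i h w, Vt i h w))) :
      g_sigma_algebraType (span X id lo hi) -> R).
Proof.
move=> iN lo_le hi_ge.
have sub : [set l : nat | ((i.-1 * r).+1 <= l <= i * r + s - 1)%N] `<=`
    [set l : nat | (lo <= id l <= hi)%N].
  move=> l /= /andP[l1 l2]; apply/andP; split; first exact: leq_trans l1.
  exact: leq_trans hi_ge.
apply: (@measurable_row_diff _ _ _ P _ V0 Vt0 a _ g t _
    (g_sigma_algebraType (span X id lo hi)) (fun w h => (V i h w, Vt i h w)) _ _ n) => j.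
- move=> _ B mB; rewrite setTI.
  by apply: (entries_mono sub); have [] := blockV (g j) iN mB.
- move=> _ B mB; rewrite setTI.
  by apply: (entries_mono sub); have [] := blockV (g j) iN mB.
Qed.

Lemma mixing_sums_row_diff (k l : nat) (b : R) : 0 <= b -> (2 <= k)%N -> (l < k)%N ->
  (s <= k.-1 * r)%N ->
  (beta_mixing P N (fun i j => sigma_gen [set l : nat | (i <= l <= j)%N] X)
    (k.-1 * r - s)%N <= b%:E)%E ->
  mixing_sums P mN (fun i w => if (l + k * i < mN)%N then
    row_diff P V0 Vt0 a g t n
      (fun h => (V (l + k * i).+1 h w, Vt (l + k * i).+1 h w)) else 0) b.
Proof.
move=> b0 k2 lk sk betab.
apply: (@mixing_sums_span _ _ _ P _ _ nat X id mX mN N _ _ b b0 betab) => j jN.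
pose x i (w : T) := if (l + k * i < mN)%N then row_diff P V0 Vt0 a g t n
   (fun h => (V (l + k * i).+1 h w, Vt (l + k * i).+1 h w)) else 0.
have mx i lo hi : (l + k * i < mN -> lo <= ((l + k * i) * r).+1)%N ->
   (l + k * i < mN -> (l + k * i).+1 * r + s - 1 <= hi)%N ->
   measurable_fun setT (x i : g_sigma_algebraType (span X id lo hi) -> R).
  rewrite /x; case: (ltnP (l + k * i) mN) => [h lo1 hi1|_ _ _] //.
  by apply: (measurable_block_diff (i := (l + k * i).+1)) => //;
    [exact: lo1|exact: hi1].
have hi_le i : (i < mN)%N -> (i.+1 * r + s - 1 <= N)%N.
  move=> im; rewrite leq_subLR add1n; apply: leq_trans mNE.
  by rewrite leq_add2r leq_mul2r im orbT.
have [mNj|jmN] : (mN <= l + k * j)%N \/ (l + k * j < mN)%N.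
  by apply/orP; rewrite leqNgt orNb.
  apply: Or32; split; first by exists 0; apply/funext => w; rewrite ltnNge mNj.
  by move=> i _; apply: (mx i) => // h; exact: hi_le.
have [j0|j0] := eqVneq j 0%N.
  by apply: Or31; split => //; apply: (mx j) => // h; exact: hi_le.
(* The last block of the past ends one observation before this index. Adding the gap (k - 1) r - s
   and one more gives (l + k j) r + 1, the first observation of the present block. *)
apply: Or33; exists ((l + k * j - k).+1 * r + s)%N; split.
- by rewrite addn_gt0 muln_gt0 r0.
- move=> i ij; apply: (mx i) => // _.
  rewrite leq_subLR (leq_trans _ (leq_addl _ _))// leq_add2r leq_mul2r ltnS.
  have kij : (k * i + k <= k * j)%N by rewrite -mulnSr leq_mul2l ij orbT.
  apply/orP; right; rewrite leq_subRL; last by rewrite (leq_trans _ (leq_addl _ _))// (leq_trans _ kij)// leq_addl.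
  by rewrite addnC -addnA leq_add2l.
- apply: (mx j) => h; last exact: hi_le.
  have kj : (k <= l + k * j)%N.
    by rewrite (leq_trans _ (leq_addl _ _))// leq_pmulr// lt0n.
  rewrite ltnS -addnA subnKC// -mulnDl leq_mul2r; apply/orP; right.
  by case: (k) kj k2 => // k' kj _; rewrite addSn -addnS subnK.
Qed.

End blocks.

Section square_root_scaling.
Context {R : realType}.
Implicit Types p x e : R.

Lemma sqr_inv_sqrtM p x : 0 <= p -> ((Num.sqrt p)^-1 * x) ^+ 2 = p^-1 * x ^+ 2.
Proof. by move=> p0; rewrite exprMn exprVn sqr_sqrtr. Qed.

Lemma inv_sqrtM_le p x e : 0 < p ->
  (`|(Num.sqrt p)^-1 * x| <= e) = (`|x| <= e * Num.sqrt p).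
Proof.
move=> p0; have s0 : 0 < Num.sqrt p by rewrite sqrtr_gt0.
by rewrite normrM gtr0_norm ?invr_gt0// mulrC ler_pdivrMr.
Qed.

Lemma inv_sqrtM_gt p x e : 0 < p ->
  (e < `|(Num.sqrt p)^-1 * x|) = (e * Num.sqrt p < `|x|).
Proof. by move=> p0; rewrite !ltNge inv_sqrtM_le. Qed.

End square_root_scaling.

Section scaled_moments.
Context {R : realType} d (T : measurableType d) (P : probability T R).
Context (m : nat -> nat) (p : nat -> R) (p_ge0 : forall n, 0 <= p n).
Context (x : nat -> T -> R) (mx : forall n, measurable_fun setT (x n)).

Let gtp n : p n != 0 -> 0 < p n. Proof. by rewrite lt_neqAle eq_sym p_ge0 andbT. Qed.

Lemma intg_head (f : T -> R) (e : R) : measurable_fun setT f ->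
  intg P (fun w => f w ^+ 2 * (`|f w| <= e)%R%:R).
Proof.
move=> mf; apply: (intg_bounded P (M := e ^+ 2)).
  apply: measurable_funM; first exact: measurable_funX.
  rewrite (_ : (fun w => _) = (fun w => 1 - (e < `|f w|)%R%:R)).
    by apply: measurable_funB => //; exact: measurable_lt_norm.
  by apply/funext => w; have [h|h] := leP `|f w| e; rewrite ?subr0 ?subrr.
move=> w; have [h|h] := boolP (`|f w| <= e); last by rewrite mulr0 normr0 sqr_ge0.
by rewrite mulr1 normrX ler_pXn2r ?nnegrE// (le_trans _ h).
Qed.

Lemma negl_scaled_head :
  (fun n => fine 'E_P[fun w => (x n w) ^+ 2 *
     \1_[set w | `|x n w| <= Num.sqrt (p n)] w])
    =o_\oo (fun n => p n / (m n)%:R) ->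
  negl m (fun n => Ex P (fun w => ((Num.sqrt (p n))^-1 * x n w) ^+ 2 *
     (`|(Num.sqrt (p n))^-1 * x n w| <= 1)%R%:R)).
Proof.
move=> xo; apply: (littleo_negl p_ge0 _ _ xo) => n pn.
  rewrite pn sqrtr0 invr0 -[RHS](Ex_cst P); apply: eq_Ex => w.
  by rewrite mul0r expr0n mul0r.
have p0 := gtp pn.
rewrite expectation_Ex -ExZ; last first.
  rewrite (_ : (fun w => _) = (fun w => x n w ^+ 2 * (`|x n w| <= Num.sqrt (p n))%R%:R)).
    exact: intg_head.
  by apply/funext => w; rewrite (indic_bool R (fun w => `|x n w| <= Num.sqrt (p n))).
apply: eq_Ex => w; rewrite (indic_bool R (fun w => `|x n w| <= Num.sqrt (p n))).
by rewrite sqr_inv_sqrtM// inv_sqrtM_le// mul1r mulrA.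
Qed.

Lemma negl_scaled_tail (e : R) : (forall n, intg P (fun w => x n w ^+ 2)) ->
  (fun n => fine 'E_P[fun w => (x n w) ^+ 2 *
     \1_[set w | `|x n w| > e * Num.sqrt (p n)] w])
    =o_\oo (fun n => p n / (m n)%:R) ->
  negl m (fun n => Ex P (fun w => ((Num.sqrt (p n))^-1 * x n w) ^+ 2 *
     (e < `|(Num.sqrt (p n))^-1 * x n w|)%R%:R)).
Proof.
move=> ix xo; apply: (littleo_negl p_ge0 _ _ xo) => n pn.
  rewrite pn sqrtr0 invr0 -[RHS](Ex_cst P); apply: eq_Ex => w.
  by rewrite mul0r expr0n mul0r.
have p0 := gtp pn.
rewrite expectation_Ex -ExZ; last first.
  rewrite (_ : (fun w => _) = (fun w => x n w ^+ 2 * (e * Num.sqrt (p n) < `|x n w|)%R%:R)).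
    exact: intg_tail.
  by apply/funext => w; rewrite (indic_bool R (fun w => e * Num.sqrt (p n) < `|x n w|)).
apply: eq_Ex => w; rewrite (indic_bool R (fun w => e * Num.sqrt (p n) < `|x n w|)).
by rewrite sqr_inv_sqrtM// inv_sqrtM_gt// mulrA.
Qed.

Lemma negl_scaled_probability :
  (fun n => fine (P [set w | `|x n w| > Num.sqrt (p n)]))
    =o_\oo (fun n => ((m n)%:R)^-1 : R) ->
  negl m (fun n => Ex P (fun w => (1 < `|(Num.sqrt (p n))^-1 * x n w|)%R%:R)).
Proof.
move=> xo; apply: (@negl_le _ m _ (fun n => fine (P [set w | `|x n w| > Num.sqrt (p n)]))).
  apply: (@littleo_negl _ m _ (fun=> 1) _ _ _ _ _) => [//|n /eqP|n _|].
  - by rewrite oner_eq0.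
  - by rewrite invr1 mul1r.
  - rewrite (_ : (fun n => 1 / (m n)%:R) = (fun n => ((m n)%:R)^-1))//.
    by apply/funext => n; rewrite mul1r.
move=> n; have mA : measurable [set w | `|x n w| > Num.sqrt (p n)].
  rewrite -[X in measurable X]setTI.
  have -> : [set w | `|x n w| > Num.sqrt (p n)] =
      (fun w => `|x n w|) @^-1` `]Num.sqrt (p n), +oo[%classic.
    by apply/seteqP; split=> w /=; rewrite in_itv/= andbT.
  by apply: measurableT_comp => //; exact: measurable_itv.
rewrite -(Ex_indic P mA); have [p0|pn] := eqVneq (p n) 0.
  rewrite (_ : Ex P _ = 0); first by rewrite normr0 Ex_ge0.
  rewrite -[RHS](Ex_cst P); apply: eq_Ex => w.
  by rewrite p0 sqrtr0 invr0 mul0r normr0 ltr10.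
rewrite ger0_norm; last exact: Ex_ge0.
rewrite le_eqVlt; apply/orP; left; apply/eqP; apply: eq_Ex => w.
rewrite (indic_bool R (fun w => Num.sqrt (p n) < `|x n w|)).
by rewrite (inv_sqrtM_gt _ _ (gtp pn)) mul1r.
Qed.

End scaled_moments.

(** * The central limit theorem for the empirical process *)

Lemma fine_covariance (R : realType) d (T : measurableType d) (P : probability T R)
  (X Y : T -> R) :
  fine (covariance P X Y) = Ex P (fun w => (X w - Ex P X) * (Y w - Ex P Y)).
Proof. by rewrite unlock expectation_Ex !expectation_Ex. Qed.

Theorem theoremA1 (R : realType) (E : completeNormedModType R)
    (d : measure_display) (T : measurableType d) (P : probability T R)
    (G : topologicalType)
    (X : nat -> nat -> {RV P >-> borel E})
    (s r : nat -> nat)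
    (V Vt : nat -> nat -> G -> {RV P >-> R})
    (* the generic pairs (V_n, tilde V_n) *)
    (V0 Vt0 : nat -> G -> {RV P >-> R})
    (c : G -> G -> R) :
  let m := fun n : nat => ((n.+1 - s n) %/ r n)%N in
  let p := fun n : nat => prob_completed P [set w | exists g, V0 n g w != 0] in
  let FX := fun n i j : nat =>
    sigma_gen [set l : nat | (i <= l <= j)%N] (X n) in
  let FVt := fun n i j : nat =>
    sigma_gen [set x : nat * G | (i <= x.1 <= j)%N]
      (fun x : nat * G => Vt n x.1 x.2) in
  let VC := fun n g w => V0 n g w - fine 'E_P[V0 n g] in
  let Delta := fun n g w => V0 n g w - Vt0 n g w in
  let DeltaC := fun n g w => Delta n g w - fine 'E_P[Delta n g] in
  let Z := fun n g w =>
    (Num.sqrt (p n))^-1 *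
      \sum_(1 <= i < (m n).+1) (V n i g w - fine 'E_P[V n i g]) in
  (* the generic pairs have the law of (V_{n,1}, tilde V_{n,1}) *)
  (forall n, (0 < m n)%N ->
     same_law P (fun g w => (V0 n g w, Vt0 n g w))
                (fun g w => (V n 1%N g w, Vt n 1%N g w))) ->
  (* the expectations and covariances below are well defined *)
  (forall n g, (V0 n g : T -> R) \in Lfun P 2%:E) ->
  (forall n g, (Vt0 n g : T -> R) \in Lfun P 1%:E) ->
  p @ \oo --> (0 : R) ->
  (* (1) *)
  (forall n, stationary_row P n (fun i (_ : unit) => X n i)) ->
  (forall n, (0 < r n)%N) ->
  (fun n => (s n)%:R : R) =o_\oo (fun n => (r n)%:R : R) ->
  (fun n => (r n)%:R : R) =o_\oo (fun n => n%:R : R) ->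
  (* (2) *)
  (forall n i g (B : set R), (1 <= i <= m n)%N -> measurable B ->
     FX n (i.-1 * r n).+1 (i * r n + s n - 1)%N (V n i g @^-1` B) /\
     FX n (i.-1 * r n).+1 (i * r n + s n - 1)%N (Vt n i g @^-1` B)) ->
  (forall n, stationary_row P (m n) (fun i g w => (V n i g w, Vt n i g w))) ->
  (* (3) *)
  ((fun n => (m n)%:R%:E * beta_mixing P (m n) (FVt n) 0)%E @ \oo --> 0%E) ->
  (* (4) *)
  (exists2 k : nat, (2 <= k)%N &
     (fun n => (m n)%:R%:E *
        beta_mixing P n (FX n) (k.-1 * r n - s n)%N)%E @ \oo --> 0%E) ->
  (* (5) *)
  (forall g,
     (fun n => fine 'E_P[fun w => (DeltaC n g w) ^+ 2 *
        \1_[set w | `|DeltaC n g w| <= Num.sqrt (p n)] w])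
       =o_\oo (fun n => p n / (m n)%:R)) ->
  (forall g,
     (fun n => fine (P [set w | `|DeltaC n g w| > Num.sqrt (p n)]))
       =o_\oo (fun n => ((m n)%:R)^-1 : R)) ->
  (* (6) *)
  (forall g (eps : R), 0 < eps ->
     (fun n => fine 'E_P[fun w => (VC n g w) ^+ 2 *
        \1_[set w | `|VC n g w| > eps * Num.sqrt (p n)] w])
       =o_\oo (fun n => p n / (m n)%:R)) ->
  (* (7) *)
  (forall n, separable_process P (V0 n)) ->
  (* (8) *)
  (forall g h,
     (fun n => (m n)%:R / p n * fine (covariance P (V0 n g) (V0 n h))) @ \oo
       --> c g h) ->
  forall (q : nat) (g : 'I_q -> G),
    exists (d' : measure_display) (T' : measurableType d')
           (Q : probability T' R) (Y : 'I_q -> {RV Q >-> R}),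
      centered_gaussian_process Y (fun i j => c (g i) (g j)) /\
      cvg_law P Q (fun n j => Z n (g j)) Y.
Proof.
move=> m p FX FVt VC Delta DeltaC Z law0 V02 Vt01 _ _ r0 sr rn blockV stV bVt.
move=> [k k2 bX] diff_head diff_prob lind _ cov q g.
have p_ge0 n : 0 <= p n by apply: fine_ge0; exact: mu_ext_ge0.
pose Vf n i h : T -> R := V n i h; pose Vtf n i h : T -> R := Vt n i h.
pose V0f n h : T -> R := V0 n h; pose Vt0f n h : T -> R := Vt0 n h.
have mV n i h : measurable_fun setT (Vf n i h) by exact: measurable_funPT.
have mVt n i h : measurable_fun setT (Vtf n i h) by exact: measurable_funPT.
have mV0 n h : measurable_fun setT (V0f n h) by exact: measurable_funPT.
have mVt0 n h : measurable_fun setT (Vt0f n h) by exact: measurable_funPT.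
have iV0 n h : intg P (V0f n h) by exact: (intg_Lfun2 (V02 n h)).
have iV02 n h : intg P (fun w => V0f n h w ^+ 2) by exact: (intg_sqr_Lfun2 (V02 n h)).
have iVt0 n h : intg P (Vt0f n h) by exact: (intg_Lfun1 (Vt01 n h)).
pose a n : R := (Num.sqrt (p n))^-1; pose c' i j := c (g i) (g j).
have m_large := block_count_large r0 sr rn.
have m_gt0 := m_large 1%N.
have law n i : (i < m n)%N ->
    same_law P (fun h w => (V0f n h w, Vt0f n h w))
               (fun h w => (Vf n i.+1 h w, Vtf n i.+1 h w)).
  move=> im; apply: same_law_trans (law0 n _) _; first exact: leq_ltn_trans im.
  exact: (stationary_row_law (stV n) im).
have VCE n j w : scaled_V P V0f a g n j (path0 V0f Vt0f n w) = a n * VC n (g j) w.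
  by rewrite /scaled_V /VC expectation_Ex.
have DCE n j w : scaled_diff P V0f Vt0f a g n j (path0 V0f Vt0f n w) =
    a n * DeltaC n (g j) w.
  by rewrite /scaled_diff /DeltaC expectation_Ex.
have mVC n h : measurable_fun setT (VC n h) by exact: measurable_funB.
have mDC n h : measurable_fun setT (DeltaC n h).
  by apply: measurable_funB => //; exact: measurable_funB.
have iVC2 n h : intg P (fun w => VC n h w ^+ 2).
  exact: (intg_sqrD (mV0 n h) (measurable_cst _) (iV02 n h) (intg_cst P ((- fine 'E_P[V0 n h]) ^+ 2))).
have diff_small j : negl m (fun n => Ex P (fun w =>
    scaled_diff P V0f Vt0f a g n j (path0 V0f Vt0f n w) ^+ 2 *
    (`|scaled_diff P V0f Vt0f a g n j (path0 V0f Vt0f n w)| <= 1)%R%:R)).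
  rewrite (_ : (fun n => _) = (fun n => Ex P (fun w => (a n * DeltaC n (g j) w) ^+ 2 *
    (`|a n * DeltaC n (g j) w| <= 1)%R%:R))).
    exact: (@negl_scaled_head _ _ _ P m p p_ge0 (fun n => DeltaC n (g j))).
  by apply/funext => n; apply: eq_Ex => w; rewrite DCE.
have diff_tail j : negl m (fun n => Ex P (fun w =>
    (1 < `|scaled_diff P V0f Vt0f a g n j (path0 V0f Vt0f n w)|)%R%:R)).
  rewrite (_ : (fun n => _) =
    (fun n => Ex P (fun w => (1 < `|a n * DeltaC n (g j) w|)%R%:R))).
    exact: (@negl_scaled_probability _ _ _ P m p p_ge0 (fun n => DeltaC n (g j))).
  by apply/funext => n; apply: eq_Ex => w; rewrite DCE.
have lindeberg j e : 0 < e -> negl m (fun n => Ex P (fun w =>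
    scaled_V P V0f a g n j (path0 V0f Vt0f n w) ^+ 2 *
    (e < `|scaled_V P V0f a g n j (path0 V0f Vt0f n w)|)%R%:R)).
  move=> e0; rewrite (_ : (fun n => _) = (fun n => Ex P (fun w =>
    (a n * VC n (g j) w) ^+ 2 * (e < `|a n * VC n (g j) w|)%R%:R))).
    by apply: (@negl_scaled_tail _ _ _ P m p p_ge0 (fun n => VC n (g j))) => //;
      exact: lind.
  by apply/funext => n; apply: eq_Ex => w; rewrite VCE.
have cov_cvg i j : (fun n => (m n)%:R * Ex P (fun w =>
    scaled_V P V0f a g n i (path0 V0f Vt0f n w) *
    scaled_V P V0f a g n j (path0 V0f Vt0f n w))) @ \oo --> c' i j.
  rewrite (_ : (fun n => _) = (fun n =>
    (m n)%:R / p n * fine (covariance P (V0 n (g i)) (V0 n (g j))))); first exact: cov.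
  (* The identity (a n)^2 = 1 / p n used here also holds when p n = 0, both sides being 0. *)
  apply/funext => n; rewrite fine_covariance -mulrA; congr (_ * _).
  rewrite -ExZ; last first.
    by have := intgM_sqr (mVC n (g i)) (mVC n (g j)) (iVC2 n (g i)) (iVC2 n (g j));
      rewrite /VC !expectation_Ex.
  apply: eq_Ex => w; rewrite !VCE /VC !expectation_Ex mulrACA.
  by rewrite -expr2 exprVn sqr_sqrtr.
have sym i j : c' i j = c' j i.
  have h := cov_cvg i j; have h' := cov_cvg j i.
  rewrite (_ : (fun n => _) = (fun n => (m n)%:R * Ex P (fun w =>
    scaled_V P V0f a g n i (path0 V0f Vt0f n w) *
    scaled_V P V0f a g n j (path0 V0f Vt0f n w)))) in h'.
    exact: cvg_unique h h'.
  by apply/funext => n; congr (_ * _); apply: eq_Ex => w; rewrite mulrC.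
have psd t : 0 <= qform c' t by exact: (limit_qform_ge0 mV0 iV02 t cov_cvg).
have [d' [T' [Q [Y [Ygauss Ychar]]]]] := exists_gaussian_process sym psd.
exists d', T', Q, Y; split => //; apply: charfn_cvg_law.
- move=> n j; apply: measurable_funM => //; apply: measurable_sum => i.
  exact: measurable_funB.
- by move=> j; exact: measurable_funPT.
move=> th t; rewrite Ychar mulrC.
have meanV n i h : (i < m n)%N -> fine 'E_P[V n i.+1 h] = Ex P (V0f n h).
  move=> im; rewrite expectation_Ex.
  apply: (transfer_Ex mV mVt mV0 mVt0 law im (phi := fun f => (f h).1)).
  exact: (measurableT_comp measurable_fst (measurable_coordinate h)).
have ZE n w : \sum_j t j * Z n (g j) w =
    \sum_(i < m n) row_V P V0f a g t n (path_ Vf Vtf n i.+1 w).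
  rewrite /row_V exchange_big/=; apply: eq_bigr => j _.
  rewrite -mulr_sumr; congr (_ * _); rewrite /Z -mulr_sumr; congr (_ * _).
  by rewrite big_add1 big_mkord; apply: eq_bigr => i _; rewrite meanV.
rewrite (_ : (fun n => _) = (fun n => Ex P (fun w => cos (th +
    \sum_(i < m n) row_V P V0f a g t n (path_ Vf Vtf n i.+1 w))))); last first.
  by apply/funext => n; apply: eq_Ex => w; rewrite ZE.
apply: (row_V_charfn_cvg mV mVt mV0 mVt0 iV0 iV02 iVt0 law m_large diff_small
  diff_tail lindeberg cov_cvg (ltnW k2)) => e e0.
- have Hb := eventually_le_div e0 m_gt0 bVt; near=> n.
  have mn : (0 < m n)%N by near: n.
  apply: (@mixing_sums_row_Vt _ _ _ P G (Vf n) (Vtf n) V0f Vt0f a q g t n).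
  + exact: mVt.
  + by rewrite divr_ge0// ltW.
  + by near: n.
- have Hb := eventually_le_div e0 m_gt0 bX; move/eqoP : sr => /(_ 1 ltr01) sr1.
  near=> n; move=> l lk.
  have mn : (0 < m n)%N by near: n.
  have srn : (s n <= r n)%N.
    have : `|(s n)%:R : R| <= 1 * `|(r n)%:R : R| by near: n.
    by rewrite mul1r !ger0_norm// ler_nat.
  apply: (@mixing_sums_row_diff _ _ _ P G (Vf n) (Vtf n) V0f Vt0f a q g t n _
    (borel E) (X n) _ (r n) (s n) n (m n)).
  + by move=> i; exact: measurable_funPT.
  + exact: r0.
  (* The last block ends at observation m r + s - 1 <= n; [m n > 0] ensures that the subtraction n +
     1 - s is not cut off at 0. *)
  + have mr : (m n * r n <= n.+1 - s n)%N by exact: leq_divM.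
    rewrite -(leq_add2r (s n)) subnK in mr => //.
    rewrite leqNgt; apply/negP => ns; move: mn.
    by rewrite /m (eqP (_ : n.+1 - s n == 0)%N) ?div0n// subn_eq0 ltnW.
  + by move=> i h B iN mB; exact: blockV.
  + by rewrite divr_ge0// ltW.
  + exact: k2.
  + exact: lk.
  (* s <= r <= (k - 1) r, so that the gap in (4) is a genuine difference. *)
  + by rewrite (leq_trans srn)// leq_pmull//; case: (k) k2 => [|[]].
  + by near: n.
Unshelve. all: by end_near. Qed.
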